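(* Let $k$ be a field, $n \ge 3$, and let $G$ be a simple graph on the vertex set $\{1,\dots,n\}$. Then $I_G^m$ is a Cohen-Macaulay ideal for some $m \ge 3$ if and only if $I_G$ is a complete intersection.
   Context: Let $S = k[x_1,\dots,x_n]$ be a polynomial ring. A simple graph here means a finite undirected graph without multiple edges, without loops and without isolated vertices (every vertex in $\{1,\dots,n\}$ belongs to an edge). We write $\{i,j\}\in G$ if $\{i,j\}$ is an edge of $G$. For $i \ne j$ put $P_{ij} = (x_t \mid t \ne i,j)$, the prime ideal of $S$ generated by all variables other than $x_i,x_j$. Define $I_G = \bigcap_{\{i,j\}\in G} P_{ij}$; $I_G^m$ denotes the ordinary $m$-th power. An ideal $I$ of $S$ is called Cohen-Macaulay if $S/I$ is a Cohen-Macaulay ring, and a complete intersection if it is generated by a regular sequence. *)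

(* Defs.v *)
From HB Require Import structures.
From mathcomp Require Import all_boot all_algebra generic_quotient ring.
From mathcomp Require Import boolp.
From mathcomp Require Import mpoly.

Set Implicit Arguments.
Unset Strict Implicit.
Unset Printing Implicit Defensive.

Import GRing.Theory.

Local Open Scope ring_scope.
Local Open Scope quotient_scope.

(* Ideals are Prop-valued and may be the whole ring: the decidable proper      *)
(* ideals of ring_quotient.v exclude generated ideals and intersections.       *)
Record ideal (R : comPzRingType) := Ideal {
  ideal_mem :> R -> Prop;
  ideal0 : ideal_mem 0;
  idealD : forall x y, ideal_mem x -> ideal_mem y -> ideal_mem (x + y);
  idealM : forall a x, ideal_mem x -> ideal_mem (a * x)
}.

Section Ideals.
Variable R : comPzRingType.
Implicit Types (I J : ideal R) (A : R -> Prop).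

Definition ideal_sub I J := forall x, I x -> J x.
Definition ideal_eq I J := forall x, I x <-> J x.

Definition prime_ideal I := ~ I 1 /\ forall a b, I (a * b) -> I a \/ I b.

Definition maximal_ideal I :=
  ~ I 1 /\ forall J, ideal_sub I J -> ~ J 1 -> ideal_sub J I.

Definition gen_mem A (x : R) := forall J, (forall y, A y -> J y) -> J x.

Lemma gen0 A : gen_mem A 0.
Proof. by move=> J _; apply: ideal0. Qed.

Lemma genD A x y : gen_mem A x -> gen_mem A y -> gen_mem A (x + y).
Proof. by move=> Ax Ay J AJ; apply: idealD; [apply: Ax | apply: Ay]. Qed.

Lemma genM A a x : gen_mem A x -> gen_mem A (a * x).
Proof. by move=> Ax J AJ; apply: idealM; apply: Ax. Qed.

Definition ideal_gen A : ideal R := Ideal (@gen0 A) (@genD A) (@genM A).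

Definition ideal_seq (s : seq R) : ideal R := ideal_gen (fun x => x \in s).

Definition ideal_exp I (m : nat) : ideal R :=
  ideal_gen (fun x => exists2 f : 'I_m -> R,
               (forall i, I (f i)) & x = \prod_(i < m) f i).

Definition noetherian := forall I, exists s : seq R, ideal_eq I (ideal_seq s).

Definition prime_chain (d : nat) :=
  exists c : nat -> ideal R,
    (forall i, (i <= d)%N -> prime_ideal (c i)) /\
    (forall i, (i < d)%N -> ideal_sub (c i) (c i.+1) /\ ~ ideal_sub (c i.+1) (c i)).

Definition krull_dim (d : nat) :=
  prime_chain d /\ forall e, prime_chain e -> (e <= d)%N.

Definition regular_sequence (s : seq R) :=
  ~ ideal_seq s 1 /\
  forall i b, (i < size s)%N ->
    ideal_seq (take i s) (s`_i * b) -> ideal_seq (take i s) b.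

Definition complete_intersection I :=
  exists2 s : seq R, regular_sequence s & ideal_eq I (ideal_seq s).

Definition regular_in I (s : seq R) :=
  regular_sequence s /\ forall x, x \in s -> I x.

Definition depth I (d : nat) :=
  (exists2 s, regular_in I s & size s = d) /\
  forall s, regular_in I s -> (size s <= d)%N.

Lemma idealN I x : I x -> I (- x).
Proof. by move=> Ix; rewrite -mulN1r; apply: idealM. Qed.

Lemma maximal_prime I : maximal_ideal I -> prime_ideal I.
Proof.
move=> [I1 maxI]; split=> // a b Iab.
case: (EM (I a)) => [|nIa]; [by left | right].
pose K x := exists y r, I y /\ x = y + r * a.
have K0 : K 0 by exists 0, 0; split; [exact: ideal0 | rewrite mul0r addr0].
have KD x y : K x -> K y -> K (x + y).
  move=> [u [r [Iu ->]]] [v [t [Iv ->]]]; exists (u + v), (r + t).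
  by split; [exact: idealD | rewrite mulrDl addrACA].
have KM c x : K x -> K (c * x).
  move=> [u [r [Iu ->]]]; exists (c * u), (c * r).
  by split; [exact: idealM | rewrite mulrDr mulrA].
case: (EM (K 1)) => [[u [r [Iu e1]]] | nK1].
  have -> : b = b * u + r * (a * b) by rewrite -{1}[b]mul1r e1; ring.
  by apply: idealD; apply: idealM.
case: nIa; apply: (maxI (Ideal K0 KD KM) _ nK1).
- by move=> x Ix; exists x, 0; split=> //; rewrite mul0r addr0.
- by exists 0, 1; split; [exact: ideal0 | rewrite add0r mul1r].
Qed.

End Ideals.

Section QuotientRing.
Variables (R : comPzRingType) (I : ideal R).

Definition quot_rel : rel R := fun x y => `[< I (x - y) >].

Lemma quot_refl : reflexive quot_rel.
Proof. by move=> x; apply/asboolP; rewrite subrr; exact: ideal0. Qed.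

Lemma quot_sym : ssrbool.symmetric quot_rel.
Proof.
by move=> x y; apply/asboolP/asboolP => /idealN; rewrite opprB.
Qed.

Lemma quot_trans : transitive quot_rel.
Proof.
move=> y x z /asboolP xy /asboolP yz; apply/asboolP.
by have := idealD xy yz; rewrite addrA subrK.
Qed.

Canonical quot_equiv := EquivRel quot_rel quot_refl quot_sym quot_trans.

Definition quot_ring := {eq_quot quot_rel}.

HB.instance Definition _ := EqQuotient.on quot_ring.
HB.instance Definition _ := Choice.on quot_ring.

Definition quot_zero : quot_ring := lift_cst quot_ring 0.
Definition quot_one : quot_ring := lift_cst quot_ring 1.
Definition quot_add := lift_op2 quot_ring (fun x y : R => x + y).
Definition quot_opp := lift_op1 quot_ring (fun x : R => - x).
Definition quot_mul := lift_op2 quot_ring (fun x y : R => x * y).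

Canonical pi_quot_zero := PiConst quot_zero.
Canonical pi_quot_one := PiConst quot_one.

Lemma quot_reprP x : I (repr (\pi_quot_ring x) - x).
Proof. by apply/asboolP; have /eqmodP := reprK (\pi_quot_ring x). Qed.

Lemma pi_quot_addM : {morph \pi_quot_ring : x y / x + y >-> quot_add x y}.
Proof.
move=> x y; unlock quot_add; apply/eqmodP; rewrite /= quot_sym; apply/asboolP.
by have := idealD (quot_reprP x) (quot_reprP y); rewrite addrACA opprD.
Qed.
Canonical pi_quot_add := PiMorph2 pi_quot_addM.

Lemma pi_quot_oppM : {morph \pi_quot_ring : x / - x >-> quot_opp x}.
Proof.
move=> x; unlock quot_opp; apply/eqmodP; rewrite /= quot_sym; apply/asboolP.
by have := idealN (quot_reprP x); rewrite opprD.
Qed.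
Canonical pi_quot_opp := PiMorph1 pi_quot_oppM.

Lemma pi_quot_mulM : {morph \pi_quot_ring : x y / x * y >-> quot_mul x y}.
Proof.
move=> x y; unlock quot_mul; apply/eqmodP; rewrite /= quot_sym; apply/asboolP.
set x' := repr _; set y' := repr _.
have -> : x' * y' - x * y = y' * (x' - x) + x * (y' - y) by ring.
by apply: idealD; apply: idealM; apply: quot_reprP.
Qed.
Canonical pi_quot_mul := PiMorph2 pi_quot_mulM.

Lemma quot_addA : associative quot_add.
Proof. by do 3![elim/quotW=> ?]; rewrite !piE addrA. Qed.

Lemma quot_addC : commutative quot_add.
Proof. by do 2![elim/quotW=> ?]; rewrite !piE addrC. Qed.

Lemma quot_add0 : left_id quot_zero quot_add.
Proof. by elim/quotW=> ?; rewrite !piE add0r. Qed.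

Lemma quot_addN : left_inverse quot_zero quot_opp quot_add.
Proof. by elim/quotW=> ?; rewrite !piE addNr. Qed.

HB.instance Definition _ :=
  GRing.isZmodule.Build quot_ring quot_addA quot_addC quot_add0 quot_addN.

Lemma quot_mulA : associative quot_mul.
Proof. by do 3![elim/quotW=> ?]; rewrite !piE mulrA. Qed.

Lemma quot_mulC : commutative quot_mul.
Proof. by do 2![elim/quotW=> ?]; rewrite !piE mulrC. Qed.

Lemma quot_mul1 : left_id quot_one quot_mul.
Proof. by elim/quotW=> ?; rewrite !piE mul1r. Qed.

Lemma quot_mulD : left_distributive quot_mul quot_add.
Proof. by do 3![elim/quotW=> ?]; rewrite !piE mulrDl. Qed.

HB.instance Definition _ :=
  GRing.Zmodule_isComPzRing.Build quot_ring
    quot_mulA quot_mulC quot_mul1 quot_mulD.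

Definition to_quot (x : R) : quot_ring := \pi_quot_ring x.

Lemma to_quot_zmod : zmod_morphism to_quot.
Proof. by move=> x y; rewrite /to_quot pi_quot_addM pi_quot_oppM. Qed.

Lemma to_quot_monoid : monoid_morphism to_quot.
Proof. by split=> [|x y]; rewrite /to_quot ?pi_quot_mulM ?piE. Qed.

HB.instance Definition _ :=
  GRing.isZmodMorphism.Build R quot_ring to_quot to_quot_zmod.
HB.instance Definition _ :=
  GRing.isMonoidMorphism.Build R quot_ring to_quot to_quot_monoid.

Lemma to_quot_surj (y : quot_ring) : exists x, y = to_quot x.
Proof. by elim/quotW: y => x; exists x. Qed.

Lemma to_quot_eq0 x : to_quot x = 0 <-> I x.
Proof.
have -> : 0 = to_quot 0 by rewrite raddf0.
split=> [/eqmodP/asboolP | Ix]; first by rewrite subr0.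
by apply/eqmodP/asboolP; rewrite subr0.
Qed.

End QuotientRing.

Section Localization.
Variables (R : comPzRingType) (p : ideal R) (pP : prime_ideal p).

Definition denom := {s : R | `[< ~ p s >]}.

Definition den (s : denom) : R := val s.

Lemma denP (s : denom) : ~ p (den s).
Proof. exact/asboolP/(valP s). Qed.

Lemma den1_proof : `[< ~ p 1 >].
Proof. by apply/asboolP; case: pP. Qed.

Definition den1 : denom := exist _ 1 den1_proof.

Lemma denM_proof (s t : denom) : `[< ~ p (den s * den t) >].
Proof. by apply/asboolP => /(proj2 pP)[]; exact: denP. Qed.

Definition denM (s t : denom) : denom := exist _ (den s * den t) (denM_proof s t).

Lemma denE : (den den1 = 1) * (forall s t, den (denM s t) = den s * den t).
Proof. by []. Qed.

(* The pair (a, s) stands for a / s; the factor u is needed as R may have      *)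
(* zero divisors.                                                              *)
Definition loc_eqv (x y : R * denom) :=
  exists u : denom, den u * (x.1 * den y.2) = den u * (y.1 * den x.2).

Definition loc_rel : rel (R * denom) := fun x y => `[< loc_eqv x y >].

Lemma loc_refl : reflexive loc_rel.
Proof. by move=> x; apply/asboolP; exists den1. Qed.

Lemma loc_sym : ssrbool.symmetric loc_rel.
Proof. by move=> x y; apply/asboolP/asboolP => -[u e]; exists u. Qed.

Lemma loc_trans : transitive loc_rel.
Proof.
move=> [b t] [a s] [c r] /asboolP[u /= e] /asboolP[v /= f].
apply/asboolP; exists (denM (denM u v) t); rewrite /= !denE.
transitivity (den v * den r * (den u * (a * den t))); first by ring.
by rewrite e; transitivity (den u * den s * (den v * (b * den r)));
  [ring | rewrite f; ring].
Qed.

Canonical loc_equiv := EquivRel loc_rel loc_refl loc_sym loc_trans.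

Definition localization := {eq_quot loc_rel}.

HB.instance Definition _ := EqQuotient.on localization.
HB.instance Definition _ := Choice.on localization.

Definition add_frac (x y : R * denom) : R * denom :=
  (x.1 * den y.2 + y.1 * den x.2, denM x.2 y.2).
Definition opp_frac (x : R * denom) : R * denom := (- x.1, x.2).
Definition mul_frac (x y : R * denom) : R * denom := (x.1 * y.1, denM x.2 y.2).

Definition loc_zero : localization := lift_cst localization (0, den1).
Definition loc_one : localization := lift_cst localization (1, den1).
Definition loc_add := lift_op2 localization add_frac.
Definition loc_opp := lift_op1 localization opp_frac.
Definition loc_mul := lift_op2 localization mul_frac.

Canonical pi_loc_zero := PiConst loc_zero.
Canonical pi_loc_one := PiConst loc_one.

Lemma loc_reprP x : loc_eqv (repr (\pi_localization x)) x.
Proof. by apply/asboolP; have /eqmodP := reprK (\pi_localization x). Qed.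

Lemma loc_eqP x y : loc_eqv x y -> \pi_localization x = \pi_localization y.
Proof. by move=> e; apply/eqmodP; apply/asboolP. Qed.

Lemma pi_loc_addM :
  {morph \pi_localization : x y / add_frac x y >-> loc_add x y}.
Proof.
move=> x y; unlock loc_add; apply/esym/loc_eqP.
case: (loc_reprP x) (loc_reprP y) => u; set x' := repr _ => e [v].
set y' := repr _ => f; exists (denM u v); rewrite /= !denE.
transitivity (den v * den y.2 * den y'.2 * (den u * (x'.1 * den x.2))
              + den u * den x.2 * den x'.2 * (den v * (y'.1 * den y.2))).
  by ring.
by rewrite e f; ring.
Qed.
Canonical pi_loc_add := PiMorph2 pi_loc_addM.

Lemma pi_loc_oppM : {morph \pi_localization : x / opp_frac x >-> loc_opp x}.
Proof.
move=> x; unlock loc_opp; apply/esym/loc_eqP.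
by case: (loc_reprP x) => u e; exists u; rewrite /= !mulNr !mulrN e.
Qed.
Canonical pi_loc_opp := PiMorph1 pi_loc_oppM.

Lemma pi_loc_mulM :
  {morph \pi_localization : x y / mul_frac x y >-> loc_mul x y}.
Proof.
move=> x y; unlock loc_mul; apply/esym/loc_eqP.
case: (loc_reprP x) (loc_reprP y) => u; set x' := repr _ => e [v].
set y' := repr _ => f; exists (denM u v); rewrite /= !denE.
transitivity ((den u * (x'.1 * den x.2)) * (den v * (y'.1 * den y.2))).
  by ring.
by rewrite e f; ring.
Qed.
Canonical pi_loc_mul := PiMorph2 pi_loc_mulM.

Lemma loc_addA : associative loc_add.
Proof.
do 3![elim/quotW=> ?]; rewrite !piE; apply: loc_eqP; exists den1.
by rewrite /= !denE; ring.
Qed.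

Lemma loc_addC : commutative loc_add.
Proof.
do 2![elim/quotW=> ?]; rewrite !piE; apply: loc_eqP; exists den1.
by rewrite /= !denE; ring.
Qed.

Lemma loc_add0 : left_id loc_zero loc_add.
Proof.
elim/quotW=> ?; rewrite !piE; apply: loc_eqP; exists den1.
by rewrite /= !denE; ring.
Qed.

Lemma loc_addN : left_inverse loc_zero loc_opp loc_add.
Proof.
elim/quotW=> ?; rewrite !piE; apply: loc_eqP; exists den1.
by rewrite /= !denE; ring.
Qed.

HB.instance Definition _ :=
  GRing.isZmodule.Build localization loc_addA loc_addC loc_add0 loc_addN.

Lemma loc_mulA : associative loc_mul.
Proof.
do 3![elim/quotW=> ?]; rewrite !piE; apply: loc_eqP; exists den1.
by rewrite /= !denE; ring.
Qed.

Lemma loc_mulC : commutative loc_mul.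
Proof.
do 2![elim/quotW=> ?]; rewrite !piE; apply: loc_eqP; exists den1.
by rewrite /= !denE; ring.
Qed.

Lemma loc_mul1 : left_id loc_one loc_mul.
Proof.
elim/quotW=> ?; rewrite !piE; apply: loc_eqP; exists den1.
by rewrite /= !denE; ring.
Qed.

Lemma loc_mulD : left_distributive loc_mul loc_add.
Proof.
do 3![elim/quotW=> ?]; rewrite !piE; apply: loc_eqP; exists den1.
by rewrite /= !denE; ring.
Qed.

HB.instance Definition _ :=
  GRing.Zmodule_isComPzRing.Build localization
    loc_mulA loc_mulC loc_mul1 loc_mulD.

Definition to_loc (a : R) : localization := \pi_localization (a, den1).

Lemma to_loc_zmod : zmod_morphism to_loc.
Proof.
move=> a b; rewrite /to_loc -[X in _ = _ + X]pi_loc_oppM -[RHS]pi_loc_addM.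
by apply: loc_eqP; exists den1; rewrite /= !denE; ring.
Qed.

Lemma to_loc_monoid : monoid_morphism to_loc.
Proof.
split=> [|a b]; first by rewrite /to_loc [RHS]piE.
rewrite /to_loc -[RHS]pi_loc_mulM.
by apply: loc_eqP; exists den1; rewrite /= !denE; ring.
Qed.

HB.instance Definition _ :=
  GRing.isZmodMorphism.Build R localization to_loc to_loc_zmod.
HB.instance Definition _ :=
  GRing.isMonoidMorphism.Build R localization to_loc to_loc_monoid.

Lemma to_loc_inv s : ~ p s -> exists z, z * to_loc s = 1.
Proof.
move=> nps; have ds : `[< ~ p s >] by exact/asboolP.
exists (\pi_localization (1, exist _ s ds)).
rewrite -(rmorph1 to_loc) /to_loc -[LHS]pi_loc_mulM; apply: loc_eqP.
by exists den1; rewrite /= !denE /den /=; ring.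
Qed.

Lemma to_loc_surj (z : localization) :
  exists a s, ~ p s /\ z * to_loc s = to_loc a.
Proof.
elim/quotW: z => -[a s]; exists a, (den s); split; first exact: denP.
rewrite /to_loc -[LHS]pi_loc_mulM; apply: loc_eqP.
by exists den1; rewrite /= !denE; ring.
Qed.

Lemma to_loc_eq0 a : to_loc a = 0 <-> exists2 s, ~ p s & s * a = 0.
Proof.
rewrite -(rmorph0 to_loc) /to_loc; split=> [/eqmodP/asboolP[u] /=|[s nps sa0]].
  by rewrite !denE mulr1 mul0r mulr0 => e; exists (den u); first exact: denP.
have ds : `[< ~ p s >] by exact/asboolP.
by apply: loc_eqP; exists (exist _ s ds); rewrite /= !denE mulr1 mul0r mulr0.
Qed.

(* p R_p, the maximal ideal of the local ring R_p *)
Definition loc_maximal : ideal localization :=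
  ideal_gen (fun x => exists2 a, p a & x = to_loc a).

End Localization.

(* The localizations need only be tested at maximal ideals; the common value d *)
(* of dimension and depth depends on p.                                        *)
Definition cohen_macaulay_ring (R : comPzRingType) :=
  noetherian R /\
  forall (p : ideal R) (pmax : maximal_ideal p),
    exists2 d, krull_dim (localization (maximal_prime pmax)) d
             & depth (loc_maximal (maximal_prime pmax)) d.

Definition cohen_macaulay_ideal (R : comPzRingType) (I : ideal R) :=
  cohen_macaulay_ring (quot_ring I).

Definition simple_graph (n : nat) (G : rel 'I_n) :=
  [/\ ssrbool.symmetric G, irreflexive G & forall i, exists j, G i j].

Section GraphIdeal.
Variables (k : fieldType) (n : nat).

Definition edge_prime (i j : 'I_n) : ideal {mpoly k[n]} :=
  ideal_gen (fun f => exists t : 'I_n, [/\ t != i, t != j & f = 'X_t]).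

Variable G : rel 'I_n.

Definition graph_mem (f : {mpoly k[n]}) := forall i j, G i j -> edge_prime i j f.

Lemma graph0 : graph_mem 0.
Proof. by move=> i j _; exact: ideal0. Qed.

Lemma graphD f g : graph_mem f -> graph_mem g -> graph_mem (f + g).
Proof. by move=> If Ig i j Gij; apply: idealD; [exact: If | exact: Ig]. Qed.

Lemma graphM a f : graph_mem f -> graph_mem (a * f).
Proof. by move=> If i j Gij; apply: idealM; exact: If. Qed.

Definition graph_ideal : ideal {mpoly k[n]} := Ideal graph0 graphD graphM.

End GraphIdeal.

(* Main.v *)
(* A complete intersection I_G has few generators: comparing a regular sequence
   of generators with chains of primes gives at most n - 2 of them, and counting
   independent classes in I_G/mI_G at the coordinate points and at the origin
   leaves only n = 3 and the 4-cycle.  There I_G is generated by monomials p, q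
   with disjoint supports (q = 0 if n = 3), and S/I_G^m is filtered by the
   planes S/P_ij.  A maximal ideal contains polynomials F1(u), F2(v) in
   u = sum x_i and v = - sum_{i<j} x_i x_j, by Zariski's lemma, and these form a
   regular sequence on every plane, hence on S/I_G^m.

   Conversely, if S/I_G^m is Cohen-Macaulay then its local ring at the origin has
   depth at least 2, so sections over the punctured spectrum extend.  Applied to
   sections that are a monomial on some of the sets D(x_t) and 0 on the others,
   this forbids vertices of degree 3, and for m >= 3 it forces any two disjoint
   edges to lie in a 4-cycle; again only n = 3 and the 4-cycle survive. *)

From HB Require Import structures.
From mathcomp Require Import all_boot all_order all_algebra ring zify.
From mathcomp Require Import boolp classical_sets.
From mathcomp Require Import mpoly.
Require Import Defs.

Set Implicit Arguments.
Unset Strict Implicit.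
Unset Printing Implicit Defensive.

Import Order.TTheory GRing.Theory.

Local Open Scope ring_scope.

(** * Ideals and chains of primes *)

(** Since k is arbitrary, maximal ideals need not be points, and one regular sequence has to be
    found at each of them that works on all planes at once. Symmetric functions provide it: on every
    plane u and v restrict to x_i + x_j and - x_i x_j, over which both coordinates are integral, so
    it is enough that F1 and F2 are monic. A regular sequence in a prime produces a chain of primes
    of the same length. Hence depth never exceeds dimension, and dimension 2 needs only one regular
    pair and an upper bound for chains. That bound comes from counting monomials, in place of
    transcendence degrees. In the converse, gluing conditions live on the sets D(x_s x_t), where
    I_G^m is P_st^m or the unit ideal, so they only ask for the order of a monomial along P_st. That
    a monomial lies outside I_G^m is read off a monomial valuation. The bound m >= 3 enters because
    a product of two variables has to stay outside P_ab^m. *)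

Section IdealFacts.
Variable R : comPzRingType.
Implicit Types (I J Q : ideal R) (A : R -> Prop) (s : seq R).

Lemma idealB J x y : J x -> J y -> J (x - y).
Proof. by move=> Jx Jy; apply: idealD => //; apply: idealN. Qed.

Lemma idealMr J a x : J x -> J (x * a).
Proof. by move=> Jx; rewrite mulrC; apply: idealM. Qed.

Lemma ideal_sum J (T : Type) (r : seq T) (P : pred T) (F : T -> R) :
  (forall i, P i -> J (F i)) -> J (\sum_(i <- r | P i) F i).
Proof.
by move=> JF; apply: big_ind => //; [exact: ideal0 | exact: idealD].
Qed.

Lemma mem_ideal_gen A x : A x -> ideal_gen A x.
Proof. by move=> Ax J; apply. Qed.

Lemma ideal_gen_sub A J : (forall x, A x -> J x) -> ideal_sub (ideal_gen A) J.
Proof. by move=> AJ x; apply. Qed.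

Lemma prime_ideal_expr Q x m : prime_ideal Q -> Q (x ^+ m) -> Q x.
Proof.
move=> [Q1 QM]; elim: m => [|m IH]; first by rewrite expr0 => /Q1.
by rewrite exprS => /QM[].
Qed.

Lemma prime_ideal_prod Q (T : eqType) (r : seq T) (F : T -> R) :
  prime_ideal Q -> Q (\prod_(i <- r) F i) -> exists2 i, i \in r & Q (F i).
Proof.
move=> [Q1 QM]; elim: r => [|i r IH]; first by rewrite big_nil => /Q1.
rewrite big_cons => /QM[Qi|/IH[j jr Qj]]; first by exists i; rewrite ?mem_head.
by exists j; rewrite // inE jr orbT.
Qed.

Section AddGen.
Variables (J : ideal R) (z : R).

Definition add_gen_mem x := exists a b, J a /\ x = a + z * b.

Lemma add_gen0 : add_gen_mem 0.
Proof. by exists 0, 0; split; [exact: ideal0 | ring]. Qed.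

Lemma add_genD x y : add_gen_mem x -> add_gen_mem y -> add_gen_mem (x + y).
Proof.
move=> [a [b [Ja ->]]] [c [d [Jc ->]]]; exists (a + c), (b + d).
by split; [exact: idealD | ring].
Qed.

Lemma add_genM c x : add_gen_mem x -> add_gen_mem (c * x).
Proof.
move=> [a [b [Ja ->]]]; exists (c * a), (c * b).
by split; [exact: idealM | ring].
Qed.

Definition add_gen : ideal R := @Ideal R add_gen_mem add_gen0 add_genD add_genM.

Lemma add_gen_sub : ideal_sub J add_gen.
Proof. by move=> x Jx; exists x, 0; split=> //; ring. Qed.

Lemma add_gen_in : add_gen z.
Proof. by exists 0, 1; split; [exact: ideal0 | ring]. Qed.

End AddGen.

Lemma ideal_seq_nil (x : R) : ideal_seq [::] x <-> x = 0.
Proof.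
split=> [|->]; last exact: ideal0.
have ZD a b : a = 0 -> b = 0 -> a + b = 0 :> R by move=> -> ->; rewrite addr0.
have ZM a b : b = 0 -> a * b = 0 :> R by move=> ->; rewrite mulr0.
exact: (ideal_gen_sub (J := @Ideal R (fun x => x = 0) erefl ZD ZM)).
Qed.

Lemma ideal_seq_rcons s z x :
  ideal_seq (rcons s z) x <-> add_gen (ideal_seq s) z x.
Proof.
split; last first.
  move=> [a [b [sa ->]]]; apply: idealD.
    by apply: ideal_gen_sub sa => y sy; apply: mem_ideal_gen;
      rewrite mem_rcons inE sy orbT.
  by apply: idealMr; apply: mem_ideal_gen; rewrite mem_rcons inE eqxx.
apply: ideal_gen_sub => y; rewrite mem_rcons inE => /predU1P[->|sy].
  exact: add_gen_in.
by apply: add_gen_sub; apply: mem_ideal_gen.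
Qed.

(** By Zorn there is an ideal maximal among those containing J and avoiding T. It is prime: if a and
    b are outside I, then I + (a) and I + (b) meet T, and the product of the two elements found lies
    in I + (ab). *)
Lemma prime_disjoint J (T : R -> Prop) :
    T 1 -> (forall x y, T x -> T y -> T (x * y)) ->
    (forall x, T x -> ~ J x) ->
  exists Q, [/\ prime_ideal Q, ideal_sub J Q & forall x, T x -> ~ Q x].
Proof.
move=> T1 TM TJ.
pose ok I := ideal_sub J I /\ forall x, T x -> ~ I x.
pose X := {I : ideal R | ok I}.
have okJ : ok J by split=> // x.
pose X0 : X := exist _ J okJ.
pose le (a b : X) := `[< ideal_sub (sval a) (sval b) >].
have [||C totC|I0 maxI] := @ZL_preorder X X0 le.
- by move=> a; apply/asboolP.
- by move=> b a c /asboolP ab /asboolP bc; apply/asboolP => x /ab/bc.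
(* The disjunct [J x] makes the union an upper bound for the empty chain as well. *)
- pose U x := (exists2 a, C a & sval a x) \/ J x.
  have U0 : U 0 by right; exact: ideal0.
  have UM c x : U x -> U (c * x).
    by move=> [[a Ca ax]|Jx]; [left; exists a => // | right]; apply: idealM.
  have UD x y : U x -> U y -> U (x + y).
    move=> [[a Ca ax]|Jx] [[b Cb iby]|Jy].
    + case: (totC a b Ca Cb) => /asboolP le_ab; left.
        by exists b => //; apply: idealD => //; apply: le_ab.
      by exists a => //; apply: idealD => //; apply: le_ab.
    + by left; exists a => //; apply: idealD => //; apply: (proj1 (svalP a)).
    + by left; exists b => //; apply: idealD => //; apply: (proj1 (svalP b)).
    + by right; apply: idealD.
  have okU : ok (Ideal U0 UD UM).
    split=> [x Jx|x Tx [[a Ca ax]|]]; [by right | | exact: TJ].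
    exact: (proj2 (svalP a)) Tx ax.
  exists (exist _ _ okU) => a Ca; apply/asboolP => x ax.
  by left; exists a.
have [JI TI] := svalP I0; set I := sval I0 in JI TI.
exists I; split=> //; split; first exact: TI.
move=> a b Iab; apply/or_asboolP; rewrite -[_ || _]negbK negb_or.
apply/negP => /andP[/asboolP nIa /asboolP nIb].
have key c : ~ I c -> exists u v, [/\ I u & T (u + c * v)].
  move=> nIc.
  have : ~ ok (add_gen I c).
    move=> okc; apply: nIc; have /= := maxI (exist _ _ okc).
    have leI : le I0 (exist _ _ okc).
      by apply/asboolP; exact: add_gen_sub.
    by move=> /(_ leI)/asboolP; apply; exact: add_gen_in.
  move/not_andP => [[]|/existsNP[x /not_implyP[Tx /contrapT[u [v [Iu xE]]]]]].
    by move=> x Jx; apply: add_gen_sub; apply: JI.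
  by exists u, v; rewrite -xE.
have [u [v [Iu Tu]]] := key _ nIa; have [w [z [Iw Tw]]] := key _ nIb.
apply: (TI _ (TM _ _ Tu Tw)).
have -> : (u + a * v) * (w + b * z) =
  (w + b * z) * u + (a * v) * w + (v * z) * (a * b) by ring.
by apply: idealD; [apply: idealD|]; apply: idealM.
Qed.

(* A non-zero-divisor modulo J lies outside some prime between J and Q, which  *)
(* is how each term of a regular sequence yields one more step in a chain.     *)
Lemma regular_prime_step J Q a : prime_ideal Q -> ideal_sub J Q ->
    (forall b, J (a * b) -> J b) ->
  exists Q', [/\ prime_ideal Q', ideal_sub J Q', ideal_sub Q' Q & ~ Q' a].
Proof.
move=> [Q1 QM] JQ ra.
(* Avoiding T keeps the new prime inside Q (take m = 0) and keeps a out of it (take u = 1). *)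
pose T x := exists u m, ~ Q u /\ x = u * a ^+ m.
have [|||Q' [pQ' JQ' TQ']] := @prime_disjoint J T.
- by exists 1, 0%N; split=> //; rewrite mulr1.
- move=> _ _ [u [m [nu ->]]] [v [l [nv ->]]]; exists (u * v), (m + l)%N.
  by split; [case/QM | rewrite exprD; ring].
- move=> _ [u [m [nu ->]]]; elim: m => [|m IH].
    by rewrite mulr1 => /JQ.
  by rewrite exprS mulrCA => /ra.
exists Q'; split=> //.
  move=> x Q'x; apply: contrapT => nQx; apply: (TQ' x) => //.
  by exists x, 0%N; split=> //; rewrite mulr1.
by apply: TQ'; exists 1, 1%N; split=> //; rewrite mul1r.
Qed.

(** The chain is built downwards from Q: the last term of the sequence yields a smaller prime that
    misses it and still contains the earlier terms, to which the induction applies. *)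
Lemma regular_seq_chain s Q : prime_ideal Q -> regular_sequence s ->
    (forall x, x \in s -> Q x) ->
  exists c : nat -> ideal R, [/\ forall i, (i <= size s)%N -> prime_ideal (c i),
    forall i, (i < size s)%N ->
      ideal_sub (c i) (c i.+1) /\ ~ ideal_sub (c i.+1) (c i)
    & c (size s) = Q].
Proof.
move=> pQ [_]; elim/last_ind: s Q pQ => [|s x IH] Q pQ reg sQ.
  by exists (fun=> Q).
have [Q' [pQ' sQ' Q'Q Q'x]] : exists Q', [/\ prime_ideal Q',
    ideal_sub (ideal_seq s) Q', ideal_sub Q' Q & ~ Q' x].
  apply: regular_prime_step => //.
    by apply: ideal_gen_sub => y sy; apply: sQ; rewrite mem_rcons inE sy orbT.
  move=> b; have := reg (size s) b.
  by rewrite size_rcons ltnSn -cats1 take_size_cat // nth_cat ltnn subnn; apply.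
have [i b lt_i| |c [pc stc cQ]] := IH Q' pQ'.
- have := reg i b; rewrite size_rcons ltnS (ltnW lt_i) -cats1 take_cat lt_i.
  by rewrite nth_cat lt_i; apply.
- by move=> y sy; apply: sQ'; apply: mem_ideal_gen.
exists (fun i => if (i <= size s)%N then c i else Q); rewrite size_rcons.
split=> [i|i|]; last by rewrite ltnn.
  by move=> _; case: ifP => // /pc.
rewrite ltnS => le_i; have [->|ne_i] := eqVneq i (size s).
  rewrite /= leqnn ltnn cQ; split=> // QQ'; apply: Q'x; apply: QQ'; apply: sQ.
  by rewrite mem_rcons inE eqxx.
have lt_i : (i < size s)%N by rewrite ltn_neqAle ne_i.
by rewrite le_i lt_i; apply: stc.
Qed.

End IdealFacts.

(** * Localizations of quotients *)

(* R is the localization of S/J at M, with phi the canonical map and mR its *)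
(* maximal ideal.                                                           *)
Record localizes (S R : comPzRingType) (J M : ideal S) (phi : {rmorphism S -> R})
    (mR : ideal R) : Prop := Localizes {
  loc_max : maximal_ideal M;
  loc_le : ideal_sub J M;
  loc_fracP : forall z, exists a s, ~ M s /\ z * phi s = phi a;
  loc_unitP : forall s, ~ M s -> exists z, z * phi s = 1;
  loc_kerP : forall a, phi a = 0 <-> exists2 s, ~ M s & J (s * a);
  loc_maxP : forall z, mR z <-> exists a s, [/\ M a, ~ M s & z * phi s = phi a]
}.

Section Comap.
Variables (S R : comPzRingType) (f : {rmorphism S -> R}) (p : ideal R).

Lemma comap0 : p (f 0). Proof. by rewrite rmorph0; exact: ideal0. Qed.

Lemma comapD x y : p (f x) -> p (f y) -> p (f (x + y)).
Proof. by rewrite rmorphD; exact: idealD. Qed.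

Lemma comapM a x : p (f x) -> p (f (a * x)).
Proof. by rewrite rmorphM; exact: idealM. Qed.

Definition comap : ideal S :=
  @Ideal S (fun x => p (f x)) comap0 comapD comapM.

Lemma prime_comap : prime_ideal p -> prime_ideal comap.
Proof.
by move=> [p1 pM]; split=> [|a b] /=; rewrite ?rmorph1 // rmorphM => /pM.
Qed.

End Comap.

(** Quotient and localization are merged into one map out of S, so that later fractions have
    numerators and denominators in the polynomial ring itself. *)
Lemma localization_localizes (S : comPzRingType) (J : ideal S)
    (p : ideal (quot_ring J)) (pmax : maximal_ideal p) :
  localizes J (comap (to_quot J) p)
    (to_loc (maximal_prime pmax) \o to_quot J)
    (loc_maximal (maximal_prime pmax)).
Proof.
set pP := maximal_prime pmax; set phi : {rmorphism S -> localization pP} := (X in localizes _ _ X _).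
have inv s : ~ comap (to_quot J) p s -> exists z, z * phi s = 1.
  by move=> ns; have [z ze] := to_loc_inv pP ns; exists z.
have frac z : exists a s, ~ comap (to_quot J) p s /\ z * phi s = phi a.
  have [a' [s' [ns e]]] := to_loc_surj (pP := pP) z.
  have [a aE] := to_quot_surj a'; have [s sE] := to_quot_surj s'.
  by exists a, s; rewrite /phi /= -aE -sE.
have ker a : phi a = 0 <-> exists2 s, ~ comap (to_quot J) p s & J (s * a).
  rewrite /phi /=; split=> [/to_loc_eq0[s' ns] | [s ns Jsa]].
    have [s sE] := to_quot_surj s'.
    by rewrite sE -rmorphM => /to_quot_eq0 Jsa; exists s => //=; rewrite -sE.
  apply/to_loc_eq0; exists (to_quot J s) => //.
  by rewrite -rmorphM; apply/to_quot_eq0.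
have pP' := prime_comap (to_quot J) pP.
have JM : ideal_sub J (comap (to_quot J) p).
  by move=> x /to_quot_eq0 /= ->; exact: ideal0.
split=> //.
- split; first by case: pP'.
  move=> K pK K1 x Kx /=.
  pose K' y := exists2 u, K u & y = to_quot J u.
  have K'0 : K' 0 by exists 0; [exact: ideal0 | rewrite rmorph0].
  have K'D y z : K' y -> K' z -> K' (y + z).
    by move=> [u Ku ->] [v Kv ->]; exists (u + v); rewrite ?rmorphD //; exact: idealD.
  have K'M y z : K' z -> K' (y * z).
    move=> [v Kv ->]; have [u ->] := to_quot_surj y.
    by exists (u * v); rewrite ?rmorphM //; exact: idealM.
  apply: (proj2 pmax (Ideal K'0 K'D K'M)) => [y py||]; last by exists x.
    by have [u uE] := to_quot_surj y; exists u => //; apply: pK; rewrite /= -uE.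
  move=> [u Ku e]; apply: K1; have : J (1 - u).
    by apply/to_quot_eq0; apply/eqP; rewrite rmorphB subr_eq0 rmorph1; apply/eqP.
  by move=> /JM/pK Ku1; rewrite -(subrK u 1); exact: idealD.
- move=> z; split.
    pose P z := exists a s, [/\ comap (to_quot J) p a,
      ~ comap (to_quot J) p s & z * phi s = phi a].
    have P0 : P 0.
      by exists 0, 1; rewrite mul0r !rmorph0; split=> //; [exact: ideal0 | case: pP'].
    have PD x y : P x -> P y -> P (x + y).
      move=> [a [s [pa ps xE]]] [b [t [pb pt yE]]]; exists (a * t + b * s), (s * t).
      split; first by apply: idealD; apply: idealMr.
        by move=> /(proj2 pP')[].
      by rewrite !rmorphD !rmorphM -xE -yE; ring.
    have PM x y : P y -> P (x * y).
      move=> [b [t [pb pt yE]]]; have [a [s [ns xE]]] := frac x.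
      exists (a * b), (s * t); split; first exact: idealM.
        by move=> /(proj2 pP')[].
      by rewrite !rmorphM -xE -yE; ring.
    apply: (ideal_gen_sub (J := Ideal P0 PD PM)) => _ [a' pa ->].
    have [a aE] := to_quot_surj a'; exists a, 1.
    by rewrite aE rmorph1 mulr1; split=> //=; rewrite -?aE //; case: pP'.
  move=> [a [s [pa ns e]]]; have [w we] := inv s ns.
  have -> : z = w * phi a by rewrite -e mulrCA we mulr1.
  by apply: idealM; apply: mem_ideal_gen; exists (to_quot J a).
Qed.

Section Localizes.
Variables (S R : comPzRingType) (J M : ideal S) (phi : {rmorphism S -> R}).
Variables (mR : ideal R) (H : localizes J M phi mR).

Let primeM : prime_ideal M := maximal_prime (loc_max H).

Lemma loc_denM s t : ~ M s -> ~ M t -> ~ M (s * t).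
Proof. by move=> ns nt /(proj2 primeM)[]. Qed.

Lemma loc_cancel s z : ~ M s -> z * phi s = 0 -> z = 0.
Proof.
move=> /(loc_unitP H)[w we] e.
by rewrite -[z]mulr1 -we mulrCA e mulr0.
Qed.

Lemma loc_mem a : M a -> mR (phi a).
Proof.
move=> Ma; apply/(loc_maxP H); exists a, 1.
by split=> //; [case: primeM | rewrite rmorph1 mulr1].
Qed.

Lemma loc_ker_prime P a : prime_ideal P -> ideal_sub J P -> ideal_sub P M ->
  phi a = 0 -> P a.
Proof.
move=> [_ PM] JP PsM /(loc_kerP H)[s ns /JP/PM[]//].
by move=> /PsM.
Qed.

Section Extension.
Variables (P : ideal S) (JP : ideal_sub J P) (PM : ideal_sub P M).

Definition extend_mem z := exists a s, [/\ P a, ~ M s & z * phi s = phi a].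

Lemma extend0 : extend_mem 0.
Proof.
exists 0, 1; rewrite mul0r rmorph0; split=> //; first exact: ideal0.
by case: primeM.
Qed.

Lemma extendD x y : extend_mem x -> extend_mem y -> extend_mem (x + y).
Proof.
move=> [a [s [pa ps xE]]] [b [t [pb pt yE]]]; exists (a * t + b * s), (s * t).
split; first by apply: idealD; apply: idealMr.
  exact: loc_denM.
by rewrite !rmorphD !rmorphM -xE -yE; ring.
Qed.

Lemma extendM x y : extend_mem y -> extend_mem (x * y).
Proof.
move=> [b [t [pb pt yE]]]; have [a [s [ns xE]]] := loc_fracP H x.
exists (a * b), (s * t); split; first exact: idealM.
  exact: loc_denM.
by rewrite !rmorphM -xE -yE; ring.
Qed.

Definition extend : ideal R := @Ideal R extend_mem extend0 extendD extendM.

Hypothesis primeP : prime_ideal P.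

Lemma extend_phi a : extend (phi a) <-> P a.
Proof.
split=> [[b [s [Pb ns e]]]|Pa]; last first.
  by exists a, 1; rewrite rmorph1 mulr1; split=> //; case: primeM.
have : P (a * s - b).
  by apply: loc_ker_prime => //; rewrite rmorphB rmorphM e subrr.
move=> Pab; have : P (a * s) by rewrite -(subrK b (a * s)); exact: idealD.
by move=> /(proj2 primeP)[//|/PM].
Qed.

Lemma extend_prime : prime_ideal extend.
Proof.
split=> [|x y exy].
  rewrite -(rmorph1 phi) => /extend_phi; exact: (proj1 primeP).
have [a [s [ns xE]]] := loc_fracP H x; have [b [t [nt yE]]] := loc_fracP H y.
have : extend (phi (a * b)).
  have -> : phi (a * b) = (phi s * phi t) * (x * y).
    by rewrite rmorphM -xE -yE; ring.
  exact: idealM.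
move=> /extend_phi/(proj2 primeP)[Pa|Pb]; [left | right].
  by exists a, s.
by exists b, t.
Qed.

End Extension.

Lemma loc_max_prime : prime_ideal mR.
Proof.
have := extend_prime (loc_le H) (fun _ => id) primeM.
by move=> [p1 pM]; split=> [|x y]; rewrite ?(loc_maxP H) //; exact: pM.
Qed.

Lemma prime_chain_extend d (c : nat -> ideal S) :
    (forall i, (i <= d)%N ->
       [/\ prime_ideal (c i), ideal_sub J (c i) & ideal_sub (c i) M]) ->
    (forall i, (i < d)%N ->
       ideal_sub (c i) (c i.+1) /\ ~ ideal_sub (c i.+1) (c i)) ->
  prime_chain R d.
Proof.
move=> pc sc; exists (fun i => extend (c i)).
split=> [i /pc[pi Ji iM]|i lt_i]; first exact: extend_prime.
have [le_c nle_c] := sc i lt_i.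
have [pi Ji iM] := pc i (ltnW lt_i); have [pi' Ji' iM'] := pc i.+1 lt_i.
split=> [x [a [s [ca ns e]]]|le_e]; first by exists a, s; split=> //; exact: le_c.
apply: nle_c => x cx; apply/(extend_phi Ji iM pi); apply: le_e.
exact/extend_phi.
Qed.

(** Strict inclusions survive contraction because every element of R is a unit times an element of
    the image of S. *)
Lemma prime_chain_comap d : prime_chain R d ->
  exists c : nat -> ideal S,
    (forall i, (i <= d)%N -> prime_ideal (c i) /\ ideal_sub J (c i)) /\
    (forall i, (i < d)%N ->
       ideal_sub (c i) (c i.+1) /\ ~ ideal_sub (c i.+1) (c i)).
Proof.
move=> [c [pc sc]]; exists (fun i => comap phi (c i)).
split=> [i le_i|i lt_i].
  split; first by apply: prime_comap; exact: pc.
  move=> x Jx /=; have -> : phi x = 0; last exact: ideal0.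
  apply/(loc_kerP H); exists 1; first by case: primeM.
  by rewrite mul1r.
have [le_c nle_c] := sc i lt_i; split=> [x /le_c //|le_x].
apply: nle_c => z cz; have [a [s [ns e]]] := loc_fracP H z.
have : c i (z * phi s) by rewrite e; apply: le_x; rewrite /= -e; exact: idealMr.
have [w we] := loc_unitP H ns.
move=> czs; have -> : z = w * (z * phi s) by rewrite mulrCA we mulr1.
exact: idealM.
Qed.

End Localizes.

(* f, g is a weakly regular sequence on S/J; J may contain 1. *)
Definition regular_pair (S : comPzRingType) (f g : S) (J : ideal S) :=
  (forall a, J (f * a) -> J a) /\
  (forall a b, J (g * a - f * b) -> exists c, J (a - f * c)).

Lemma regular_pair_in (R : comPzRingType) (mR : ideal R) (f g : R) :
    prime_ideal mR -> mR f -> mR g ->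
    (forall a, f * a = 0 -> a = 0) ->
    (forall a b, g * a = f * b -> exists c, a = f * c) ->
  regular_in mR [:: f; g].
Proof.
move=> [m1 _] mf mg rf rg.
have mem x : x \in [:: f; g] -> mR x by rewrite !inE => /orP[] /eqP->.
have fP x : ideal_seq [:: f] x <-> exists c, x = f * c.
  rewrite (ideal_seq_rcons [::] f x); split=> [[a [b [/ideal_seq_nil -> ->]]]|[c ->]].
    by exists b; rewrite add0r.
  by exists 0, c; rewrite add0r; split=> //; exact/ideal_seq_nil.
split=> //; split; first by move=> /(ideal_gen_sub mem).
case=> [|[|//]] b _; rewrite [take _ _]/= [nth _ _ _]/=.
  by rewrite !ideal_seq_nil; exact: rf.
by rewrite !fP => -[c]; exact: rg.
Qed.

(** A relation in R becomes a relation modulo J once denominators are cleared and the result is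
    multiplied by some u outside M. Since f and g lie in M, the weakly regular pair generates a
    proper ideal in R. *)
Lemma regular_pair_loc (S R : comPzRingType) (J M : ideal S)
    (phi : {rmorphism S -> R}) (mR : ideal R) (f g : S) :
    localizes J M phi mR -> M f -> M g -> regular_pair f g J ->
  regular_in mR [:: phi f; phi g].
Proof.
move=> H Mf Mg [rf rg]; apply: regular_pair_in; try exact: (loc_mem H).
- exact: loc_max_prime H.
- move=> z; have [a [s [ns e]]] := loc_fracP H z => fz.
  have : phi (f * a) = 0 by rewrite rmorphM -e mulrA fz mul0r.
  move=> /(loc_kerP H)[t nt]; rewrite mulrCA => /rf Jta.
  by apply: (loc_cancel H ns); rewrite e; apply/(loc_kerP H); exists t.
move=> z w; have [a [s [ns ze]]] := loc_fracP H z.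
have [b [t [nt we]]] := loc_fracP H w => e.
have : phi (g * (t * a) - f * (s * b)) = 0.
  rewrite rmorphB !rmorphM -ze -we; apply/eqP; rewrite subr_eq0; apply/eqP.
  transitivity (phi s * phi t * (phi g * z)); first by ring.
  by rewrite e; ring.
move=> /(loc_kerP H)[u nu]; have -> : u * (g * (t * a) - f * (s * b)) =
  g * (u * t * a) - f * (u * s * b) by ring.
move=> /rg[c Jc].
have nd : ~ M (u * t * s) by do 2?apply: (loc_denM H).
have [v ve] := loc_unitP H nd; exists (v * phi c).
apply/eqP; rewrite -subr_eq0; apply/eqP; apply: (loc_cancel H nd).
have : phi (u * t * a - f * c) = 0.
  apply/(loc_kerP H); exists 1; last by rewrite mul1r.
  by case: (maximal_prime (loc_max H)).
have -> : (z - phi f * (v * phi c)) * phi (u * t * s) =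
   phi u * phi t * (z * phi s) - phi f * phi c * (v * phi (u * t * s)).
  by rewrite !rmorphM; ring.
by rewrite ve mulr1 ze rmorphB !rmorphM.
Qed.

(** * Sections over the punctured spectrum *)

Section Sections.
Variables (R : comPzRingType) (f g : R).
Hypothesis rf : forall a, f * a = 0 -> a = 0.
Hypothesis rg : forall a b, g * a = f * b -> exists c, a = f * c.

(** Powers of f and g are needed because only a high power of an element of the maximal ideal lies
    in the ideal generated by fixed powers of the variables. *)
Lemma regular_expl m a : f ^+ m * a = 0 -> a = 0.
Proof. by elim: m => [|m IH]; rewrite ?mul1r // exprS -mulrA => /rf/IH. Qed.

Lemma regular_exprl m a b : g * a = f ^+ m * b -> exists c, a = f ^+ m * c.
Proof.
elim: m a b => [|m IH] a b; first by exists a; rewrite mul1r.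
rewrite exprS -mulrA => /[dup]/rg[c ->]; rewrite mulrCA => e.
have : f * (g * c - f ^+ m * b) = 0 by rewrite mulrBr e subrr.
move=> /rf/eqP; rewrite subr_eq0 => /eqP/IH[d ->].
by exists d; rewrite mulrA.
Qed.

Lemma regular_expr l m a b : g ^+ l * a = f ^+ m * b -> exists c, a = f ^+ m * c.
Proof.
elim: l a b => [|l IH] a b; first by rewrite mul1r; exists b.
by rewrite exprSr -mulrA => /IH[c /regular_exprl].
Qed.

(* Depth at least two: a section of the structure sheaf over the punctured     *)
(* spectrum, given as a_t / z_t on D(z_t), extends.                            *)
Lemma punctured_section (n : nat) (z a : 'I_n -> R) (l m : nat) (c e : 'I_n -> R) :
    (forall s t, z s * a t = z t * a s) ->
    f ^+ m = \sum_t c t * z t -> g ^+ l = \sum_t e t * z t ->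
  exists b, forall t, a t = z t * b.
Proof.
move=> za fE gE.
(* These are the sought section multiplied by [f ^+ m] and by [g ^+ l]. From g^l af = f^m ag,
   regularity shows that f^m divides af. *)
pose af := \sum_t c t * a t; pose ag := \sum_t e t * a t.
have zf s : z s * af = f ^+ m * a s.
  by rewrite fE mulr_sumr mulr_suml; apply: eq_bigr => t _; rewrite mulrCA za; ring.
have [b bE] : exists b, af = f ^+ m * b.
  apply: (regular_expr (l := l) (b := ag)).
  rewrite gE mulr_suml /ag mulr_sumr; apply: eq_bigr => t _.
  by rewrite -mulrA zf; ring.
exists b => t; apply/eqP; rewrite -subr_eq0; apply/eqP; apply: (regular_expl (m := m)).
by rewrite mulrBr -zf bE; ring.
Qed.

End Sections.

(** * Dimension of polynomial rings *)

Lemma mpoly_mem_ideal (k : fieldType) (n : nat) (J : ideal {mpoly k[n]})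
    (p : {mpoly k[n]}) : (forall m, m \in msupp p -> J 'X_[m]) -> J p.
Proof.
move=> Jp; rewrite (mpolyE p) big_seq; apply: ideal_sum => m mp.
by rewrite -mul_mpolyC; apply: idealM; apply: Jp.
Qed.

Lemma ideal_mpolyX (k : fieldType) (n : nat) (J : ideal {mpoly k[n]})
    (m : 'X_{1..n}) (u : 'I_n) : m u != 0%N -> J 'X_u -> J 'X_[m].
Proof.
rewrite -lep1mP => um Ju; rewrite -(submK um) mpolyXD.
exact: idealM.
Qed.

Definition mdeg_le (k : fieldType) (n : nat) (d : nat) (p : {mpoly k[n]}) :=
  forall m, m \in msupp p -> (mdeg m <= d)%N.

Section MdegLe.
Variables (k : fieldType) (n : nat).
Implicit Types p q : {mpoly k[n]}.

Lemma mdeg_leM d e p q : mdeg_le d p -> mdeg_le e q -> mdeg_le (d + e) (p * q).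
Proof.
move=> pd qe m /msuppM_le/allpairsP[[m1 m2] /= [mp mq ->]].
by rewrite mdegD leq_add ?pd ?qe.
Qed.

Lemma mdeg_le1 d : mdeg_le d (1 : {mpoly k[n]}).
Proof. by move=> m; rewrite msupp1 inE => /eqP->; rewrite mdeg0. Qed.

Lemma mdeg_leW d e p : (d <= e)%N -> mdeg_le d p -> mdeg_le e p.
Proof. by move=> de pd m /pd/leq_trans; apply. Qed.

Lemma mdeg_leX d p i : mdeg_le d p -> mdeg_le (i * d) (p ^+ i).
Proof.
move=> pd; elim: i => [|i IH]; first exact: mdeg_le1.
by rewrite exprS mulSn; apply: mdeg_leM.
Qed.

Lemma mdeg_le_sum d (I : finType) (F : I -> {mpoly k[n]}) :
  (forall i, mdeg_le d (F i)) -> mdeg_le d (\sum_i F i).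
Proof.
move=> Fd; apply: big_ind => // [m|p q pd qd m /msuppD_le].
  by rewrite msupp0.
by rewrite mem_cat => /orP[/pd|/qd].
Qed.

Lemma mdeg_leZ d c p : mdeg_le d p -> mdeg_le d (c *: p).
Proof. by move=> pd m /msuppZ_le/pd. Qed.

End MdegLe.

(** Exponent vectors of length l with entries below N, as nested pairs so that recursion on l
    removes the first variable. *)
Fixpoint box (N l : nat) : finType :=
  if l is l'.+1 then ('I_N * box N l')%type else unit.

Lemma card_box N l : #|box N l| = (N ^ l)%N.
Proof. by elim: l => [|l IH] /=; rewrite ?card_unit // card_prod card_ord IH expnS. Qed.

Lemma sum_box (V : nmodType) (N l : nat) (F : 'I_N * box N l -> V) :
  \sum_(b : box N l.+1) F b = \sum_i \sum_b F (i, b).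
Proof.
rewrite pair_bigA /=; apply: eq_bigr => -[i b] _; by [].
Qed.

Lemma leq_expW a b i : (a <= b)%N -> (a ^ i <= b ^ i)%N.
Proof. by move=> le_ab; elim: i => // i IH; rewrite !expnS leq_mul. Qed.

Section DimensionBound.
Variables (k : fieldType) (n : nat) (N : nat).
Local Notation S := {mpoly k[n]}.

Fixpoint box_monomial (l : nat) : box N l -> (nat -> S) -> S :=
  if l is l'.+1 return box N l -> (nat -> S) -> S then
    fun b y => y 0%N ^+ b.1 * box_monomial b.2 (fun i => y i.+1)
  else fun _ _ => 1.

(* Look at the lexicographically least exponent with a non-zero coefficient:   *)
(* the primes of the chain strip the variables off one at a time.              *)
Lemma chain_independent l (Q : nat -> ideal S) (y : nat -> S) (c : box N l -> k) :
    (forall i, (i <= l)%N -> prime_ideal (Q i)) ->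
    (forall i, (i < l)%N -> [/\ ideal_sub (Q i) (Q i.+1), Q i.+1 (y i) & ~ Q i (y i)]) ->
    Q 0%N (\sum_b c b *: box_monomial b y) ->
  forall b, c b = 0.
Proof.
elim: l Q y c => [|l IH] Q y c pQ sQ.
  rewrite (bigD1 tt) //= big1 => [|[]//]; rewrite addr0 => Qc [].
  apply: contrapT => /eqP nc; apply: (proj1 (pQ 0%N isT)).
  have -> : 1 = (c tt)^-1%:MP * (c tt *: 1) :> S.
    by rewrite mul_mpolyC scalerA mulVf // scale1r.
  exact: idealM.
pose e (i : 'I_N) : S := \sum_b c (i, b) *: box_monomial b (fun i => y i.+1).
have -> : \sum_b c b *: box_monomial b y = \sum_(i < N) y 0%N ^+ i * e i.
  rewrite sum_box; apply: eq_bigr => i _; rewrite mulr_sumr.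
  by apply: eq_bigr => b _; rewrite /= scalerAr.
move=> Q0; suff ind (i : nat) : forall j : 'I_N, (j < i)%N -> forall b, c (j, b) = 0.
  by case=> j b; apply: (ind j.+1).
elim: i => [//|i IHi] j; rewrite ltnS leq_eqVlt => /predU1P[ji|]; last exact: IHi.
apply: (IH (fun i => Q i.+1) (fun i => y i.+1)) => [u|u|]; [exact: (pQ u.+1)|exact: (sQ u.+1)|].
have [Q01 Q1y nQ0y] := sQ 0%N isT.
rewrite -/(e j).
(* The coefficients before j vanish by induction. As [Q 0] is prime and misses [y 0], the cofactor
   lies in it; modulo [Q 1], which contains [y 0], only [e j] is left. *)
have [r rE] : exists r, \sum_(i < N) y 0%N ^+ i * e i = y 0%N ^+ j * (e j + y 0%N * r).
  exists (\sum_(u < N | (j < u)%N) y 0%N ^+ (u - j.+1) * e u).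
  rewrite (bigD1 j) //= mulrDr; congr (_ + _).
  rewrite (bigID (fun u : 'I_N => (j < u)%N)) /= [X in _ + X]big1 ?addr0.
    rewrite !mulr_sumr; apply: eq_big => [u|u /andP[_ lt_ju]].
      by apply/andP/idP => [[]//|lt_ju]; split=> //; apply: contraTneq lt_ju => ->; rewrite ltnn.
    by rewrite !mulrA -exprSr -exprD; congr (_ ^+ _ * _); lia.
  move=> u /andP[neq]; rewrite -leqNgt leq_eqVlt => /predU1P[e_uj|lt_uj].
    by rewrite (val_inj e_uj) eqxx in neq.
  rewrite /e big1 ?mulr0 // => b _; rewrite IHi ?scale0r // -ji //.
move: Q0; rewrite rE => /(proj2 (pQ 0%N isT))[/(prime_ideal_expr (pQ 0%N isT))//|].
move=> /Q01 Q1; rewrite -[e j](addrK (y 0%N * r)); apply: idealB => //.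
exact: idealMr.
Qed.

Lemma box_monomial_deg D l (b : box N l) (y : nat -> S) :
  (forall i, (i < l)%N -> mdeg_le D (y i)) -> mdeg_le (l * (N * D)) (box_monomial b y).
Proof.
elim: l b y => [|l IH] b y yD /=; first exact: mdeg_le1.
rewrite mulSn; apply: mdeg_leM; last by apply: IH => i; apply: (yD i.+1).
apply: mdeg_leW (mdeg_leX (i := b.1) (yD 0%N isT)).
by rewrite leq_mul2r ltnW ?orbT.
Qed.

End DimensionBound.

Lemma wide_matrix_kernel (F : fieldType) (I J : finType) (A : I -> J -> F) :
  (#|J| < #|I|)%N ->
  exists c : I -> F, (exists i, c i != 0) /\ forall j, \sum_i c i * A i j = 0.
Proof.
move=> ltJI; pose M := \matrix_(i < #|I|, j < #|J|) A (enum_val i) (enum_val j).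
have : kermx M != 0.
  rewrite kermx_eq0 /row_free; apply: contraTneq ltJI => <-.
  by rewrite -leqNgt rank_leq_col.
move=> /rowV0Pn[v /sub_kermxP vM /rV0Pn[i vi]].
exists (fun i => v 0 (enum_rank i)); split; first by exists (enum_val i); rewrite enum_valK.
move=> j; have := congr1 (fun w : 'rV_ _ => w 0 (enum_rank j)) vM.
rewrite !mxE => vM0; rewrite -[RHS]vM0 (reindex (@enum_val I predT)) /=; last first.
  by apply: onW_bij; exact: enum_val_bij.
by apply: eq_bigr => u _; rewrite mxE enum_valK enum_rankK.
Qed.

(** A longer chain would give d + 1 elements y_i whose monomials are independent modulo [c 0]. There
    are N^(d+1) of them with exponents below N, and their degrees grow linearly in N. But modulo
    [c 0] only d variables survive, which leaves room for O(N^d). *)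
Lemma prime_chain_mpoly_bound (k : fieldType) (n d e : nat) (tau : 'I_d -> 'I_n)
    (c : nat -> ideal {mpoly k[n]}) :
    injective tau ->
    (forall i, (i <= e)%N -> prime_ideal (c i)) ->
    (forall i, (i < e)%N -> ideal_sub (c i) (c i.+1) /\ ~ ideal_sub (c i.+1) (c i)) ->
    (forall u, u \notin codom tau -> c 0%N 'X_u) ->
  (e <= d)%N.
Proof.
move=> injtau pc sc cX; rewrite leqNgt; apply/negP => lt_de.
have /choice[y yP] : forall i, exists y, (i < d.+1)%N -> c i.+1 y /\ ~ c i y.
  move=> i; case: (ltnP i d.+1) => [lt_i|_]; last by exists 0.
  have [_ /existsNP[y /not_implyP[cy ncy]]] := sc i (leq_trans lt_i lt_de).
  by exists y.
pose D := (\max_(i < d.+1) msize (y i))%N.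
have yD i : (i < d.+1)%N -> mdeg_le D (y i).
  move=> lt_i m /msize_mdeg_lt/ltnW/leq_trans; apply.
  exact: (leq_bigmax (Ordinal lt_i)).
(* With C = (d+1)D + 1 the number B of admissible exponents is at most C N, and N = C^d + 1 gives (C
   N)^d < N^(d+1). *)
pose N := ((d.+1 * D).+1 ^ d).+1.
pose B := (d.+1 * (N * D)).+1.
pose mnm (a : {ffun 'I_d -> 'I_B}) : 'X_{1..n} :=
  [multinom (\sum_(j | tau j == i) a j)%N | i < n].
have [|a [[b ab] aA]] := @wide_matrix_kernel k (box N d.+1) {ffun 'I_d -> 'I_B}
    (fun b a => (box_monomial b y)@_(mnm a)).
  rewrite card_box card_ffun !card_ord expnS.
  apply: (@leq_ltn_trans (((d.+1 * D).+1 * N) ^ d)).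
    have leB : (B <= (d.+1 * D).+1 * N)%N.
      by rewrite /B mulnA mulnAC [leqRHS]mulSnr -[leqLHS]addn1 leq_add2l.
    exact: leq_expW.
  by rewrite expnMn ltn_mul2r expn_gt0 /= ltnS leqnn.
case/eqP: ab; apply: (@chain_independent k n N d.+1 c y a) => [i lt_i|i lt_i|].
- by apply: pc; exact: leq_trans lt_i lt_de.
- have [? ?] := yP i lt_i.
  by split=> //; exact: (proj1 (sc i (leq_trans lt_i lt_de))).
set h := \sum_b _; have hB : mdeg_le B.-1 h.
  by apply: mdeg_le_sum => b'; apply: mdeg_leZ; exact: box_monomial_deg.
apply: mpoly_mem_ideal => m mh.
case: (pickP (fun u => (u \notin codom tau) && (m u != 0%N))) => [u /andP[nu mu]|mtau].
  by apply: ideal_mpolyX mu _; exact: cX.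
have lt_mB i : (m i < B)%N.
  rewrite ltnS; apply: leq_trans (hB m mh).
  by rewrite mdegE (bigD1 i) //= leq_addr.
pose am : {ffun 'I_d -> 'I_B} := [ffun j => Ordinal (lt_mB (tau j))].
have mE : m = mnm am.
  apply/mnmP => i; rewrite mnmE; case: (boolP (i \in codom tau)) => [/codomP[j ->]|ni].
    by rewrite (big_pred1 j) ?ffunE // => u; rewrite (inj_eq injtau).
  have := mtau i; rewrite ni => /negbFE/eqP ->; rewrite big_pred0 // => u.
  by apply/eqP => e_u; rewrite -e_u codom_f in ni.
move: mh; rewrite mcoeff_msupp => /eqP[]; rewrite mE /h raddf_sum /= -[RHS](aA am).
by apply: eq_bigr => b' _; rewrite mcoeffZ.
Qed.

(** * Noetherianity *)

Lemma tail_min (a : nat -> nat) N :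
  exists2 i, (N <= i)%N & forall j, (N <= j)%N -> (a i <= a j)%N.
Proof.
have ex : exists v, `[< exists2 i, (N <= i)%N & a i = v >].
  by exists (a N); apply/asboolP; exists N.
case: (ex_minnP ex) => v /asboolP[i Ni <-] minv; exists i => // j Nj.
by apply: minv; apply/asboolP; exists j.
Qed.

(** Each index is chosen to minimize a on the tail that follows the previous index. *)
Lemma nondecreasing_subseq (a : nat -> nat) : exists phi : nat -> nat,
  {homo phi : i j / (i < j)%N} /\ {homo (a \o phi) : i j / (i <= j)%N}.
Proof.
have /choice[g gP] := fun N => (exists2P _ _).1 (tail_min a N).
pose phi i := iter i (fun u => g u.+1) (g 0%N).
have step i : (phi i < phi i.+1)%N by rewrite /= (gP _).1.
have min i j : (phi i <= j)%N -> (a (phi i) <= a j)%N.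
  case: i => [|i] le_j; first by rewrite (gP 0%N).2.
  by apply: (gP _).2; apply: leq_trans (step i) le_j.
have hom : {homo phi : i j / (i < j)%N} by apply: homo_ltn => //; exact: ltn_trans.
exists phi; split=> // i j; rewrite leq_eqVlt => /predU1P[->//|/hom/ltnW].
exact: min.
Qed.

(** Subsequences are refined one coordinate at a time; the first two terms of the final one are
    comparable. *)
Lemma dickson (n : nat) (a : nat -> 'X_{1..n}) :
  exists i j, (i < j)%N /\ (a i <= a j)%MM.
Proof.
have main l : exists phi : nat -> nat, {homo phi : i j / (i < j)%N} /\
    forall u : 'I_n, (u < l)%N -> {homo (fun i => a (phi i) u) : i j / (i <= j)%N}.
  elim: l => [|l [phi [hom le_a]]]; first by exists id; split.
  case: (ltnP l n) => [lt_ln|le_nl]; last first.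
    by exists phi; split=> // u _; apply: le_a; apply: leq_trans le_nl.
  have [psi [hom' le']] := nondecreasing_subseq (fun i => a (phi i) (Ordinal lt_ln)).
  exists (phi \o psi); split=> [i j /hom'/hom//|u].
  have mpsi : {homo psi : i j / (i <= j)%N}.
    by move=> i j; rewrite leq_eqVlt => /predU1P[->//|/hom'/ltnW].
  rewrite ltnS leq_eqVlt => /predU1P[ul|lt_u] i j le_ij; last exact/le_a/mpsi.
  have -> : u = Ordinal lt_ln by apply: val_inj.
  by apply: le'.
have [phi [hom le_a]] := main n.
exists (phi 0%N), (phi 1%N); split; first exact: hom.
by apply/mnm_lepP => u; apply: le_a.
Qed.

(** If I is not finitely generated, keep adjoining an element of I outside the ideal generated so
    far, with least possible leading monomial. By Dickson's lemma the leading monomial of some f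
    divides that of a later h, and cancelling the leading term of h against f contradicts the
    minimality of h. *)
Lemma noetherian_mpoly (k : fieldType) (n : nat) : noetherian {mpoly k[n]}.
Proof.
move=> I; apply: contrapT => notfg.
pose S := {mpoly k[n]}.
(* The condition on s stands under the existential so that [choice] yields a function on all
   sequences. *)
have ex (s : seq S) : exists f, (forall x, x \in s -> I x) ->
    [/\ I f, ~ ideal_seq s f &
      forall h, I h -> ~ ideal_seq s h -> ~~ (mlead h < mlead f)%O].
  case: (EM (forall x, x \in s -> I x)) => [sI|]; last by exists 0.
  have [f0 [If0 nf0]] : exists f, I f /\ ~ ideal_seq s f.
    apply: contrapT => /forallNP nex; apply: notfg; exists s => x; split.
      by move=> Ix; apply: contrapT => nx; apply: (nex x).
    exact: ideal_gen_sub.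
  move: f0 If0 nf0.
  suff wf m : forall f, mlead f = m -> I f -> ~ ideal_seq s f ->
     exists f, (forall x, x \in s -> I x) -> [/\ I f, ~ ideal_seq s f &
      forall h, I h -> ~ ideal_seq s h -> ~~ (mlead h < mlead f)%O].
    by move=> f; apply: (wf (mlead f)).
  elim/(well_founded_ind (@ltom_wf n)): m => m IH f fm If nf.
  case: (EM (forall h, I h -> ~ ideal_seq s h -> ~~ (mlead h < mlead f)%O)) => [|].
    by move=> minf; exists f.
  move=> /existsNP[h /not_implyP[Ih /not_implyP[nh /negP/negPn lt_h]]].
  by apply: (IH (mlead h) _ h) => //; rewrite -fm.
have /choice[g gP] := ex.
pose s_ i := iter i (fun s : seq S => rcons s (g s)) [::].
have s_I i : forall x, x \in s_ i -> I x.
  elim: i => [|i IH] x; rewrite /= ?in_nil // mem_rcons inE => /predU1P[->|/IH//].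
  by have [] := gP _ IH.
have in_s i j : (i < j)%N -> g (s_ i) \in s_ j.
  elim: j => // j IH; rewrite ltnS leq_eqVlt /= mem_rcons inE.
  by case/predU1P=> [->|/IH ->]; rewrite ?eqxx ?orbT.
have [i [j [lt_ij]]] := dickson (fun i => mlead (g (s_ i))).
set f := g (s_ i); set h := g (s_ j) => le_fh.
have [If _ _] := gP _ (s_I i); have [Ih nh minh] := gP _ (s_I j).
rewrite -/f in If; rewrite -/h in Ih nh minh.
have h0 : h != 0 by apply: contra_notN nh => /eqP->; exact: ideal0.
have f0 : f != 0.
  apply/eqP => f0; have [_ nf _] := gP _ (s_I i); apply: nf.
  by rewrite -/f f0; exact: ideal0.
pose m := (mlead h - mlead f)%MM; pose c := mleadc h / mleadc f.
pose r := h - c *: (f * 'X_[m]).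
have hm : mlead h = (m + mlead f)%MM by rewrite submK.
have sf : ideal_seq (s_ j) (c *: (f * 'X_[m])).
  rewrite -mul_mpolyC; apply: idealM; apply: idealMr; apply: mem_ideal_gen.
  exact: in_s.
have nr : ~ ideal_seq (s_ j) r.
  by move=> sr; apply: nh; rewrite -[h](subrK (c *: (f * 'X_[m]))); exact: idealD.
have Ir : I r.
  by apply: idealB => //; rewrite -mul_mpolyC; apply: idealM; apply: idealMr.
move/negP: (minh r Ir nr); apply; rewrite lt_neqAle.
have r0 : r != 0 by apply: contra_notN nr => /eqP->; exact: ideal0.
have rh : r@_(mlead h) = 0.
  rewrite mcoeffB mcoeffZ [in X in _ - X]hm mcoeffMX divfK ?subrr //.
  by rewrite mleadc_eq0.
apply/andP; split.
  by apply: contraTneq (mlead_supp r0) => ->; rewrite mcoeff_msupp rh eqxx.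
apply: le_trans (mleadB_le _ _) _; rewrite leUx lexx /=.
apply: le_trans (mleadZ_le _ _) _; apply: le_trans (mleadM_le _ _) _.
by rewrite mleadXm hm addmC.
Qed.

Lemma noetherian_quot (S : comPzRingType) (J : ideal S) :
  noetherian S -> noetherian (quot_ring J).
Proof.
move=> nS I; have [s sE] := nS (comap (to_quot J) I).
exists [seq to_quot J x | x <- s] => y; split.
  have [x ->] := to_quot_surj y => Ix; have /sE sx : comap (to_quot J) I x by [].
  have := ideal_gen_sub (J := comap (to_quot J) (ideal_seq [seq to_quot J x | x <- s])).
  apply; last exact: sx.
  by move=> z sz; apply: mem_ideal_gen; exact: map_f.
apply: ideal_gen_sub => _ /mapP[x sx ->].
have /sE : ideal_seq s x by apply: mem_ideal_gen.
by [].
Qed.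

(** * Depth at the origin *)

Section WeightIdeal.
Variables (k : fieldType) (n : nat).
Local Notation S := {mpoly k[n]}.

(** The monomial valuation with weights w. If I has order at least v, then its m-th power has order
    at least m v, which certifies that certain monomials do not occur in it. *)
Definition weight (w : 'I_n -> nat) (m : 'X_{1..n}) := (\sum_i w i * m i)%N.

Lemma weightD w m1 m2 : weight w (m1 + m2)%MM = (weight w m1 + weight w m2)%N.
Proof.
by rewrite -big_split; apply: eq_bigr => i _; rewrite mnmDE mulnDr.
Qed.

Lemma weightU w i l : weight w (U_(i) *+ l)%MM = (w i * l)%N.
Proof.
rewrite /weight (bigD1 i) //= big1 => [|j ne_ji].
  by rewrite mulmnE mnm1E eqxx mul1n addn0.
by rewrite mulmnE mnm1E eq_sym (negbTE ne_ji) mul0n muln0.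
Qed.

Variables (w : 'I_n -> nat) (v : nat).

Definition weight_mem (f : S) := forall m, m \in msupp f -> (v <= weight w m)%N.

Lemma weight_mem0 : weight_mem 0.
Proof. by move=> m; rewrite msupp0. Qed.

Lemma weight_memD f g : weight_mem f -> weight_mem g -> weight_mem (f + g).
Proof. by move=> wf wg m /msuppD_le; rewrite mem_cat => /orP[/wf|/wg]. Qed.

Lemma weight_memM a f : weight_mem f -> weight_mem (a * f).
Proof.
move=> wf m /msuppM_le/allpairsP[[m1 m2] /= [_ /wf le_v ->]].
by rewrite weightD (leq_trans le_v) ?leq_addl.
Qed.

Definition weight_ideal : ideal S :=
  @Ideal S weight_mem weight_mem0 weight_memD weight_memM.

Lemma weight_ideal_coef f m : weight_ideal f -> (weight w m < v)%N -> f@_m = 0.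
Proof.
by move=> wf lt_v; apply: memN_msupp_eq0; apply: contraL lt_v => /wf; rewrite -leqNgt.
Qed.

End WeightIdeal.

Lemma weight_ideal_mul (k : fieldType) (n : nat) (w : 'I_n -> nat) v u
    (f g : {mpoly k[n]}) :
  weight_ideal k w v f -> weight_ideal k w u g -> weight_ideal k w (v + u) (f * g).
Proof.
move=> wf wg m /msuppM_le/allpairsP[[m1 m2] /= [/wf le_v /wg le_u ->]].
by rewrite weightD leq_add.
Qed.

Lemma weight_ideal_prod (k : fieldType) (n : nat) (w : 'I_n -> nat) v m
    (f : 'I_m -> {mpoly k[n]}) :
  (forall i, weight_ideal k w v (f i)) -> weight_ideal k w (m * v) (\prod_i f i).
Proof.
elim: m f => [|m IH] f wf; first by move=> u _; rewrite mul0n.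
rewrite big_ord_recl mulSn; apply: weight_ideal_mul => //.
by apply: IH => i; exact: wf.
Qed.

Lemma ideal_exp_weight (k : fieldType) (n : nat) (I : ideal {mpoly k[n]})
    (w : 'I_n -> nat) v m :
  ideal_sub I (weight_ideal k w v) ->
  ideal_sub (ideal_exp I m) (weight_ideal k w (m * v)).
Proof.
move=> Iw; apply: ideal_gen_sub => _ [f If ->].
by apply: weight_ideal_prod => i; exact: Iw.
Qed.

Lemma maximal_quot (S : comPzRingType) (J M : ideal S) :
    maximal_ideal M -> ideal_sub J M ->
  exists2 p : ideal (quot_ring J), maximal_ideal p & ideal_eq (comap (to_quot J) p) M.
Proof.
move=> [M1 maxM] JM.
pose P y := exists2 x, M x & y = to_quot J x.
have P0 : P 0 by exists 0; [exact: ideal0 | rewrite rmorph0].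
have PD y z : P y -> P z -> P (y + z).
  by move=> [u Ku ->] [v Kv ->]; exists (u + v); rewrite ?rmorphD //; exact: idealD.
have PM y z : P z -> P (y * z).
  move=> [v Kv ->]; have [u ->] := to_quot_surj y.
  by exists (u * v); rewrite ?rmorphM //; exact: idealM.
pose p := Ideal P0 PD PM.
have pE : ideal_eq (comap (to_quot J) p) M.
  move=> x; split=> [[u Mu e]|Mx]; last by exists x.
  rewrite -(subrK u x); apply: idealD => //; apply: JM; apply/to_quot_eq0.
  by apply/eqP; rewrite rmorphB subr_eq0; apply/eqP.
exists p => //; split.
  by rewrite -(rmorph1 (to_quot J)) => /pE.
move=> K pK K1 y; have [x ->] := to_quot_surj y => Kx.
have Mx : M x.
  apply: (maxM (comap (to_quot J) K)) => //=; last by rewrite rmorph1.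
  by move=> z Mz; apply: pK; exists z.
by exists x.
Qed.

Section Origin.
Variables (k : fieldType) (n : nat).
Local Notation S := {mpoly k[n]}.

Definition origin : ideal S.
Proof.
apply: (@Ideal S (fun f => f@_0%MM = 0)) => [|f g f0 g0|f g g0].
- by rewrite mcoeff0.
- by rewrite mcoeffD f0 g0 addr0.
- by rewrite (rmorphM (mcoeff 0%MM)) /= g0 mulr0.
Defined.

Lemma origin_maximal : maximal_ideal origin.
Proof.
split=> [|K oK K1 f Kf] /=; first by rewrite mcoeff1 eqxx => /eqP; rewrite oner_eq0.
apply: contrapT => /eqP f0; apply: K1.
have K0 : K (f@_0%MM)%:MP.
  rewrite -[X in K X](subKr f); apply: idealB => //; apply: oK => /=.
  by rewrite mcoeffB mcoeffC eqxx mulr1 subrr.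
have := idealM (f@_0%MM)^-1%:MP K0.
by rewrite -mpolyCM mulVf.
Qed.

Lemma origin_weight : ideal_sub origin (weight_ideal k (fun _ => 1%N) 1).
Proof.
move=> f /= f0 m mf; rewrite lt0n; apply: contraTneq mf => w0.
have -> : m = 0%MM.
  apply/mnmP => i; rewrite mnm0E; apply/eqP; rewrite -leqn0 -w0 /weight.
  by rewrite (bigD1 i) //= mul1n leq_addr.
by rewrite mcoeff_msupp f0 eqxx.
Qed.

Variable N : nat.

Definition power_ideal : ideal S.
Proof.
apply: (@Ideal S (fun f => exists c : 'I_n -> S, f = \sum_t c t * 'X_t ^+ N)).
- by exists (fun=> 0); rewrite big1 // => t _; rewrite mul0r.
- move=> _ _ [c ->] [e ->]; exists (fun t => c t + e t).
  by rewrite -big_split; apply: eq_bigr => t _; rewrite mulrDl.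
- move=> a _ [c ->]; exists (fun t => a * c t).
  by rewrite mulr_sumr; apply: eq_bigr => t _; rewrite mulrA.
Defined.

(** Every monomial of the power has degree at least n N, and exponents below N would add up to at
    most n (N - 1). *)
Lemma origin_power f : (0 < N)%N -> (0 < n)%N -> origin f -> power_ideal (f ^+ (n * N)).
Proof.
move=> N0 n0 /origin_weight wf; have : weight_ideal k (fun=> 1%N) (n * N * 1) (f ^+ (n * N)).
  have -> : f ^+ (n * N) = \prod_(i < n * N) f by rewrite prodr_const card_ord.
  exact: weight_ideal_prod.
rewrite muln1 => wfN; apply: mpoly_mem_ideal => m /wfN le_m.
have /existsP[t Nt] : [exists t, (N <= m t)%N].
  apply: contraLR le_m => /existsPn lt_mN; rewrite -ltnNge /weight.
  have le_sum : (\sum_(i < n) 1 * m i <= n * N.-1)%N.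
    rewrite -[leqRHS]/(n * N.-1)%N -[X in (X * _)%N](card_ord n) -sum_nat_const.
    by apply: leq_sum => i _; rewrite mul1n -ltnS prednK // ltnNge.
  by apply: leq_ltn_trans le_sum _; rewrite ltn_pmul2l // prednK.
have le_tm : (U_(t) *+ N <= m)%MM.
  apply/mnm_lepP => i; rewrite mulmnE mnm1E; case: eqP => [<-|//].
  by rewrite mul1n.
exists (fun i => if i == t then 'X_[m - U_(t) *+ N] else 0).
rewrite (bigD1 t) //= eqxx big1 => [|i /negbTE->]; last by rewrite mul0r.
by rewrite addr0 mpolyXn -mpolyXD submK.
Qed.

End Origin.

(* R is the local ring of S/J at the origin, and it has depth at least two. *)
Definition deep_at_origin (k : fieldType) (n : nat) (J : ideal {mpoly k[n]}) :=
  exists (R : comPzRingType) (M : ideal {mpoly k[n]})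
    (phi : {rmorphism {mpoly k[n]} -> R}) (mR : ideal R) (f g : R),
  [/\ localizes J M phi mR, ideal_eq M (origin k n), mR f /\ mR g,
    (forall a, f * a = 0 -> a = 0) &
    (forall a b, g * a = f * b -> exists c, a = f * c)].

(** The chain c shows that the local dimension, hence the depth, is at least 2; the first two terms
    of a regular sequence of that length are the pair required. *)
Lemma cohen_macaulay_deep (k : fieldType) (n : nat) (J : ideal {mpoly k[n]})
    (c : nat -> ideal {mpoly k[n]}) :
    cohen_macaulay_ideal J ->
    (forall i, (i <= 2)%N ->
       [/\ prime_ideal (c i), ideal_sub J (c i) & ideal_sub (c i) (origin k n)]) ->
    (forall i, (i < 2)%N ->
       ideal_sub (c i) (c i.+1) /\ ~ ideal_sub (c i.+1) (c i)) ->
  deep_at_origin J.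
Proof.
move=> [_ cm] pc sc.
have [p pmax pE] : exists2 p : ideal (quot_ring J), maximal_ideal p &
    ideal_eq (comap (to_quot J) p) (origin k n).
  apply: maximal_quot; first exact: origin_maximal.
  by have [_ Jc co] := pc 0%N isT; move=> x /Jc/co.
have [d [_ dmax] [[s [[s1 sreg] sm] sd] _]] := cm p pmax.
have H := localization_localizes pmax; set mR := loc_maximal _ in sm H *.
have le_2d : (2 <= d)%N.
  apply: dmax; apply: (prime_chain_extend H (c := c)) => // i /pc[pci Jc co].
  by split=> // x /co/pE.
rewrite -{}sd {dmax} in le_2d.
case: s s1 sreg sm le_2d => [|f [|g s]] // _ sreg sm _.
exists (localization (maximal_prime pmax)), (comap (to_quot J) p), (to_loc (maximal_prime pmax) \o to_quot J), mR, f, g.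
split=> //; first by split; apply: sm; rewrite !inE eqxx ?orbT.
  move=> a fa; have := sreg 0%N a isT; rewrite [take _ _]/= [nth _ _ _]/= !ideal_seq_nil.
  exact.
move=> a b e; have := sreg 1%N a isT; rewrite [take _ _]/= [nth _ _ _]/=.
have fP x : ideal_seq [:: f] x <-> exists c, x = f * c.
  rewrite (ideal_seq_rcons [::] f x); split=> [[u [v [/ideal_seq_nil -> ->]]]|[v ->]].
    by exists v; rewrite add0r.
  by exists 0, v; rewrite add0r; split=> //; exact/ideal_seq_nil.
by move=> h; apply/fP; apply: h; apply/fP; exists b.
Qed.

Section Deep.
Variables (k : fieldType) (n : nat) (J : ideal {mpoly k[n]}).
Hypothesis deepJ : deep_at_origin J.
Local Notation S := {mpoly k[n]}.

(** The fractions a_t / x_t^N agree on overlaps, so they extend to a fraction b / s at the origin.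
    Equality in the local ring is brought back to J by enlarging s, and a common s is arranged for
    the two charts to be compared. *)
Lemma deep_section (N : nat) (a : 'I_n -> S) (t1 t2 : 'I_n) : (0 < N)%N ->
    (forall s t, J ('X_s ^+ N * a t - 'X_t ^+ N * a s)) ->
  exists s b, [/\ s@_0%MM != 0, J (s * a t1 - 'X_t1 ^+ N * b)
    & J (s * a t2 - 'X_t2 ^+ N * b)].
Proof.
move=> N0 Ja; have [R [M [phi [mR [f [g [H ME [mf mg] rf rg]]]]]]] := deepJ.
have n0 : (0 < n)%N by case: (n) t1 => [[]|].
have phiJ x : J x -> phi x = 0.
  move=> Jx; apply/(loc_kerP H); exists 1; last by rewrite mul1r.
  by case: (maximal_prime (loc_max H)).
have pow x : mR x -> exists c : 'I_n -> R, x ^+ (n * N) = \sum_t c t * phi ('X_t ^+ N).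
  move=> /(loc_maxP H)[u [s [Mu ns e]]]; have [w we] := loc_unitP H ns.
  have [c cE] := origin_power N0 n0 ((ME u).1 Mu).
  exists (fun t => w ^+ (n * N) * phi (c t)).
  have -> : x = w * phi u by rewrite -e mulrCA we mulr1.
  rewrite exprMn -rmorphXn cE rmorph_sum mulr_sumr.
  by apply: eq_bigr => t _; rewrite rmorphM mulrA.
have [c cE] := pow f mf; have [e eE] := pow g mg.
have [|b bE] := punctured_section rf rg (a := fun t => phi (a t)) _ cE eE.
  move=> s t; apply/eqP; rewrite -subr_eq0 -!rmorphM -rmorphB; apply/eqP.
  exact: phiJ.
have [u [s [ns ue]]] := loc_fracP H b.
have key t : exists2 v, ~ M v & J (v * (s * a t - 'X_t ^+ N * u)).
  apply/(loc_kerP H); rewrite rmorphB !rmorphM -ue bE; ring.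
have [v1 nv1 J1] := key t1; have [v2 nv2 J2] := key t2.
exists (v1 * v2 * s), (v1 * v2 * u); split.
- apply/eqP => z; have : M (v1 * v2 * s) by apply/ME.
  by apply: (loc_denM H) => //; exact: (loc_denM H).
- have -> : v1 * v2 * s * a t1 - 'X_t1 ^+ N * (v1 * v2 * u) =
    v2 * (v1 * (s * a t1 - 'X_t1 ^+ N * u)) by ring.
  exact: idealM.
- have -> : v1 * v2 * s * a t2 - 'X_t2 ^+ N * (v1 * v2 * u) =
    v1 * (v2 * (s * a t2 - 'X_t2 ^+ N * u)) by ring.
  exact: idealM.
Qed.

Lemma mcoeffM_X0 (p : S) m : (p * 'X_[m])@_m = p@_0%MM.
Proof. by rewrite -[X in _@_X]addm0 mcoeffMX. Qed.

(** The section equal to x^al on D(x_t) for t in [eps] and to 0 on the other charts would extend to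
    b / s. Comparing coefficients on the charts t1 and t2, the coefficient of x^al in b is both
    s(0), which is not 0, and 0. *)
Lemma deep_connected (al : 'X_{1..n}) (N : nat) (eps : pred 'I_n) (t1 t2 : 'I_n) :
    (0 < N)%N -> eps t1 -> ~~ eps t2 ->
    (forall s t, eps s -> ~~ eps t -> J ('X_[al] * ('X_s ^+ N * 'X_t ^+ N))) ->
    (forall f, J f -> f@_(al + U_(t1) *+ N)%MM = 0) ->
    (forall f, J f -> f@_(al + U_(t2) *+ N)%MM = 0) ->
  False.
Proof.
move=> N0 e1 e2 Jst c1 c2.
pose a t : S := if eps t then 'X_[al] * 'X_t ^+ N else 0.
have [s t|s [b [s0 /c1 b1 /c2 b2]]] := @deep_section N a t1 t2 N0.
  rewrite /a; case: ifP => et; case: ifP => es; rewrite ?mulr0 ?subr0 ?sub0r.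
  - have -> : 'X_s ^+ N * ('X_[al] * 'X_t ^+ N) - 'X_t ^+ N * ('X_[al] * 'X_s ^+ N) = 0 :> S.
      by ring.
    exact: ideal0.
  - rewrite mulrCA [_ ^+ N * _]mulrC; apply: Jst => //; exact: negbT.
  - apply: idealN; rewrite mulrCA [_ ^+ N * _]mulrC; apply: Jst => //; exact: negbT.
  - exact: ideal0.
move: b1 b2; rewrite /a e1 (negbTE e2) !mcoeffB mulr0 mcoeff0 sub0r.
rewrite !mpolyXn -?mpolyXD mcoeffM_X0.
rewrite ![_ * b]mulrC ![(al + _)%MM]addmC !mcoeffMX => /eqP.
rewrite subr_eq0 => /eqP s0E /eqP; rewrite oppr_eq0 => /eqP b0.
by rewrite s0E b0 eqxx in s0.
Qed.

(** Here the section is x^al / x_t^N on D(x_t) and 0 on all other charts. It has a genuine pole, as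
    [al t < N]: the monomial x^al does not occur in x_t^N b, so an extension b / s would have s(0) =
    0. *)
Lemma deep_no_isolated (al : 'X_{1..n}) (N : nat) (t : 'I_n) :
    (al t < N)%N ->
    (forall s, s != t -> J ('X_[al] * 'X_s ^+ N)) ->
    (forall f, J f -> f@_al = 0) ->
  False.
Proof.
move=> N0 Js c; pose a u : S := if u == t then 'X_[al] else 0.
have [|u v|s [b [s0 /c b1 _]]] := @deep_section N a t t.
- exact: leq_ltn_trans N0.
- rewrite /a; case: eqP => [->|/eqP nv]; case: eqP => [->|/eqP nu].
  + by rewrite subrr; exact: ideal0.
  + by rewrite mulr0 subr0 mulrC; exact: Js.
  + by rewrite mulr0 sub0r; apply: idealN; rewrite mulrC; exact: Js.
  + by rewrite !mulr0 subr0; exact: ideal0.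
move: b1; rewrite /a eqxx mcoeffB mcoeffM_X0 [X in _ - X]memN_msupp_eq0.
  by rewrite subr0 => /eqP; rewrite (negbTE s0).
rewrite mulrC mpolyXn (perm_mem (msuppMX _ _)); apply/mapP => -[m _ alE].
by move: N0; rewrite alE mnmDE mulmnE mnm1E eqxx mul1n ltnNge leq_addr.
Qed.

End Deep.

(** * Powers of graph ideals *)

Lemma ideal_exp_mul (R : comPzRingType) (I : ideal R) m x y :
  I x -> ideal_exp I m y -> ideal_exp I m.+1 (x * y).
Proof.
move=> Ix.
have K0 : ideal_exp I m.+1 (x * 0) by rewrite mulr0; exact: ideal0.
have KD u v : ideal_exp I m.+1 (x * u) -> ideal_exp I m.+1 (x * v) ->
    ideal_exp I m.+1 (x * (u + v)) by rewrite mulrDr; exact: idealD.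
have KM u v : ideal_exp I m.+1 (x * v) -> ideal_exp I m.+1 (x * (u * v)).
  by rewrite mulrCA; exact: idealM.
apply: (ideal_gen_sub (J := @Ideal R (fun u => ideal_exp I m.+1 (x * u)) K0 KD KM)).
move=> _ [f If ->]; apply: mem_ideal_gen.
exists (fun i => if unlift ord0 i is Some j then f j else x).
  by move=> i; case: unliftP => [j|].
rewrite big_ord_recl unlift_none; congr (_ * _).
by apply: eq_bigr => i _; rewrite liftK.
Qed.

Lemma ideal_exp0 (R : comPzRingType) (I : ideal R) x : ideal_exp I 0 x.
Proof.
rewrite -[x]mulr1; apply: idealM; apply: mem_ideal_gen; exists (fun=> 0) => [[]//|].
by rewrite big_ord0.
Qed.

Lemma ideal_exp_sub (R : comPzRingType) (I : ideal R) m :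
  (0 < m)%N -> ideal_sub (ideal_exp I m) I.
Proof.
case: m => // m _; apply: ideal_gen_sub => _ [f If ->].
by rewrite big_ord_recl; apply: idealMr.
Qed.

(** * Ideals generated by variables *)

Section VarIdeal.
Variables (k : fieldType) (n : nat) (T : pred 'I_n).
Local Notation S := {mpoly k[n]}.

Definition var_proj : S -> S := mmap (@mpolyC n k) (fun u => if T u then 'X_u else 0).

HB.instance Definition _ := GRing.RMorphism.copy var_proj
  (mmap (@mpolyC n k) (fun u => if T u then 'X_u else 0)).

(** T lists the variables that survive in the quotient, so P_ij belongs to [pred2 i j] and the
    origin to [pred0]. *)
Definition var_ideal : ideal S :=
  ideal_gen (fun f => exists2 u, ~~ T u & f = 'X_u).

Lemma var_projX u : var_proj 'X_u = if T u then 'X_u else 0.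
Proof. by rewrite /var_proj mmapX mmap1U. Qed.

Lemma var_ideal_mon m : var_proj 'X_[m] = 'X_[m] \/ var_ideal 'X_[m] /\ var_proj 'X_[m] = 0.
Proof.
case: (pickP (fun u => ~~ T u && (m u != 0%N))) => [u /andP[nT mu]|mT].
  right; split.
    by apply: ideal_mpolyX mu _; apply: mem_ideal_gen; exists u.
  have le_um : (U_(u) <= m)%MM by rewrite lep1mP.
  by rewrite -(submK le_um) mpolyXD rmorphM /= [X in _ * X]var_projX (negbTE nT) mulr0.
left; rewrite mpolyXE_id rmorph_prod; apply: eq_bigr => u _.
rewrite rmorphXn /= var_projX; case: ifP => // Tu.
by have := mT u; rewrite Tu => /negbFE/eqP->.
Qed.

Lemma var_idealP f : var_ideal f <-> var_proj f = 0.
Proof.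
split.
  have K0 : var_proj 0 = 0 by rewrite rmorph0.
  have KD u v : var_proj u = 0 -> var_proj v = 0 -> var_proj (u + v) = 0.
    by move=> eu ev; rewrite rmorphD /= eu ev addr0.
  have KM u v : var_proj v = 0 -> var_proj (u * v) = 0.
    by move=> ev; rewrite rmorphM /= ev mulr0.
  apply: (ideal_gen_sub (J := @Ideal _ (fun u => var_proj u = 0) K0 KD KM)) => _ [u nT ->] /=.
  by rewrite var_projX (negbTE nT).
move=> f0; rewrite -(subr0 f) -f0 {f0}.
rewrite {2}(mpolyE f) rmorph_sum {1}(mpolyE f) -sumrB; apply: ideal_sum => m _.
rewrite -mul_mpolyC; have -> : forall c : k, c%:MP * 'X_[m] - var_proj (c%:MP * 'X_[m]) =
    c%:MP * ('X_[m] - var_proj 'X_[m]).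
  by move=> c; rewrite rmorphM /= [var_proj _%:MP]mmapC -mulrBr.
apply: idealM.
by case: (var_ideal_mon m) => [->|[vm ->]]; rewrite ?subrr ?subr0 //; exact: ideal0.
Qed.

Lemma var_ideal_prime : prime_ideal var_ideal.
Proof.
split=> [/var_idealP/eqP|a b /var_idealP]; first by rewrite rmorph1 oner_eq0.
by rewrite rmorphM /= => /eqP; rewrite mulf_eq0 => /orP[]/eqP e; [left|right]; apply/var_idealP.
Qed.

Lemma var_idealX u : var_ideal 'X_u <-> ~~ T u.
Proof.
split=> [/var_idealP|nT]; last by apply: mem_ideal_gen; exists u.
rewrite var_projX; case: (T u) => // /eqP.
by rewrite -msize_poly_eq0 msizeX mdeg1.
Qed.

Lemma var_ideal_weight :
  ideal_eq var_ideal (weight_ideal k (fun u => ~~ T u) 1).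
Proof.
move=> f; split.
  apply: ideal_gen_sub => _ [u nT ->] m; rewrite msuppX inE => /eqP ->.
  by rewrite -[U_(u)%MM]mulm1n weightU nT.
move=> wf; apply: mpoly_mem_ideal => m /wf.
case: (pickP (fun u => ~~ T u && (m u != 0%N))) => [u /andP[nT mu] _|mT].
  by apply: ideal_mpolyX mu _; apply: mem_ideal_gen; exists u.
rewrite /weight big1 // => u _; have := mT u; case: (T u) => //= /negbFE/eqP->.
by rewrite muln0.
Qed.

End VarIdeal.

Lemma var_idealS (k : fieldType) (n : nat) (T U : pred 'I_n) :
  {subset U <= T} -> ideal_sub (var_ideal k T) (var_ideal k U).
Proof.
move=> UT; apply: ideal_gen_sub => _ [u nT ->]; apply: mem_ideal_gen.
by exists u => //; apply: contra nT; exact: UT.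
Qed.

Lemma edge_primeE (k : fieldType) (n : nat) (i j : 'I_n) :
  ideal_eq (edge_prime k i j) (var_ideal k (pred2 i j)).
Proof.
move=> f; split; apply: ideal_gen_sub => x.
  by move=> [t [ti tj ->]]; apply: mem_ideal_gen; exists t; rewrite //= negb_or ti.
by move=> [t /= /norP[ti tj] ->]; apply: mem_ideal_gen; exists t.
Qed.

Section GraphPowers.
Variables (k : fieldType) (n : nat) (G : rel 'I_n).
Hypothesis hG : simple_graph G.
Local Notation S := {mpoly k[n]}.
Local Notation I := (graph_ideal k G).

Let Gsym : ssrbool.symmetric G. Proof. by case: hG. Qed.
Let Girr : irreflexive G. Proof. by case: hG. Qed.

Lemma graph_neq s t : G s t -> s != t.
Proof. by apply: contraTneq => ->; rewrite Girr. Qed.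

Definition off (s t u : 'I_n) := (u != s) && (u != t).

(** The valuation with these weights is the order along P_st. *)
Definition woff (s t u : 'I_n) : nat := off s t u.

Lemma graph_ideal_edge s t : G s t -> ideal_sub I (weight_ideal k (woff s t) 1).
Proof.
move=> st f /(_ s t st)/edge_primeE/var_ideal_weight wf m /wf.
by rewrite /weight /woff /off; under eq_bigr do rewrite /= negb_or.
Qed.

Lemma graph_power_coef s t m f al : G s t -> ideal_exp I m f ->
  (weight (woff s t) al < m)%N -> f@_al = 0.
Proof.
move=> st If lt_m; apply: weight_ideal_coef (_ : (_ < m * 1)%N); last by rewrite muln1; exact: lt_m.
exact: (ideal_exp_weight (graph_ideal_edge st)).
Qed.

Lemma graph_idealX (al : 'X_{1..n}) :
  (forall i j, G i j -> exists2 u, al u != 0%N & off i j u) -> I 'X_[al].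
Proof.
move=> ex i j /ex[u alu ou]; apply/edge_primeE; apply: ideal_mpolyX alu _.
by apply/var_idealX; rewrite /= negb_or; exact: ou.
Qed.

Lemma graph_nonedge s t : s != t -> ~~ G s t -> I ('X_s * 'X_t).
Proof.
move=> st nst; rewrite -mpolyXD; apply: graph_idealX => i j ij.
have [si|si] := boolP (off i j s); first by exists s; rewrite // mnmDE !mnm1E eqxx.
exists t; first by rewrite mnmDE !mnm1E eqxx addn1.
move: si; rewrite /off negb_and !negbK => /orP[]/eqP sE; subst s.
  by rewrite eq_sym st /=; apply: contraNneq nst => ->.
by rewrite [t == j]eq_sym st andbT; apply: contraNneq nst => ->; rewrite Gsym.
Qed.

Lemma graph_triple s t u : s != t -> s != u -> t != u -> I ('X_s * ('X_t * 'X_u)).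
Proof.
move=> st su tu; rewrite -!mpolyXD; apply: graph_idealX => i j ij.
have [os|os] := boolP (off i j s); first by exists s; rewrite // !mnmDE !mnm1E eqxx.
have [ot|ot] := boolP (off i j t).
  by exists t; rewrite // !mnmDE !mnm1E eqxx addnA addn1.
exists u; first by rewrite !mnmDE !mnm1E eqxx addnA addn1.
move: os ot; rewrite /off !negb_and !negbK.
move=> /orP[]/eqP sE /orP[]/eqP tE; subst s t; move: st su tu; rewrite ?eqxx //.
  by rewrite ![u == _]eq_sym => _ -> ->.
by rewrite ![u == _]eq_sym => _ -> ->.
Qed.

(** Peel off m elements of I_G: x_s x_t if st is not an edge, and otherwise x_s x_t x_u with u off
    the edge. Each costs one x_s and one x_t, and on an edge one unit of the order along P_st. *)
Lemma mem_graph_power s t m (be : 'X_{1..n}) : s != t ->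
    (m <= be s)%N -> (m <= be t)%N -> (G s t -> (m <= weight (woff s t) be)%N) ->
  ideal_exp I m 'X_[be].
Proof.
move=> st; elim: m be => [|m IH] be sm tm wm; first exact: ideal_exp0.
have [Gst|nst] := boolP (G s t); last first.
  have le_be : (U_(s) + U_(t) <= be)%MM.
    apply/mnm_lepP => i; rewrite mnmDE !mnm1E.
    by case: eqP => [<-|_]; case: eqP => // e; rewrite ?addn0 ?add0n -?e //;
      [rewrite e eqxx in st | lia ..].
  rewrite -(submK le_be) mpolyXD mulrC mpolyXD; apply: ideal_exp_mul; first exact: graph_nonedge.
  apply: IH => [||/(negP nst)//]; rewrite mnmBE mnmDE !mnm1E eqxx.
    by rewrite [t == s]eq_sym (negbTE st); lia.
  by rewrite (negbTE st); lia.
have /existsP[u /andP[ou bu]] : [exists u, off s t u && (be u != 0%N)].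
  apply: contraTT (wm Gst) => /existsPn nex; rewrite -ltnNge /weight big1 // => u _.
  by have := nex u; rewrite /woff negb_and negbK => /orP[/negbTE->|/eqP->]; rewrite ?muln0.
have /andP[us ut] := ou.
have le_be : (U_(s) + (U_(t) + U_(u)) <= be)%MM.
  apply/mnm_lepP => i; rewrite !mnmDE !mnm1E.
  case: (eqVneq s i) => [<-|si]; first by rewrite [t == s]eq_sym (negbTE st) (negbTE us); lia.
  case: (eqVneq t i) => [<-|ti]; first by rewrite (negbTE ut); lia.
  by case: (eqVneq u i) => [<-|//]; lia.
have wE : weight (woff s t) be = (weight (woff s t) (be - (U_(s) + (U_(t) + U_(u)))) + 1)%N.
  rewrite -{1}(submK le_be) weightD; congr (_ + _)%N.
  rewrite !weightD -[U_(s)%MM]mulm1n -[U_(t)%MM]mulm1n -[U_(u)%MM]mulm1n !weightU.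
  by rewrite /woff /off !eqxx us ut !andbF.
rewrite -(submK le_be) mpolyXD mulrC !mpolyXD; apply: ideal_exp_mul.
  by apply: graph_triple; rewrite // eq_sym.
apply: IH => [||_].
- by rewrite mnmBE !mnmDE !mnm1E eqxx [t == s]eq_sym (negbTE st) (negbTE us); lia.
- by rewrite mnmBE !mnmDE !mnm1E eqxx (negbTE st) (negbTE ut); lia.
- by have := wm Gst; rewrite wE; lia.
Qed.

End GraphPowers.

(** * Cohen-Macaulay powers *)

Definition max_degree_two (n : nat) (G : rel 'I_n) :=
  forall t a b c, G t a -> G t b -> G t c -> uniq [:: a; b; c] -> False.

Definition four_cycle (n : nat) (G : rel 'I_n) :=
  exists a b c d, [/\ uniq [:: a; b; c; d], forall i, i \in [:: a; b; c; d],
    [/\ G a b, G b c, G c d & G d a], ~~ G a c & ~~ G b d].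

Section CohenMacaulayPower.
Variables (k : fieldType) (n : nat) (G : rel 'I_n).
Hypothesis hG : simple_graph G.
Local Notation S := {mpoly k[n]}.
Local Notation I := (graph_ideal k G).

Let Gsym : ssrbool.symmetric G. Proof. by case: hG. Qed.
Let Girr : irreflexive G. Proof. by case: hG. Qed.

Lemma graph_chain m : (0 < n)%N -> (0 < m)%N -> exists c : nat -> ideal S,
  (forall i, (i <= 2)%N -> [/\ prime_ideal (c i), ideal_sub (ideal_exp I m) (c i) &
     ideal_sub (c i) (origin k n)]) /\
  (forall i, (i < 2)%N -> ideal_sub (c i) (c i.+1) /\ ~ ideal_sub (c i.+1) (c i)).
Proof.
move=> n0 m0; pose s : 'I_n := Ordinal n0.
have [t st] : exists t, G s t by case: hG.
(* The default [pred0] supplies index 2, the ideal of all variables. *)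
pose T i : pred 'I_n := nth pred0 [:: pred2 s t; pred1 s] i.
have TS i : {subset T i.+1 <= T i}.
  by case: i => [|i] u; rewrite /T /in_mem /= ?nth_nil // => ->.
have T0 i : {subset T i <= T 0%N} by elim: i => // i IH u /TS/IH.
have Iv i : ideal_sub (ideal_exp I m) (var_ideal k (T i)).
  move=> x /(ideal_exp_sub m0)/(_ _ _ st)/edge_primeE.
  by apply: var_idealS; exact: T0.
exists (fun i => var_ideal k (T i)); split=> i.
  move=> _; split=> //; first exact: var_ideal_prime.
  apply: ideal_gen_sub => _ [u _ ->] /=.
  by rewrite mcoeffX mnm1_eq0.
move=> i2; split; first exact: var_idealS.
have [u Tu nTu] : exists2 u, T i u & ~~ T i.+1 u.
  case: i i2 => [|[|//]] _; [exists t | exists s]; rewrite /T //= ?eqxx ?orbT //.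
  by rewrite eq_sym (graph_neq hG st).
move=> /(_ 'X_u (proj2 (var_idealX k _ _) nTu))/var_idealX.
by rewrite Tu.
Qed.

Variable m : nat.
Hypothesis m_ge3 : (3 <= m)%N.
Hypothesis deepI : deep_at_origin (ideal_exp I m).

Lemma weight_mul2 (w : 'I_n -> nat) a b c x y z :
  weight w ((U_(a) *+ x + U_(b) *+ y) + U_(c) *+ z)%MM =
  (w a * x + w b * y + w c * z)%N.
Proof. by rewrite !weightD !weightU. Qed.

Lemma deep_max_degree : max_degree_two G.
Proof.
move=> t a b c ta tb tc; rewrite /= !inE negb_or andbT => /andP[/andP[ab ac] bc].
have [[nta ntb] ntc] := (graph_neq hG ta, graph_neq hG tb, graph_neq hG tc).
(* Where x_t is invertible, I_G is generated by the x_u with u not adjacent to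
   t and the products of two distinct neighbours of t.  The monomial al lies in
   the m-th symbolic power of that ideal, but its weight is 2m - 1 < 2m. *)
pose ga := (U_(a) *+ m.-1 + U_(b) *+ m.-1 + U_(c) *+ 1)%MM.
pose al := (U_(t) *+ m + ga)%MM.
have al_t : al t = m.
  rewrite !mnmDE !mulmnE !mnm1E eqxx [a == t]eq_sym [b == t]eq_sym [c == t]eq_sym.
  by rewrite (negbTE nta) (negbTE ntb) (negbTE ntc); clear -m_ge3; lia.
apply: (deep_no_isolated deepI (al := al) (N := m.+1) (t := t)); first by rewrite al_t.
  move=> s st; rewrite mpolyXn -mpolyXD.
  apply: (mem_graph_power hG (s := s) (t := t)) => //.
  - by rewrite mnmDE mulmnE mnm1E eqxx; clear -m_ge3; lia.
  - by rewrite mnmDE al_t leq_addr.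
  move=> _; rewrite weightD weightD weight_mul2 /woff /off.
  rewrite [a == t]eq_sym [b == t]eq_sym [c == t]eq_sym nta ntb ntc !andbT.
  case: (eqVneq a s) => [<-|_]; first by rewrite [b == a]eq_sym [c == a]eq_sym ab ac; clear -m_ge3; lia.
  case: (eqVneq b s) => [<-|_]; first by rewrite [c == b]eq_sym bc; clear -m_ge3; lia.
  by case: (c != s); clear -m_ge3; lia.
(* Every monomial of I_G has weight at least 2. Otherwise it involves, besides x_t, only neighbours
   of t; P_ta forces one of them, u, and then P_tu forces a second one. *)
pose w u : nat := if u == t then 0 else if G t u then 1 else 2.
have Iw : ideal_sub I (weight_ideal k w 2).
  move=> f If mu mf; rewrite leqNgt; apply/negP => lt_w.
  have nbr u : mu u != 0%N -> u != t -> G t u /\ (2 <= w u * mu u)%N = false.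
    move=> muu ut; have le_w : (w u * mu u <= weight w mu)%N.
      by rewrite /weight (bigD1 u) //= leq_addr.
    have := leq_ltn_trans le_w lt_w; rewrite /w (negbTE ut).
    by clear -muu; case: (G t u) => /=; lia.
  have two j : G t j -> exists2 u, mu u != 0%N & off t j u.
    move=> tj; have /var_ideal_weight := (edge_primeE _ _ _).1 (If _ _ tj).
    move=> /(_ _ mf) ge1; apply/exists2P; apply: contrapT => /forallNP nex.
    move: ge1; rewrite /weight big1 // => u _ /=.
    have := nex u; rewrite /off; case: (eqVneq (mu u) 0%N) => [->|mu0]; first by rewrite muln0.
    by rewrite negb_or; case: (_ && _) => // -[].
  have [u muu /andP[ut ua]] := two a ta.
  have [tu _] := nbr u muu ut.
  have [v muv /andP[vt vu]] := two u tu.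
  have [tv _] := nbr v muv vt.
  move: lt_w; rewrite /weight (bigD1 u) //= (bigD1 v) //=.
  rewrite /w (negbTE ut) (negbTE vt) tu tv.
  by move: (\sum_(i | _) _)%N => r; clear -muu muv; lia.
move=> f /(ideal_exp_weight Iw)/weight_ideal_coef; apply.
rewrite /al weightD weightU weight_mul2 /w eqxx ta tb tc.
by rewrite [a == t]eq_sym [b == t]eq_sym [c == t]eq_sym (negbTE nta) (negbTE ntb) (negbTE ntc); clear -m_ge3; lia.
Qed.

Lemma deep_no_star a b c d :
    G a b -> G c d -> uniq [:: a; b; c; d] -> ~~ G b c -> ~~ G b d -> False.
Proof.
move=> Gab Gcd; rewrite /= !inE !negb_or !andbT.
move=> /and3P[/and3P[ab ac ad] /andP[bc bd] cd] nbc nbd.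
(* On the punctured spectrum this monomial survives along ab and cd, and along no
   edge that joins cd to another vertex. *)
pose al := (U_(b) *+ m.-1 + U_(c) *+ 1 + U_(d) *+ 1)%MM.
pose sy := (eq_sym b a, eq_sym c a, eq_sym d a, eq_sym c b, eq_sym d b, eq_sym d c).
have m0 : (0 < m)%N by exact: leq_trans m_ge3.
apply: (deep_connected deepI (al := al) (eps := pred2 c d) (t1 := c) (t2 := a) m0).
- by rewrite /= eqxx.
- by rewrite /= (negbTE ac) (negbTE ad).
- move=> s t es; rewrite /= negb_or => /andP[tc td].
  rewrite !mpolyXn -!mpolyXD.
  have st : s != t by case/orP: es => /eqP->; rewrite eq_sym.
  apply: (mem_graph_power hG st).
  + by rewrite !(mnmDE, mulmnE, mnm1E) eqxx; clear -m_ge3; lia.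
  + by rewrite !(mnmDE, mulmnE, mnm1E) eqxx; clear -m_ge3; lia.
  move=> Gst; rewrite weightD weight_mul2 /woff /off.
  have bt : b != t.
    by apply: contraTneq Gst => <-; case/orP: es => /eqP->; rewrite Gsym.
  by case/orP: es => /eqP ->; rewrite ?(eq_sym c t) ?(eq_sym d t) ?sy ?bt ?bc ?bd ?cd ?tc ?td ?eqxx /=; clear -m_ge3; lia.
- move=> f If; apply: (graph_power_coef Gcd If).
  by rewrite weightD weight_mul2 weightU /woff /off ?sy bc bd !eqxx ?andbF /=; clear -m_ge3; lia.
(* Off the edge ab only x_c x_d remains, of order 2, which is below m because m >= 3. *)
- move=> f If; apply: (graph_power_coef Gab If).
  by rewrite weightD weight_mul2 weightU /woff /off ?sy ac ad ?bc ?bd !eqxx ?andbF /=; clear -m_ge3; lia.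
Qed.

(** If both pairings fail, each lacks an edge, and any two such missing edges share an end. That end
    is adjacent to neither end of the opposite edge, as [deep_no_star] forbids. *)
Lemma deep_matching a b c d : G a b -> G c d -> uniq [:: a; b; c; d] ->
  G a c && G b d || G a d && G b c.
Proof.
move=> ab cd u.
have perm s : perm_eq s [:: a; b; c; d] -> uniq s by move=> /perm_uniq->.
apply: contrapT => /negP/norP; rewrite !negb_and => -[/orP[nac|nbd] /orP[nad|nbc]].
- apply: (@deep_no_star b a c d) => //; first by rewrite Gsym.
  by apply: perm; apply/permP => p /=; lia.
- apply: (@deep_no_star d c a b); rewrite // 1?Gsym //.
  by apply: perm; apply/permP => p /=; lia.
- apply: (@deep_no_star c d a b); rewrite // 1?Gsym //.
  by apply: perm; apply/permP => p /=; lia.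
- exact: (@deep_no_star a b c d).
Qed.

Lemma deep_classification : (n <= 3)%N \/ four_cycle G.
Proof.
case: leqP => [|n4]; [by left | right].
have deg := deep_max_degree.
have out s : (size s < 4)%N -> exists u : 'I_n, u \notin s.
  move=> s4; apply/existsP; apply: contraTT s4 => /existsPn all_s.
  rewrite -leqNgt; apply: leq_trans n4 _; rewrite -[n in (n <= _)%N]card_ord.
  apply: leq_trans (card_size s); apply: subset_leq_card; apply/fintype.subsetP => u _.
  by rewrite -[_ \in _]negbK.
have nbr u : exists v, G u v by case: hG.
(* Given an edge ab, two further vertices either lie on an edge disjoint from ab or are both joined
   to it. In the latter case a common end would have degree 3, and different ends give two disjoint
   edges. *)
have [a [b [c [d [ab cd u4]]]]] : exists a b c d, [/\ G a b, G c d & uniq [:: a; b; c; d]].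
  have [a _] := out [::] isT; have [b ab] := nbr a.
  have nab := graph_neq hG ab.
  have [c] := out [:: a; b] isT; rewrite !inE negb_or => /andP[ca cb].
  have [d] := out [:: a; b; c] isT; rewrite !inE !negb_or => /and3P[da db dc].
  have adj e : e != a -> e != b -> (exists a b c d, [/\ G a b, G c d & uniq [:: a; b; c; d]])
      \/ G a e \/ G b e.
    move=> ea eb; have [v ev] := nbr e; have nev := graph_neq hG ev.
    have [va|va] := eqVneq v a; first by right; left; rewrite Gsym -va.
    have [vb|vb] := eqVneq v b; first by right; right; rewrite Gsym -vb.
    left; exists a, b, e, v; split=> //=.
    by rewrite !inE !negb_or nab nev ![a == _]eq_sym ![b == _]eq_sym ea eb va vb.
  case: (adj c ca cb) => // adjc; case: (adj d da db) => // adjd.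
  rewrite eq_sym in ca; rewrite eq_sym in da; rewrite eq_sym in cb.
  rewrite eq_sym in db; rewrite eq_sym in dc.
  case: adjc adjd => [ac|bc] [ad|bd].
  - by case: (deg a b c d) => //=; rewrite !inE !negb_or cb db dc.
  - exists a, c, b, d; split=> //=; rewrite !inE !negb_or nab ca da dc db eq_sym cb.
    by [].
  - exists a, d, b, c; split=> //=; rewrite !inE !negb_or nab ca da cb.
    by rewrite [d == b]eq_sym [d == c]eq_sym db dc.
  - by case: (deg b a c d) => //=; rewrite 1?Gsym // !inE !negb_or ca da dc.
wlog [bc da] : c d cd u4 / G b c /\ G d a.
  move=> W; case/orP: (deep_matching ab cd u4) => /andP[x y]; last first.
    by apply: (W c d) => //; split=> //; rewrite Gsym.
  apply: (W d c); rewrite 1?Gsym //; last by split=> //; rewrite Gsym.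
  by rewrite -(perm_uniq (s1 := [:: a; b; c; d])) //; apply/permP => p /=; lia.
have u4' := u4; move: u4'; rewrite /= !inE !negb_or !andbT.
move=> /and3P[/and3P[nab nac nad] /andP[nbc nbd] ncd].
have sy := (eq_sym b a, eq_sym c a, eq_sym d a, eq_sym c b, eq_sym d b, eq_sym d c).
have only e x y z : G e x -> G e y -> x != y -> G e z -> (z == x) || (z == y).
  move=> ex ey xy ez; apply: contrapT => /negP/norP[zx zy].
  by apply: (deg e x y z) => //=; rewrite !inE !negb_or xy [x == z]eq_sym [y == z]eq_sym zx zy.
(* The cycle already uses both neighbours that each of its vertices may have. *)
have nearby e v : e \in [:: a; b; c; d] -> G e v -> v \in [:: a; b; c; d].
  have ba : G b a by rewrite Gsym.
  have cb : G c b by rewrite Gsym.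
  have dc : G d c by rewrite Gsym.
  have ad : G a d by rewrite Gsym.
  rewrite !inE => /or4P[]/eqP-> ev.
  - by have := only a b d v ab ad nbd ev; case/orP=> /eqP->; rewrite eqxx ?orbT.
  - by have := only b a c v ba bc nac ev; case/orP=> /eqP->; rewrite eqxx ?orbT.
  - by have := only c b d v cb cd nbd ev; case/orP=> /eqP->; rewrite eqxx ?orbT.
  - by have := only d c a v dc da _ ev; rewrite sy => /(_ nac)/orP[]/eqP->; rewrite eqxx ?orbT.
exists a, b, c, d; split=> //.
(* An edge iv away from the cycle would be matched with ab, joining a to a vertex outside the
   cycle. *)
- move=> i; apply: contrapT => /negP ni; have [v iv] := nbr i.
  have nv : v \notin [:: a; b; c; d].
    by apply: contraNN ni => /nearby; apply; rewrite Gsym.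
  have : uniq [:: a; b; i; v].
    move: ni nv; rewrite /= !inE !negb_or => /and4P[ia ib _ _] /and4P[va vb _ _].
    by rewrite nab ![a == _]eq_sym ![b == _]eq_sym ia ib va vb (graph_neq hG iv).
  move=> /(deep_matching ab iv)/orP[]/andP[ai _].
    by move/negP: ni; apply; apply: (nearby a); rewrite ?inE ?eqxx.
  by move/negP: nv; apply; apply: (nearby a); rewrite ?inE ?eqxx.
- apply/negP => ac; have := only a b d c ab _ nbd ac; rewrite Gsym => /(_ da).
  by rewrite sy (negbTE nbc) (negbTE ncd).
- apply/negP => bd; have := only b a c d _ bc nac bd; rewrite Gsym => /(_ ab).
  by rewrite !sy (negbTE nad) (negbTE ncd).
Qed.

End CohenMacaulayPower.

(** * Generators of complete intersections *)

(* Functionals which are linear over an evaluation of the ring factor through *)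
(* I/mI, so dual families bound the number of generators from below.          *)
Lemma generators_lower_bound (k : fieldType) (R : comPzRingType) (I : ideal R)
    (s : seq R) (F : finType) (ev : R -> k) (L : F -> R -> k) (g : F -> R) :
    ideal_eq I (ideal_seq s) ->
    (forall i x y, L i (x + y) = L i x + L i y) ->
    (forall i a x, I x -> L i (a * x) = ev a * L i x) ->
    (forall i, I (g i)) -> (forall i j, L i (g j) = (i == j)%:R) ->
  (#|F| <= size s)%N.
Proof.
move=> IE LD LM Ig Lg; rewrite leqNgt; apply/negP => lt_sF.
have [|c [[j cj] cL]] := @wide_matrix_kernel k F 'I_(size s) (fun i l => L i s`_l).
  by rewrite card_ord.
have L0 i : L i 0 = 0 by apply: (@addrI _ (L i 0)); rewrite -LD !addr0.
pose P x := I x /\ \sum_i c i * L i x = 0.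
have P0 : P 0 by split; [exact: ideal0 | rewrite big1 // => i _; rewrite L0 mulr0].
have PD x y : P x -> P y -> P (x + y).
  move=> [Ix x0] [Iy y0]; split; first exact: idealD.
  by under eq_bigr do rewrite LD mulrDr; rewrite big_split /= x0 y0 addr0.
have PM a x : P x -> P (a * x).
  move=> [Ix x0]; split; first exact: idealM.
  by under eq_bigr do rewrite LM // mulrCA; rewrite -mulr_sumr x0 mulr0.
have [_] : P (g j).
  apply: (ideal_gen_sub (J := @Ideal R P P0 PD PM) _ ((IE (g j)).1 (Ig j))) => x xs /=.
  have lt_xs : (index x s < size s)%N by rewrite index_mem.
  split; first by apply/IE; apply: mem_ideal_gen.
  by have := cL (Ordinal lt_xs); rewrite /= nth_index.
rewrite (bigD1 j) //= big1 => [|i ij]; last by rewrite Lg (negbTE ij) mulr0.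
by rewrite addr0 Lg eqxx mulr1 => /eqP; rewrite (negbTE cj).
Qed.

Section DerivativesAtPoint.
Variables (k : fieldType) (n : nat) (v : 'I_n -> k).
Local Notation S := {mpoly k[n]}.
Implicit Types (f a : S).

Lemma mderivU (u w : 'I_n) : ('X_w : S)^`M(u) = ((w == u)%:R)%:MP.
Proof.
rewrite mderivX mnm1E; case: eqP => [->|_]; last by rewrite scale0r mpolyC0.
have -> : (U_(u) - U_(u) = 0)%MM by apply/mnmP => i; rewrite mnmBE mnm0E subnn.
by rewrite mpolyX0 scale1r mpolyC1.
Qed.

Lemma mderiv2_XX x y p q :
  (('X_p * 'X_q : S)^`M(x)^`M(y)).@[v] =
    (p == x)%:R * (q == y)%:R + (p == y)%:R * (q == x)%:R.
Proof.
rewrite mderivM mderivD !mderivM !mderivU !mderivC !mevalD !mevalM.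
by rewrite !mevalC !mevalXU; ring.
Qed.

Lemma mderiv_eval1 u f a : f.@[v] = 0 ->
  ((a * f)^`M(u)).@[v] = a.@[v] * (f^`M(u)).@[v].
Proof. by move=> f0; rewrite mderivM mevalD !mevalM f0 mulr0 add0r. Qed.

(** The lower-order terms of the Leibniz rule vanish, so second derivatives in directions along
    which all first derivatives of I_G vanish are admissible functionals for
    [generators_lower_bound]. *)
Lemma mderiv_eval2 x y f a : f.@[v] = 0 -> (f^`M(x)).@[v] = 0 -> (f^`M(y)).@[v] = 0 ->
  ((a * f)^`M(x)^`M(y)).@[v] = a.@[v] * (f^`M(x)^`M(y)).@[v].
Proof.
move=> f0 fx fy; rewrite mderivM mderivD !mderivM !mevalD !mevalM f0 fx fy.
by rewrite !mulr0 !add0r.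
Qed.

Lemma var_ideal_eval (T : pred 'I_n) f : (forall u, ~~ T u -> v u = 0) ->
  var_ideal k T f -> f.@[v] = 0 /\ forall j, T j -> (f^`M(j)).@[v] = 0.
Proof.
move=> vT.
pose P f := f.@[v] = 0 /\ forall j, T j -> (f^`M(j)).@[v] = 0.
have P0 : P 0 by split=> [|j _]; rewrite ?raddf0 ?mderiv0 ?meval0.
have PD x y : P x -> P y -> P (x + y).
  move=> [x0 xT] [y0 yT]; split=> [|j Tj]; first by rewrite mevalD x0 y0 addr0.
  by rewrite mderivD mevalD xT // yT // addr0.
have PM a x : P x -> P (a * x).
  move=> [x0 xT]; split=> [|j Tj]; first by rewrite mevalM x0 mulr0.
  by rewrite mderiv_eval1 // xT // mulr0.
apply: (ideal_gen_sub (J := @Ideal S P P0 PD PM)) => _ [u nT ->].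
split=> [|j Tj]; first by rewrite mevalXU vT.
by rewrite mderivU mevalC; case: eqP nT => // ->; rewrite Tj.
Qed.

End DerivativesAtPoint.

Section CompleteIntersection.
Variables (k : fieldType) (n : nat) (G : rel 'I_n).
Hypothesis hG : simple_graph G.
Local Notation S := {mpoly k[n]}.
Local Notation I := (graph_ideal k G).

Let Gsym : ssrbool.symmetric G. Proof. by case: hG. Qed.
Let Girr : irreflexive G. Proof. by case: hG. Qed.

(** The chain produced by s ends at P_ab for an edge ab. Two more coordinate primes lead from there
    to the origin, and no chain in S is longer than n. *)
Lemma regular_sequence_length (s : seq S) : (0 < n)%N ->
  regular_sequence s -> ideal_eq I (ideal_seq s) -> (size s + 2 <= n)%N.
Proof.
move=> n0 sreg IE; pose a : 'I_n := Ordinal n0.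
have [b ab] : exists t, G a t by case: hG.
have nab := graph_neq hG ab.
pose T i : pred 'I_n := nth pred0 [:: pred2 a b; pred1 a] i.
pose Q i := var_ideal k (T i).
have [x xs|c [pc sc cE]] := regular_seq_chain (var_ideal_prime k (T 0%N)) sreg.
  by apply/edge_primeE; apply: ((IE x).2 _ a b ab); apply: mem_ideal_gen.
pose c' i := if (i <= size s)%N then c i else Q (i - size s)%N.
apply: (@prime_chain_mpoly_bound k n n _ id c').
- by [].
- by move=> i _; rewrite /c'; case: ifP => [/pc//|_]; exact: var_ideal_prime.
- move=> i lt_i; rewrite /c'; have [lt_is|le_si] := ltnP i (size s).
    by rewrite ltnW //; exact: sc.
  have -> : (if (i <= size s)%N then c i else Q (i - size s)%N) = Q (i - size s)%N.
    case: leqP => // le_is; have -> : i = size s by apply/eqP; rewrite eqn_leq le_is.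
    by rewrite cE subnn.
  rewrite subSn //; have : (i - size s < 2)%N by rewrite ltn_subLR.
  move: (i - size s)%N => {lt_i le_si}i i2.
  split; first by apply: var_idealS => u; case: i i2 => [|[|//]] _; rewrite /T /in_mem //= => ->.
  have [u Tu nTu] : exists2 u, T i u & ~~ T i.+1 u.
    case: i i2 => [|[|//]] _; [exists b | exists a]; rewrite /T //= ?eqxx ?orbT //.
    by rewrite eq_sym.
  move=> /(_ 'X_u (proj2 (var_idealX k _ _) nTu))/var_idealX.
  by rewrite Tu.
by move=> u /negP[]; exact: (codom_f id u).
Qed.

Variable s : seq S.
Hypothesis sI : ideal_eq I (ideal_seq s).

Lemma graph_ideal_eval (v : 'I_n -> k) i j f : G i j ->
    (forall u, u != i -> u != j -> v u = 0) -> I f ->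
  [/\ f.@[v] = 0, (f^`M(i)).@[v] = 0 & (f^`M(j)).@[v] = 0].
Proof.
move=> ij vij /(_ i j ij)/edge_primeE/(var_ideal_eval (v := v))[|f0 fT].
  by move=> u /norP[]; exact: vij.
by split=> //; apply: fT; rewrite /= eqxx ?orbT.
Qed.

(** At the coordinate point of t, I_G has the local generators x_u for u not adjacent to t and the
    products of two neighbours. Non-neighbours u give x_u, neighbours u other than a give x_a x_u,
    and the free index a is used for x_b x_c. These n - 1 classes are independent, while s has at
    most n - 2 terms. *)
Lemma generators_max_degree : (size s + 2 <= n)%N -> max_degree_two G.
Proof.
move=> le_sn t a b c ta tb tc; rewrite /= !inE negb_or andbT => /andP[/andP[ab ac] bc].
have [[nta ntb] ntc] := (graph_neq hG ta, graph_neq hG tb, graph_neq hG tc).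
pose v u : k := (u == t)%:R.
have v0 u : u != t -> v u = 0 by rewrite /v => /negbTE->.
have vt : v t = 1 by rewrite /v eqxx.
pose F := {u : 'I_n | u != t}.
pose L (u : F) (f : S) := let u := val u in
  if u == a then (f^`M(b)^`M(c)).@[v] else
  if G t u then (f^`M(a)^`M(u)).@[v] else (f^`M(u)).@[v].
pose g (u : F) : S := let u := val u in
  'X_t * (if u == a then 'X_b * 'X_c else if G t u then 'X_a * 'X_u else 'X_u).
have Iev j f : G t j -> I f -> f.@[v] = 0 /\ (f^`M(j)).@[v] = 0.
  by move=> tj If; have [u /v0//|f0 _ fj] := graph_ideal_eval tj _ If (v := v).
suff : (#|{: F}| <= size s)%N.
  rewrite card_sig; have := cardC1 t; rewrite card_ord => cE.
  have -> : #|[pred u | u != t]| = n.-1 by rewrite -cE; apply: eq_card => u.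
  by move: le_sn; clear; lia.
apply: (generators_lower_bound (I := I) (ev := meval v) (L := L) (g := g)) => //.
- by move=> [u ut] x y; rewrite /L /=; case: ifP => _; [|case: ifP => _]; rewrite !mderivD mevalD.
- move=> [u ut] x f If; rewrite /L /=; have [f0 fa] := Iev _ _ ta If.
  have [_ fb] := Iev _ _ tb If; have [_ fc] := Iev _ _ tc If.
  case: ifP => _; first exact: mderiv_eval2.
  case: ifP => tu; last exact: mderiv_eval1.
  by apply: mderiv_eval2 => //; have [] := Iev _ _ tu If.
- move=> [u ut]; rewrite /g /=; case: ifP => ua; first exact: graph_triple.
  case: ifP => tu; last by apply: (graph_nonedge hG); rewrite ?tu // eq_sym.
  by apply: graph_triple => //; rewrite eq_sym // ua.
move=> [u ut] [w wt]; rewrite /L /g /=; have -> : (exist _ u ut == exist _ w wt :> F) = (u == w) by [].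
have dt x (p : S) : x != t -> (('X_t * p)^`M(x)) = 'X_t * p^`M(x).
  by move=> xt; rewrite mderivM mderivU [t == x]eq_sym (negbTE xt) mpolyC0 mul0r add0r.
have at' : a != t by rewrite eq_sym.
have bt : b != t by rewrite eq_sym.
have ct : c != t by rewrite eq_sym.
rewrite !dt // !mevalM mevalXU vt !mul1r.
have d1 x y w' : ('X_w' : S)^`M(x)^`M(y).@[v] = 0.
  by rewrite mderivU mderivC meval0.
have [eu|ua] := boolP (u == a); have [ew|wa] := boolP (w == a).
- rewrite (eqP eu) (eqP ew).
  by rewrite mderiv2_XX !eqxx [c == b]eq_sym (negbTE bc) /=; ring.
- rewrite (eqP eu) [a == w]eq_sym (negbTE wa).
  case: ifP => _; last exact: d1.
  by rewrite mderiv2_XX (negbTE ab) (negbTE ac) /=; ring.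
- rewrite (eqP ew) (negbTE ua).
  case: ifP => tu; last by rewrite mderivM mevalD !mevalM !mderivU;
    rewrite !mevalC; case: eqP => [bu|_]; case: eqP => [cu|_]; rewrite ?mul0r ?mulr0 ?addr0 //;
    [move: tu; rewrite -?bu -?cu ?tb ?tc ..].
  by rewrite mderiv2_XX [b == a]eq_sym [c == a]eq_sym (negbTE ab) (negbTE ac) /=; ring.
- case: ifP => tu; case: ifP => tw.
  + rewrite mderiv2_XX eqxx (negbTE wa) [w == u]eq_sym /=; ring.
  + rewrite d1; case: eqP => // uw; by rewrite uw tw in tu.
  + rewrite mderivM !mderivU mevalD !mevalM !mevalC !mevalXU (v0 a at') (v0 w wt).
    by case: (eqVneq u w) => [uw|]; rewrite ?mulr0 ?mul0r ?addr0 //; rewrite uw tw in tu.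
  + by rewrite mderivU mevalC [w == u]eq_sym.
Qed.

(** Every vertex lies on an edge, so elements of I_G have no constant or linear part at the origin.
    Second derivatives there separate the quadrics x_i x_j coming from the non-edges. *)
Lemma generators_nonedges :
  (#|[pred p : 'I_n * 'I_n | (p.1 < p.2)%N && ~~ G p.1 p.2]| <= size s)%N.
Proof.
pose F := {p : 'I_n * 'I_n | (p.1 < p.2)%N && ~~ G p.1 p.2}.
pose v (u : 'I_n) : k := 0.
pose L (p : F) (f : S) := (f^`M((val p).1)^`M((val p).2)).@[v].
pose g (p : F) : S := 'X_(val p).1 * 'X_(val p).2.
have Iev j f : I f -> f.@[v] = 0 /\ (f^`M(j)).@[v] = 0.
  have [w jw] : exists w, G j w by case: hG.
  by move=> If; have [//|f0 fj _] := graph_ideal_eval jw _ If (v := v).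
rewrite -card_sig.
apply: (generators_lower_bound (I := I) (ev := meval v) (L := L) (g := g)) => //.
- by move=> p x y; rewrite /L !mderivD mevalD.
- move=> p x f If; have [f0 f1] := Iev (val p).1 _ If; have [_ f2] := Iev (val p).2 _ If.
  exact: mderiv_eval2.
- move=> p; have /andP[xy nxy] := valP p; apply: (graph_nonedge hG) => //.
  by apply: contraTneq xy => ->; rewrite ltnn.
move=> [[x y] xyP] [[z w] zwP].
have -> : (exist _ (x, y) xyP == exist _ (z, w) zwP :> F) = ((x, y) == (z, w)) by [].
move: xyP zwP; rewrite /L /g /= => /andP[xy _] /andP[zw _].
rewrite mderiv2_XX xpair_eqE [z == x]eq_sym [w == y]eq_sym -!natrM !mulnb.
case: (eqVneq z y) => [zy|_]; last by rewrite addr0.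
case: (eqVneq w x) => [wx|_]; last by rewrite addr0.
by rewrite zy wx in zw; have := ltn_trans xy zw; rewrite ltnn.
Qed.

End CompleteIntersection.

(** Each vertex has at least n - 3 non-neighbours, while there are at most n - 2 non-edges; so n (n
    - 3) <= 2 (n - 2) and n <= 4. For n = 4 equality holds throughout, and each vertex has exactly
    one non-neighbour. *)
Lemma complete_intersection_classification (k : fieldType) (n : nat) (G : rel 'I_n) :
  simple_graph G -> (3 <= n)%N -> complete_intersection (graph_ideal k G) ->
  (n <= 3)%N \/ four_cycle G.
Proof.
move=> hG n3 [s sreg sI]; have [Gsym Girr Gnbr] := hG.
have le_sn : (size s + 2 <= n)%N.
  by apply: (regular_sequence_length hG) sreg sI; apply: leq_trans n3.
have deg := generators_max_degree hG sI le_sn.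
have non := generators_nonedges hG sI.
pose f i := #|[pred j | (j != i) && ~~ G i j]|.
have f_sum : (\sum_i f i <= 2 * size s)%N.
  pose A := [set p : 'I_n * 'I_n | (p.1 < p.2)%N && ~~ G p.1 p.2].
  pose sw (p : 'I_n * 'I_n) := (p.2, p.1).
  have -> : (\sum_i f i = #|[set p : 'I_n * 'I_n | (p.2 != p.1) && ~~ G p.1 p.2]|)%N.
    rewrite -sum1_card (eq_bigl (fun p : 'I_n * 'I_n => true && ((p.2 != p.1) && ~~ G p.1 p.2))).
      rewrite -(pair_big_dep xpredT (fun i j => (j != i) && ~~ G i j) (fun _ _ => 1%N)) /=.
      by apply: eq_bigr => i _; rewrite sum1_card.
    by move=> p; rewrite inE.
  have sub : [set p : 'I_n * 'I_n | (p.2 != p.1) && ~~ G p.1 p.2] \subset A :|: (sw @: A).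
    apply/fintype.subsetP => -[x y]; rewrite !inE /= => /andP[yx nG].
    case: (ltngtP x y) => [lt|gt|e] /=; first by rewrite nG.
      by apply/imsetP; exists (y, x); rewrite // inE /= gt Gsym.
    by rewrite (val_inj e) eqxx in yx.
  apply: leq_trans (subset_leq_card sub) _; apply: leq_trans (leq_card_setU _ _) _.
  rewrite mul2n -addnn; apply: leq_add.
    by apply: leq_trans non; rewrite cardsE.
  by apply: leq_trans (leq_imset_card _ _) _; apply: leq_trans non; rewrite cardsE.
have f_ge i : (n - 3 <= f i)%N.
  have N2 : (#|G i| <= 2)%N.
    rewrite leqNgt; apply/negP => /card_gt2P[x [y [z [[ix iy iz] [xy yz zx]]]]].
    by apply: (deg i x y z) => //=; rewrite !inE negb_or xy yz eq_sym zx.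
  rewrite leq_subLR addnC -[n in (n <= _)%N]card_ord -(cardC [pred j | (j != i) && ~~ G i j]).
  rewrite leq_add2l; apply: leq_trans (_ : #|i |: [set j | G i j]| <= _)%N.
    apply: subset_leq_card; apply/fintype.subsetP => j.
    by rewrite !inE negb_and !negbK.
  apply: leq_trans (leq_card_setU _ _) _; rewrite cards1 cardsE.
  by rewrite -[3%N]/(1 + 2)%N leq_add2l.
have n4 : (n <= 4)%N.
  have : (n * (n - 3) <= 2 * size s)%N.
    apply: leq_trans f_sum; rewrite -[n in (n * _)%N]card_ord -sum_nat_const.
    by apply: leq_sum => i _.
  by move: le_sn n3; clear; nia.
move: n4; rewrite leq_eqVlt => /predU1P[n4|]; [right | by left].
have f_le i : (f i <= 1)%N.
  have : (f i + 3 <= 4)%N.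
    apply: leq_trans (_ : \sum_i f i <= _)%N; last first.
      by apply: leq_trans f_sum _; move: (size s) le_sn n4 => r; clear; lia.
    rewrite (bigD1 i) //= leq_add2l; apply: leq_trans (_ : \sum_(j | j != i) 1 <= _)%N.
      have cE : #|predC1 i| = 3 by have := cardC1 i; rewrite card_ord => ->; rewrite n4.
      by rewrite sum1_card -[leqLHS]cE; apply/eq_leq/eq_card.
    by apply: leq_sum => j _; apply: leq_trans (f_ge j); move: n4; clear; lia.
  by rewrite -[4%N]/(1 + 3)%N leq_add2r.
have one i x y : x != i -> y != i -> ~~ G i x -> ~~ G i y -> x = y.
  move=> xi yi nx ny; apply: contrapT => /eqP xy.
  have := f_le i; rewrite leqNgt => /negP; apply; apply/card_gt1P.
  by exists x, y; rewrite !inE xi yi nx ny.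
pose a : 'I_n := Ordinal (leq_trans (isT : 0 < 3)%N n3).
have /card_gt0P[c] : (0 < f a)%N by apply: leq_trans (f_ge a); move: n4; clear; lia.
rewrite inE => /andP[ca nac].
have out t : (size t < 4)%N -> exists u : 'I_n, u \notin t.
  rewrite -n4 => t4; apply/existsP; apply: contraTT t4 => /existsPn all_t.
  rewrite -leqNgt -[n in (n <= _)%N]card_ord.
  apply: leq_trans (card_size t); apply: subset_leq_card; apply/fintype.subsetP => u _.
  by rewrite -[_ \in _]negbK.
have [b] := out [:: a; c] isT; rewrite !inE negb_or => /andP[ba bc].
have [d] := out [:: a; c; b] isT; rewrite !inE !negb_or => /and3P[da dc db].
have ab : G a b by apply: contraNT bc => nab; apply/eqP; apply: (one a).
have ad : G a d by apply: contraNT dc => nad; apply/eqP; apply: (one a).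
have cb : G c b by apply: contraNT ba => ncb; apply/eqP; apply: (one c); rewrite // 1?eq_sym // Gsym.
have cd : G c d by apply: contraNT da => ncd; apply/eqP; apply: (one c); rewrite // 1?eq_sym // Gsym.
have u4 : uniq [:: a; b; c; d].
  by rewrite /= !inE !negb_or ![a == _]eq_sym ba ca da bc ![_ == d]eq_sym db dc.
exists a, b, c, d; split=> //.
- move=> i; apply: contrapT => /negP ni.
  have : (size [:: i; a; b; c; d] <= n)%N.
    rewrite -[n in (_ <= n)%N]card_ord -(card_uniqP (_ : uniq [:: i; a; b; c; d])).
      exact: max_card.
    by rewrite cons_uniq ni.
  by rewrite /=; move: n4; clear; lia.
- by split; rewrite // Gsym.
- apply/negP => bd; apply: (deg b a c d); rewrite // 1?Gsym //=.
  by rewrite !inE negb_or ![a == _]eq_sym ca da [c == d]eq_sym dc.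
Qed.

(** * Zariski's lemma *)

(** The equality K = k[x, y], put as an induction principle. *)
Definition ring_generated (k : fieldType) (K : comNzRingType) (kappa : k -> K) (x y : K) :=
  forall P : K -> Prop, (forall c, P (kappa c)) -> P x -> P y ->
    (forall z w, P z -> P w -> P (z + w)) -> (forall z w, P z -> P w -> P (z * w)) ->
  forall z, P z.

Section ZariskiLemma.
Variables (k : fieldType) (K : comNzRingType) (kappa : {rmorphism k -> K}).
Variables (x y : K).
Hypothesis invK : forall z : K, z <> 0 -> exists w, z * w = 1.
Hypothesis genK : ring_generated kappa x y.

Let rho (r : {poly k}) : K := horner_eval x (map_poly kappa r).

HB.instance Definition _ := GRing.RMorphism.copy rho (horner_eval x \o map_poly kappa).

(** Multiplying p(y) = 0 by a^(deg p - 1) gives a monic equation for a y; in the proof d is deg p -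
    1. *)
Lemma zariski_integral_step (a : {poly k}) (p : {poly {poly k}}) :
  lead_coef p = a -> (1 < size p)%N -> root (map_poly rho p) y ->
  integralOver rho (rho a * y).
Proof.
move=> pa p1 py; pose d := (size p).-2.
have pd : size p = d.+2 by rewrite /d; case: (size p) p1 => [|[]].
exists (\poly_(i < d.+2) (if i == d.+1 then 1 else p`_i * a ^+ (d - i))).
  by rewrite monicE lead_coef_poly ?eqxx // oner_neq0.
have wide (q : {poly {poly k}}) z : (size q <= d.+2)%N ->
    (map_poly rho q).[z] = \sum_(i < d.+2) rho q`_i * z ^+ i.
  move=> qd; rewrite (horner_coef_wide (n := d.+2)); last exact: leq_trans (size_poly _ _) qd.
  by apply: eq_bigr => i _; rewrite coef_map.
apply/rootP; rewrite wide ?size_poly //.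
transitivity (rho a ^+ d * (map_poly rho p).[y]); last by rewrite (rootP py) mulr0.
rewrite wide ?pd // mulr_sumr; apply: eq_bigr => i _; rewrite coef_poly ltn_ord.
case: eqP => [id|/eqP id].
  have -> : p`_i = a by rewrite -pa /lead_coef pd id.
  by rewrite rmorph1 id exprMn exprS; ring.
have le_id : (i <= d)%N by have := ltn_ord i; rewrite ltnS leq_eqVlt (negbTE id).
have -> : rho a ^+ d = rho a ^+ (d - i) * rho a ^+ i by rewrite -exprD subnK.
by rewrite rmorphM rmorphXn exprMn /=; ring.
Qed.

(** If x is transcendental, then k[x] is a polynomial ring, and y satisfies an equation over it,
    since otherwise K would be a polynomial ring in y and y not invertible. With a its leading
    coefficient, every element of K becomes integral over k[x] after multiplication by a power of a.
    The inverse of 1 + x a refutes this. *)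
Lemma zariski_left : integralOver kappa x.
Proof.
apply: contrapT => nx.
have rho_eq0 r : rho r = 0 -> r = 0.
  move=> r0; apply: contrapT => /eqP nr; apply: nx.
  exists ((lead_coef r)^-1 *: r).
    by rewrite monicE lead_coefZ mulVf ?lead_coef_eq0.
  by apply/rootP; rewrite map_polyZ hornerZ [X in _ * X]r0 mulr0.
pose ev (p : {poly {poly k}}) := (map_poly rho p).[y].
have evD p q : ev (p + q) = ev p + ev q by rewrite /ev rmorphD hornerD.
have evM p q : ev (p * q) = ev p * ev q by rewrite /ev rmorphM hornerM.
have evX : ev 'X = y by rewrite /ev map_polyX hornerX.
have evC r : ev r%:P = rho r by rewrite /ev map_polyC hornerC.
have rhoX : rho 'X = x by rewrite /rho map_polyX /horner_eval hornerX.
have rhoC c : rho c%:P = kappa c by rewrite /rho map_polyC /horner_eval hornerC.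
have rep z : exists p, z = ev p.
  apply: (genK (P := fun z => exists p, z = ev p)) => [c|||_ _ [p ->] [q ->]|_ _ [p ->] [q ->]].
  - by exists (c%:P)%:P; rewrite evC rhoC.
  - by exists 'X%:P; rewrite evC rhoX.
  - by exists 'X; rewrite evX.
  - by exists (p + q); rewrite evD.
  - by exists (p * q); rewrite evM.
have [p p0 pev] : exists2 p, p != 0 & ev p = 0.
  apply: contrapT => nex.
  have ev0 p : ev p = 0 -> p = 0.
    by move=> p0; apply: contrapT => /eqP np; apply: nex; exists p.
  have [y0|w yw] := @invK y.
    by have := ev0 'X; rewrite evX y0 => /(_ erefl)/eqP; rewrite polyX_eq0.
  have [q qE] := rep w.
  have : 'X * q - 1 = 0.
    apply: ev0; rewrite evD evM evX -qE yw.
    have -> : ev (- 1) = - 1 by rewrite /ev rmorphN rmorph1 hornerN hornerE.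
    by rewrite subrr.
  move=> /(congr1 (fun r : {poly {poly k}} => r.[0])).
  by rewrite hornerD hornerM hornerX mul0r hornerN hornerC horner0 add0r => /eqP;
    rewrite oppr_eq0 oner_eq0.
have p1 : (1 < size p)%N.
  rewrite ltnNge; apply/negP => /size1_polyC pE; case/eqP: p0.
  move: pev; rewrite pE evC => /rho_eq0->; exact: polyC0.
pose a := lead_coef p.
have a0 : a != 0 by rewrite lead_coef_eq0.
pose Z z := exists N, integralOver rho (rho a ^+ N * z).
have intX N : integralOver rho (rho a ^+ N) by rewrite -rmorphXn; exact: integral_id.
have allZ z : Z z.
  apply: (genK (P := Z)) => [c|||z1 z2 [N1 i1] [N2 i2]|z1 z2 [N1 i1] [N2 i2]].
  - by exists 0%N; rewrite expr0 mul1r -rhoC; exact: integral_id.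
  - by exists 0%N; rewrite expr0 mul1r -rhoX; exact: integral_id.
  - by exists 1%N; rewrite expr1; apply: zariski_integral_step p1 _ => //; exact/rootP.
  - exists (N1 + N2)%N.
    have -> : rho a ^+ (N1 + N2) * (z1 + z2) =
      rho a ^+ N2 * (rho a ^+ N1 * z1) + rho a ^+ N1 * (rho a ^+ N2 * z2).
      by rewrite exprD; ring.
    by apply: integral_add; apply: integral_mul.
  - exists (N1 + N2)%N.
    have -> : rho a ^+ (N1 + N2) * (z1 * z2) = (rho a ^+ N1 * z1) * (rho a ^+ N2 * z2).
      by rewrite exprD; ring.
    exact: integral_mul.
(* This c is not constant and is coprime to a, yet integrality of a^N / c makes it divide a power of
   a. *)
pose c : {poly k} := 1 + 'X * a.
have c1 : (1 < size c)%N.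
  have sX : size (a * 'X) = (size a).+1 by rewrite size_mulX.
  have sa : (0 < size a)%N by rewrite size_poly_gt0.
  by rewrite /c addrC mulrC size_polyDl sX ?ltnS // size_poly1.
have c0 : c != 0 by rewrite -size_poly_gt0 ltnW.
have [z0|w cw] := @invK (rho c); first by move/rho_eq0: z0 => /eqP; rewrite (negbTE c0).
have [N [P monP /rootP]] := allZ w.
rewrite horner_coef => Proot.
pose D := (size P).-1.
have PD : size P = D.+1 by rewrite /D prednK // size_poly_gt0 monic_neq0.
have PD' : size (map_poly rho P) = D.+1.
  by rewrite size_map_poly_id0 // (monicP monP) rmorph1 oner_neq0.
have dvd : c %| a ^+ (N * D).
  have : \sum_(i < D.+1) P`_i * (a ^+ (N * i) * c ^+ (D - i)) = 0.
    apply: rho_eq0; rewrite rmorph_sum /=.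
    transitivity (rho c ^+ D * \sum_(i < size (map_poly rho P)) (map_poly rho P)`_i * (rho a ^+ N * w) ^+ i).
      rewrite PD' mulr_sumr; apply: eq_bigr => i _.
      rewrite coef_map /= !rmorphM !rmorphXn /= exprMn -exprM.
      have le_iD : (i <= D)%N by rewrite -ltnS.
      have -> : rho c ^+ D = rho c ^+ (D - i) * rho c ^+ i by rewrite -exprD subnK.
      transitivity (rho P`_i * (rho a ^+ (N * i) * rho c ^+ (D - i)) * (rho c * w) ^+ i).
        by rewrite cw expr1n mulr1.
      by rewrite exprMn; ring.
    by rewrite Proot mulr0.
  rewrite big_ord_recr /= subnn expr0 mulr1.
  have -> : P`_D = 1 by rewrite -(monicP monP) /lead_coef PD.
  rewrite mul1r => /eqP; rewrite addrC addr_eq0 => /eqP->.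
  rewrite dvdpNr; apply: (big_ind (fun q => c %| q)) => [|q r cq cr|i _].
  - exact: dvdp0.
  - exact: dvdp_add.
  have lt_iD : (0 < D - i)%N by rewrite subn_gt0 /=.
  by rewrite -(prednK lt_iD) exprS mulrA mulrCA dvdp_mulIl.
have cop : coprimep c (a ^+ (N * D)).
  apply: coprimep_expr; apply/Bezout_coprimepP; exists (1, - 'X) => /=.
  rewrite /c (_ : 1 * (1 + 'X * a) + - 'X * a = 1) ?eqpxx //; ring.
by have := coprimep_dvdl (dvd) cop; rewrite coprimepp => /eqP e; rewrite e in c1.
Qed.

End ZariskiLemma.

Lemma zariski_lemma (k : fieldType) (K : comNzRingType) (kappa : {rmorphism k -> K})
    (x y : K) : (forall z : K, z <> 0 -> exists w, z * w = 1) ->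
  ring_generated kappa x y -> integralRange kappa.
Proof.
move=> invK gen; apply: (gen (integralOver kappa)).
- exact: integral_id.
- exact: zariski_left invK gen.
- apply: (@zariski_left k K kappa y x invK) => P Pc Py Px; exact: gen.
- exact: integral_add.
- exact: integral_mul.
Qed.

(** * Regular pairs on planes *)

Section Residue.
Variables (S : comPzRingType) (M : ideal S) (maxM : maximal_ideal M).

(** The proof of maximality is an argument so that the structure of a non-zero ring can be attached
    to the type. *)
Definition residue of maximal_ideal M := quot_ring M.
Local Notation K := (residue maxM).

HB.instance Definition _ := GRing.ComPzRing.copy K (quot_ring M).

Lemma residue_neq0 : 1 != 0 :> K.
Proof.
apply/eqP => e; apply: (proj1 maxM); apply/to_quot_eq0.
by rewrite rmorph1; exact: e.
Qed.

HB.instance Definition _ := GRing.PzSemiRing_isNonZero.Build K residue_neq0.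

Definition to_residue (x : S) : K := to_quot M x.

HB.instance Definition _ := GRing.RMorphism.copy to_residue (to_quot M).

Lemma to_residue_eq0 x : to_residue x = 0 <-> M x.
Proof. exact: to_quot_eq0. Qed.

Lemma residue_inv (z : K) : z <> 0 -> exists w, z * w = 1.
Proof.
have [x xE] : exists x, z = to_residue x := to_quot_surj z.
rewrite {}xE => nx.
have nM : ~ M x by move=> Mx; apply: nx; apply/to_residue_eq0.
have [a [b [Ma e]]] : add_gen M x 1.
  apply: contrapT => n1; apply: nM.
  exact: (proj2 maxM (add_gen M x) (@add_gen_sub S M x) n1 _ (add_gen_in M x)).
exists (to_residue b); rewrite -rmorphM -(rmorph1 to_residue) e rmorphD.
by rewrite /= (to_residue_eq0 a).2 // add0r.
Qed.

End Residue.

Lemma mpoly_ring_ind (k : fieldType) (n : nat) (P : {mpoly k[n]} -> Prop) :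
    (forall c, P c%:MP) -> (forall u, P 'X_u) ->
    (forall f g, P f -> P g -> P (f + g)) -> (forall f g, P f -> P g -> P (f * g)) ->
  forall f, P f.
Proof.
move=> PC PX PD PM f; have P1 : P 1 by rewrite -mpolyC1.
rewrite (mpolyE f); apply: (big_ind P) => // [|m _]; first by rewrite -(mpolyC0 n).
rewrite -mul_mpolyC; apply: (PM) => //.
rewrite mpolyXE_id; apply: (big_ind P) => // u _.
by elim: (m u) => [|l IH]; rewrite ?expr0 // exprS; apply: (PM).
Qed.

(** Only the classes of x_i and x_j survive in the residue field, so Zariski's lemma for two
    generators applies. *)
Lemma mpoly_residue_algebraic (k : fieldType) (n : nat) (M : ideal {mpoly k[n]})
    (i j : 'I_n) (y : {mpoly k[n]}) :
    maximal_ideal M -> (forall u, u != i -> u != j -> M 'X_u) ->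
  exists2 F : {poly k}, F \is monic & M (map_poly (@mpolyC n k) F).[y].
Proof.
move=> maxM MX.
pose kappa : {rmorphism k -> residue maxM} := to_residue maxM \o @mpolyC n k.
have gen : ring_generated kappa (to_residue maxM 'X_i) (to_residue maxM 'X_j).
  move=> P Pc Pi Pj PD PM z.
  have [f ->] : exists f, z = to_residue maxM f := to_quot_surj z.
  apply: (mpoly_ring_ind (P := fun f => P (to_residue maxM f))) => [c|u|g h|g h].
  - exact: Pc.
  - have [->//|ui] := eqVneq u i; have [->//|uj] := eqVneq u j.
    rewrite (to_residue_eq0 maxM _).2; last exact: MX.
    by have := Pc 0; rewrite rmorph0.
  - by rewrite rmorphD; exact: PD.
  - by rewrite rmorphM; exact: PM.
have [F monF rootF] := zariski_lemma (residue_inv (maxM := maxM)) gen (to_residue maxM y).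
have Fy := rootP rootF.
exists F => //; apply/(to_residue_eq0 maxM).
by rewrite -[LHS]horner_map -map_poly_comp.
Qed.

Section PlaneCoordinates.
Variables (k : fieldType) (n : nat) (i j : 'I_n).
Hypothesis lt_ij : (i < j)%N.
Local Notation S := {mpoly k[n]}.
Local Notation P := (var_ideal k (pred2 i j)).

(* Coordinates on the plane of x_i and x_j in which x_i + x_j is the inner     *)
(* variable w and - x_i x_j = X^2 - w X is monic in the outer one.             *)
Definition plane_var (u : 'I_n) : {poly {poly k}} :=
  if u == i then 'X%:P - 'X else if u == j then 'X else 0.

Definition plane : S -> {poly {poly k}} := mmap (polyC \o polyC) plane_var.

HB.instance Definition _ := GRing.RMorphism.copy plane (mmap (polyC \o polyC) plane_var).

Definition unplane_inner : {poly k} -> S :=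
  horner_eval ('X_i + 'X_j) \o map_poly (@mpolyC n k).

HB.instance Definition _ := GRing.RMorphism.copy unplane_inner
  (horner_eval ('X_i + 'X_j) \o map_poly (@mpolyC n k)).

Definition unplane : {poly {poly k}} -> S := horner_eval 'X_j \o map_poly unplane_inner.

HB.instance Definition _ := GRing.RMorphism.copy unplane
  (horner_eval 'X_j \o map_poly unplane_inner).

Let ne_ji : j != i. Proof. by rewrite -val_eqE /= gtn_eqF. Qed.

Lemma planeX u : plane 'X_u = plane_var u.
Proof. by rewrite /plane mmapX mmap1U. Qed.

Lemma planeC c : plane c%:MP = c%:P%:P.
Proof. by rewrite /plane mmapC. Qed.

Lemma unplane_outer : unplane 'X = 'X_j.
Proof. by rewrite /unplane /= map_polyX /horner_eval hornerX. Qed.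

Lemma unplaneC r : unplane r%:P = unplane_inner r.
Proof. by rewrite /unplane /= map_polyC /horner_eval hornerC. Qed.

Lemma unplane_innerX : unplane_inner 'X = 'X_i + 'X_j.
Proof. by rewrite /unplane_inner /= map_polyX /horner_eval hornerX. Qed.

Lemma unplane_innerC c : unplane_inner c%:P = c%:MP.
Proof. by rewrite /unplane_inner /= map_polyC /horner_eval hornerC. Qed.

Lemma unplaneK f : P (unplane (plane f) - f).
Proof.
apply: (mpoly_ring_ind (P := fun f => P (unplane (plane f) - f))) => [c|u|g h Pg Ph|g h Pg Ph].
- by rewrite planeC unplaneC unplane_innerC subrr; exact: ideal0.
- rewrite planeX /plane_var; case: eqP => [->|/eqP ui].
    suff -> : unplane ('X%:P - 'X) - 'X_i = 0 by exact: ideal0.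
    by rewrite rmorphB /= unplaneC unplane_innerX unplane_outer addrK subrr.
  case: eqP => [->|/eqP uj]; first by rewrite unplane_outer subrr; exact: ideal0.
  by rewrite rmorph0 sub0r; apply: idealN; apply/var_idealX; rewrite /= negb_or ui.
- have -> : unplane (plane (g + h)) - (g + h) =
    (unplane (plane g) - g) + (unplane (plane h) - h) by rewrite !rmorphD /=; ring.
  exact: idealD.
- have -> : unplane (plane (g * h)) - g * h =
    unplane (plane g) * (unplane (plane h) - h) + h * (unplane (plane g) - g).
    by rewrite !rmorphM /=; ring.
  by apply: idealD; apply: idealM.
Qed.

Lemma plane_ker f : P f <-> plane f = 0.
Proof.
split; last by move=> f0; have := unplaneK f; rewrite f0 rmorph0 sub0r => /idealN; rewrite opprK.
have K0 : plane 0 = 0 by rewrite rmorph0.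
have KD u v : plane u = 0 -> plane v = 0 -> plane (u + v) = 0.
  by move=> eu ev; rewrite rmorphD /= eu ev addr0.
have KM u v : plane v = 0 -> plane (u * v) = 0.
  by move=> ev; rewrite rmorphM /= ev mulr0.
apply: (ideal_gen_sub (J := @Ideal S (fun u => plane u = 0) K0 KD KM)) => _ [u nT ->] /=.
by move: nT; rewrite /= negb_or planeX /plane_var => /andP[/negbTE-> /negbTE->].
Qed.

Lemma planeMB a b c d : plane (a * b - c * d) = plane a * plane b - plane c * plane d.
Proof. by rewrite rmorphB !rmorphM. Qed.

End PlaneCoordinates.

(** Write b = q g + r. Then g (a - c q) = c r has smaller degree than the monic g, so a = c q. *)
Lemma monic_cancel_const (R : comNzRingType) (c : R) (g a b : {poly R}) :
  g \is monic -> g * a = c%:P * b -> exists d, a = c%:P * d.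
Proof.
move=> mg e; pose q := Pdiv.CommonRing.rdivp b g; pose r := Pdiv.CommonRing.rmodp b g.
exists q; apply/eqP; rewrite -subr_eq0; apply/negPn/negP => ne0.
have bE : b = q * g + r := Pdiv.RingMonic.rdivp_eq mg b.
have e' : g * (a - c%:P * q) = c%:P * r by rewrite mulrBr e bE; ring.
have lt_r : (size r < size g)%N by apply: Pdiv.CommonRing.ltn_rmodpN0; exact: monic_neq0.
have : (size (g * (a - c%:P * q))%R < size g)%N.
  by rewrite e' mul_polyC; apply: leq_ltn_trans (size_scale_leq _ _) lt_r.
rewrite size_monicM //; move: ne0; rewrite -size_poly_gt0.
by move: (size _) (size g) => x y; clear; lia.
Qed.

Section SystemOfParameters.
Variables (k : fieldType) (n : nat).
Local Notation S := {mpoly k[n]}.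

Definition sum_vars : S := \sum_u 'X_u.
Definition neg_pairs_row (u : 'I_n) : S := \sum_(w < n | (u < w)%N) (- 1)%:MP * ('X_u * 'X_w).

Definition neg_pairs : S := \sum_u neg_pairs_row u.

Variables (F1 F2 : {poly k}).
Hypotheses (mF1 : F1 \is monic) (mF2 : F2 \is monic).
Let f := (map_poly (@mpolyC n k) F1).[sum_vars].
Let g := (map_poly (@mpolyC n k) F2).[neg_pairs].

(** In plane coordinates f is F1 in the inner variable, a non-zero constant for the outer one, and g
    is monic in the outer variable; so g can be cancelled modulo f. *)
Lemma plane_regular_pair (i j : 'I_n) : (i < j)%N ->
  regular_pair f g (var_ideal k (pred2 i j)).
Proof.
move=> lt_ij; have ne_ji : j != i by rewrite -val_eqE /= gtn_eqF.
have pX := planeX k i j.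
have zero u : u != i -> u != j -> plane i j ('X_u : S) = 0.
  by move=> ui uj; rewrite pX /plane_var (negbTE ui) (negbTE uj).
have Xi : plane i j ('X_i : S) = 'X%:P - 'X by rewrite pX /plane_var eqxx.
have Xj : plane i j ('X_j : S) = 'X by rewrite pX /plane_var (negbTE ne_ji) eqxx.
have pe1 : plane i j sum_vars = 'X%:P.
  rewrite rmorph_sum (bigD1 i) //= (bigD1 j) //= big1 ?addr0.
    by rewrite Xi Xj subrK.
  by move=> u /andP[ui uj]; exact: zero.
have pe2 : plane i j neg_pairs = 'X * ('X - 'X%:P).
  have N1 : plane i j ((- 1)%:MP : S) = - 1 by rewrite planeC !polyCN.
  have inner_i : plane i j (neg_pairs_row i) = 'X * ('X - 'X%:P).
    rewrite rmorph_sum (bigD1 j) //= big1 => [|w /andP[lt_iw wj]].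
      by rewrite addr0 !rmorphM /= Xi Xj N1 mulN1r -mulNr opprB mulrC.
    by rewrite !rmorphM /= (zero w) ?mulr0 // -val_eqE /= gtn_eqF.
  have inner u : u != i -> plane i j (neg_pairs_row u) = 0.
    move=> ui; rewrite rmorph_sum big1 // => w lt_uw; rewrite !rmorphM /=.
    have [uj|uj] := eqVneq u j; last by rewrite (zero u) ?mul0r ?mulr0.
    have lt_jw : (j < w)%N by rewrite -uj.
    by rewrite (zero w) ?mulr0 // -val_eqE /= gtn_eqF // (ltn_trans lt_ij).
  by rewrite rmorph_sum (bigD1 i) //= inner_i big1 ?addr0.
have pH (F : {poly k}) (h : S) : plane i j (map_poly (@mpolyC n k) F).[h] =
    map_poly polyC F \Po plane i j h.
  rewrite -horner_map -map_poly_comp /comp_poly -[in RHS]map_poly_comp.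
  by congr (_.[_]); apply: eq_map_poly => c /=; rewrite planeC.
have pf : plane i j f = F1%:P.
  by rewrite pH pe1 /comp_poly horner_map /= -/(F1 \Po 'X) comp_polyXr.
have pg : plane i j g \is monic.
  rewrite pH pe2 monicE lead_coef_comp.
    rewrite lead_coefM lead_coefX lead_coefXsubC mulr1 expr1n mulr1.
    by rewrite lead_coef_map_inj ?(monicP mF2) //; exact: polyC_inj.
  by rewrite mulrC size_mulX ?polyXsubC_eq0 ?size_XsubC.
have F1P : F1%:P != 0 :> {poly {poly k}} by rewrite polyC_eq0 monic_neq0.
split=> [a|a b].
  move=> /plane_ker; rewrite rmorphM /= pf => /eqP.
  by rewrite mulf_eq0 (negbTE F1P) /= => /eqP /plane_ker.
move=> /plane_ker; rewrite planeMB pf => /eqP.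
rewrite subr_eq0 => /eqP/(monic_cancel_const pg)[d dE].
exists (unplane i j d).
have -> : a - f * unplane i j d = (unplane i j (plane i j f) - f) * unplane i j d -
    (unplane i j (plane i j a) - a).
  by rewrite dE -pf rmorphM /=; ring.
apply: (idealB (J := var_ideal k (pred2 i j))); last exact: unplaneK.
by apply: idealMr; exact: unplaneK.
Qed.

Lemma edge_regular_pair (i j : 'I_n) : i != j ->
  regular_pair f g (var_ideal k (pred2 i j)).
Proof.
move=> ne_ij; case: (ltngtP i j) => [|lt_ji|e]; first exact: plane_regular_pair.
  have [rf rg] := plane_regular_pair lt_ji.
  have E : ideal_eq (var_ideal k (pred2 i j)) (var_ideal k (pred2 j i)).
    by move=> x; split; apply: var_idealS => u; rewrite /in_mem /= orbC.
  by split=> [a /E/rf/E//|a b /E/rg[c /E ?]]; exists c.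
by rewrite (val_inj e) eqxx in ne_ij.
Qed.

End SystemOfParameters.

Section ColonFiltration.
Variables (S : comPzRingType) (f g : S).
Implicit Types J : ideal S.

Lemma regular_pair_eq J J' : ideal_eq J J' -> regular_pair f g J -> regular_pair f g J'.
Proof. by move=> E [rf rg]; split=> [a /E/rf/E//|a b /E/rg[c /E ?]]; exists c. Qed.

Lemma regular_pair_unit J : J 1 -> regular_pair f g J.
Proof.
move=> J1; have J_all x : J x by rewrite -[x]mulr1; exact: idealM.
by split=> // a b _; exists 0.
Qed.

(* 0 -> S/(J : z) -> S/J -> S/(J + z) -> 0 *)
Lemma regular_pair_colon z J J1 : (forall a, J (z * a) <-> J1 a) ->
  regular_pair f g J1 -> regular_pair f g (add_gen J z) -> regular_pair f g J.
Proof.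
move=> J1E [rf1 rg1] [rf2 rg2]; have sub := @add_gen_sub S J z.
have first a : J (f * a) -> J a.
  move=> Jfa; have [j [b [Jj aE]]] := rf2 a (sub _ Jfa).
  rewrite aE; apply: idealD => //; apply/J1E/rf1/J1E.
  have -> : z * (f * b) = f * a - f * j by rewrite aE; ring.
  by apply: idealB => //; exact: idealM.
split=> // a b Jab; have [c [j [a' [Jj aE]]]] := rg2 a b (sub _ Jab).
have aE' : a = f * c + j + z * a' by rewrite -(subrK (f * c) a) aE; ring.
have [j' [b' [Jj' bE]]] : add_gen J z (b - g * c).
  apply: rf2; exists (g * j - (g * a - f * b)), (g * a'); split.
    by apply: idealB => //; exact: idealM.
  by rewrite aE'; ring.
have [c' J1c] : exists c', J1 (a' - f * c').
  apply: (rg1 a' b'); apply/J1E.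
  have -> : z * (g * a' - f * b') = (g * a - f * b) - g * j + f * j'.
    have zb : z * b' = b - g * c - j' by rewrite bE addrAC subrr add0r.
    have -> : z * (g * a' - f * b') = g * (z * a') - f * (z * b') by ring.
    by rewrite zb aE'; ring.
  by apply: idealD; [apply: idealB|] => //; exact: idealM.
exists (c + z * c'); have -> : a - f * (c + z * c') = j + z * (a' - f * c').
  by rewrite aE'; ring.
by apply: idealD => //; apply/J1E.
Qed.

End ColonFiltration.

(** * Powers of monomial complete intersections *)

Section PowersOfTwoGenerated.
Variable S : comPzRingType.
Implicit Types (J : ideal S) (p q w x : S).

Definition unit_ideal : ideal S :=
  @Ideal S (fun _ => True) Logic.I (fun _ _ _ _ => Logic.I) (fun _ _ _ => Logic.I).

Definition scale_mem q J x := exists2 b, J b & x = q * b.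

Lemma scale0 q J : scale_mem q J 0.
Proof. by exists 0; [exact: ideal0 | rewrite mulr0]. Qed.

Lemma scaleD q J x y : scale_mem q J x -> scale_mem q J y -> scale_mem q J (x + y).
Proof.
by move=> [b Jb ->] [c Jc ->]; exists (b + c); [exact: idealD | rewrite mulrDr].
Qed.

Lemma scaleM q J a x : scale_mem q J x -> scale_mem q J (a * x).
Proof. by move=> [b Jb ->]; exists (a * b); [exact: idealM | rewrite mulrCA]. Qed.

Definition scale_ideal q J : ideal S :=
  @Ideal S (scale_mem q J) (scale0 q J) (@scaleD q J) (@scaleM q J).

Definition two_gen p q : ideal S := add_gen (scale_ideal q unit_ideal) p.

Lemma two_genP p q x : two_gen p q x <-> exists a b, x = p * a + q * b.
Proof.
split=> [[_ [a [[b _ ->] ->]]]|[a [b ->]]]; first by exists a, b; rewrite addrC.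
by exists (q * b), a; split; [exists b | rewrite addrC].
Qed.

Lemma two_genC p q : ideal_eq (two_gen p q) (two_gen q p).
Proof.
by move=> x; split=> /two_genP[a [b ->]]; apply/two_genP; exists b, a; rewrite addrC.
Qed.

(** The power (p, q)^m written as q (p, q)^(m-1) + (p^m), the shape that suits the colon by q. *)
Fixpoint two_gen_power p q m : ideal S :=
  if m is m'.+1 then add_gen (scale_ideal q (two_gen_power p q m')) (p ^+ m) else unit_ideal.

Lemma two_gen_power_expl p q m : two_gen_power p q m (p ^+ m).
Proof. by case: m => // m; exact: add_gen_in. Qed.

Lemma two_gen_power_mul p q m x y :
  two_gen p q x -> two_gen_power p q m y -> two_gen_power p q m.+1 (x * y).
Proof.
move=> /two_genP[a [b ->]]; elim: m a b y => [|m IH] a b y.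
  move=> _; exists (q * (b * y)), (a * y).
  by split; [exists (b * y) | ring].
move=> [_ [al [[be Jbe ->] ->]]].
exists (q * (b * (q * be + p ^+ m.+1 * al) + p * a * be)), (a * al); split.
  exists (b * (q * be + p ^+ m.+1 * al) + p * a * be) => //; apply: idealD.
    by apply: idealM; exists (q * be), al; split=> //; exists be.
  by have := IH a 0 be Jbe; rewrite mulr0 addr0.
by rewrite [p ^+ m.+2]exprS; ring.
Qed.

Lemma ideal_exp_two_gen I p q m : ideal_eq I (two_gen p q) ->
  ideal_eq (ideal_exp I m) (two_gen_power p q m).
Proof.
move=> IE x; split.
  apply: ideal_gen_sub => _ [f If ->]; elim: m f If => [|m IH] f If //.
  by rewrite big_ord_recl; apply: two_gen_power_mul; [exact/IE | exact: IH].
elim: m x => [|m IH] x; first by move=> _; exact: ideal_exp0.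
move=> [_ [a [[b Jb ->] ->]]]; apply: idealD.
  by apply: ideal_exp_mul (IH _ Jb); apply/IE/two_genP; exists 0, 1; ring.
rewrite exprS -mulrA; apply: ideal_exp_mul; first by apply/IE/two_genP; exists 1, 0; ring.
by apply: idealMr; apply: IH; exact: two_gen_power_expl.
Qed.

End PowersOfTwoGenerated.

(** * Filtrations by monomial ideals *)

Section MonomialFiltration.
Variables (k : fieldType) (n : nat) (f g : {mpoly k[n]}).
Local Notation S := {mpoly k[n]}.
Local Notation mon L := (\prod_(u <- L) ('X_u : S)).

Lemma mpolyXU_neq0 (t : 'I_n) : ('X_t : S) != 0.
Proof. by rewrite -msize_poly_eq0 msizeX mdeg1. Qed.

Lemma mon_neq0 (L : seq 'I_n) : mon L != 0.
Proof. by rewrite prodf_seq_neq0; apply/allP => u _; exact: mpolyXU_neq0. Qed.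

Lemma var_dvdP (t : 'I_n) (x : S) : var_ideal k (predC1 t) x <-> exists b, x = 'X_t * b.
Proof.
split=> [tx|[b ->]]; last by apply: idealMr; apply/var_idealX; rewrite /= negbK eqxx.
have /two_genP[b [c ->]] : two_gen 'X_t 0 x; last by exists b; rewrite mul0r addr0.
apply: (ideal_gen_sub (J := two_gen 'X_t 0) _ tx) => y [u]; rewrite /= negbK => /eqP -> ->.
exact: add_gen_in.
Qed.

Lemma var_dvd_mon (t : 'I_n) (L : seq 'I_n) (x b : S) : t \notin L ->
  mon L * x = 'X_t * b -> exists c, x = 'X_t * c.
Proof.
move=> tL e; apply/var_dvdP.
have : var_ideal k (predC1 t) (mon L * x) by apply/var_dvdP; exists b.
case/(proj2 (var_ideal_prime k (predC1 t))) => // /(prime_ideal_prod (var_ideal_prime k _)).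
by move=> [u uL /var_idealX]; rewrite /= negbK => /eqP ut; rewrite -ut uL in tL.
Qed.

Lemma mon_dvd (L : seq 'I_n) (x : S) : uniq L ->
  (forall t, t \in L -> exists b, x = 'X_t * b) -> exists b, x = mon L * b.
Proof.
elim: L => [|t L IH] /=; first by exists x; rewrite big_nil mul1r.
move=> /andP[tL uL] xL; have [|b xE] := IH uL.
  by move=> s sL; apply: xL; rewrite inE sL orbT.
have [c] := xL t (mem_head _ _); rewrite xE => /(var_dvd_mon tL)[d ->].
by exists d; rewrite big_cons; ring.
Qed.

(** One variable is removed from the first generator: the colon of (x_t w, w') by x_t is (w, w') and
    the sum with (x_t) is (x_t, w'). The first hypothesis says that x_t and w' have no common
    factor, and it also admits w' = 0. *)
Lemma regular_pair_two_gen (t : 'I_n) (w w' : S) :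
    (forall b c, w' * b = 'X_t * c -> exists d, w' * b = 'X_t * (w' * d)) ->
    regular_pair f g (two_gen w w') -> regular_pair f g (two_gen 'X_t w') ->
  regular_pair f g (two_gen ('X_t * w) w').
Proof.
move=> tw' rw rt; apply: (regular_pair_colon (z := 'X_t)) rw _.
  move=> a; split=> /two_genP[b [c e]]; apply/two_genP; last first.
    by exists b, ('X_t * c); rewrite e; ring.
  have [d dE] : exists d, w' * c = 'X_t * (w' * d).
    by apply: (tw' c (a - w * b)); rewrite mulrBr e; ring.
  exists b, d; apply: (mulfI (mpolyXU_neq0 t)); rewrite e dE; ring.
apply: regular_pair_eq rt => x; split=> [/two_genP[b [c ->]]|].
  by exists (w' * c), b; split; [apply/two_genP; exists 0, c; ring | ring].
move=> [_ [b [/two_genP[c [d ->]] ->]]]; apply/two_genP.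
by exists (w * c + b), d; ring.
Qed.

Lemma regular_pair_principal (L : seq 'I_n) (w : S) :
    (forall t, t \in L -> regular_pair f g (two_gen 'X_t 0)) ->
    regular_pair f g (two_gen w 0) ->
  regular_pair f g (two_gen (mon L * w) 0).
Proof.
move=> rL rw; elim: L rL => [|t L IH] rL; first by rewrite big_nil mul1r.
rewrite big_cons -mulrA; apply: regular_pair_two_gen.
- by move=> b c _; exists 0; rewrite !mul0r mulr0.
- by apply: IH => s sL; apply: rL; rewrite inE sL orbT.
- exact/rL/mem_head.
Qed.

Lemma mon_coprime (t : 'I_n) (L : seq 'I_n) (b c : S) : t \notin L ->
  mon L * b = 'X_t * c -> exists d, mon L * b = 'X_t * (mon L * d).
Proof. by move=> tL /(var_dvd_mon tL)[d ->]; exists d; ring. Qed.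

Section FourCycle.
Variables (A B : seq 'I_n).
Hypotheses (uA : uniq A) (uB : uniq B).
Hypothesis AB : forall t s, t \in A -> s \in B -> t != s.
Hypothesis rAB : forall t s, t \in A -> s \in B -> regular_pair f g (two_gen 'X_t 'X_s).

Lemma regular_pair_var_mon t L : t \in A -> {subset L <= B} ->
  regular_pair f g (two_gen 'X_t (mon L)).
Proof.
move=> tA; elim: L => [|s L IH] sL.
  by apply: regular_pair_unit; apply/two_genP; exists 0, 1; rewrite big_nil; ring.
have sB : s \in B by apply: sL; rewrite mem_head.
apply: (regular_pair_eq (two_genC _ _)); rewrite big_cons.
apply: regular_pair_two_gen.
- move=> b c; have := @mon_coprime s [:: t] b c; rewrite big_seq1 inE; apply.
  by rewrite eq_sym AB.
- apply: (regular_pair_eq (two_genC _ _)); apply: IH => u uL.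
  by apply: sL; rewrite inE uL orbT.
- by apply: (regular_pair_eq (two_genC _ _)); exact: rAB.
Qed.

Lemma regular_pair_mon_expn L m : {subset L <= A} ->
    regular_pair f g (two_gen (mon A ^+ m) (mon B)) ->
  regular_pair f g (two_gen (mon L * mon A ^+ m) (mon B)).
Proof.
move=> LA rm; elim: L LA => [|t L IH] LA; first by rewrite big_nil mul1r.
have tA : t \in A by apply: LA; rewrite mem_head.
rewrite big_cons -mulrA; apply: regular_pair_two_gen.
- move=> b c; apply: mon_coprime; apply/negP => tB.
  by have := AB tA tB; rewrite eqxx.
- by apply: IH => u uL; apply: LA; rewrite inE uL orbT.
- exact: regular_pair_var_mon.
Qed.

(** With p and q the monomials of A and B, the colon of (p, q)^(m+1) by q is (p, q)^m, as p and q
    are coprime, and adding q gives (p^(m+1), q). *)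
Lemma regular_pair_two_gen_power m :
  regular_pair f g (two_gen_power (mon A) (mon B) m).
Proof.
elim: m => [|m IH]; first exact: regular_pair_unit.
apply: (regular_pair_colon (z := mon B)) IH _ => [a|].
  split=> [[_ [al [[be Jbe ->] e]]]|Ja]; last first.
    by apply: add_gen_sub; exists a.
  have [c cE] : exists c, al = mon B * c.
    apply: mon_dvd => // s sB.
    (* The power of the monomial of A is read as the monomial of a repeated list, so that
       [var_dvd_mon] applies to it. *)
    have sA : s \notin flatten (nseq m.+1 A).
      apply/flattenP => -[_ /nseqP[-> _] sA].
      by have := AB sA sB; rewrite eqxx.
    apply: (@var_dvd_mon s (flatten (nseq m.+1 A)) al (\prod_(u <- rem s B) 'X_u * (a - be)) sA).
    have -> : mon (flatten (nseq m.+1 A)) = mon A ^+ m.+1.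
      elim: (m.+1) => [|l IHl]; first by rewrite big_nil.
      by rewrite /= big_cat IHl exprS.
    have -> : mon A ^+ m.+1 * al = mon B * (a - be) by rewrite mulrBr e; ring.
    by rewrite (big_rem s) //= -mulrA.
  have -> : a = be + mon A ^+ m.+1 * c.
    by apply: (mulfI (mon_neq0 B)); rewrite e cE; ring.
  apply: idealD => //; rewrite exprS -mulrA; apply: idealM; apply: idealMr.
  exact: two_gen_power_expl.
have rexp l : regular_pair f g (two_gen (mon A ^+ l) (mon B)).
  elim: l => [|l IHl]; last by rewrite exprS; exact: regular_pair_mon_expn.
  by apply: regular_pair_unit; apply/two_genP; exists 1, 0; ring.
apply: regular_pair_eq (rexp m.+1) => x; split=> [/two_genP[b [c ->]]|].
  exists (mon A ^+ m.+1 * b), c; split=> //.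
  by exists 0, b; split; [exact: ideal0 | ring].
move=> [_ [b [[_ [c [[d _ ->] ->]]] ->]]]; apply/two_genP.
by exists c, (d + b); ring.
Qed.

End FourCycle.

End MonomialFiltration.

(** * Three vertices and the four-cycle *)

Section GraphRing.
Variables (k : fieldType) (n : nat) (G : rel 'I_n).
Hypothesis hG : simple_graph G.
Local Notation S := {mpoly k[n]}.
Local Notation I := (graph_ideal k G).
Local Notation mon L := (\prod_(u <- L) ('X_u : S)).

(** If no P_ij lay in Q, choose an element of each outside Q. Their product is in I_G, its m-th
    power in I_G^m, hence in Q, against primality. *)
Lemma prime_contains_edge (Q : ideal S) m : prime_ideal Q ->
    ideal_sub (ideal_exp I m) Q ->
  exists i j, G i j /\ ideal_sub (var_ideal k (pred2 i j)) Q.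
Proof.
move=> pQ IQ; apply: contrapT => nex.
have /choice[h hP] : forall p : 'I_n * 'I_n, exists h, G p.1 p.2 ->
    var_ideal k (pred2 p.1 p.2) h /\ ~ Q h.
  move=> [i j] /=; case: (boolP (G i j)) => [ij|]; last by exists 0.
  have /existsNP[h /not_implyP[Ph nQh]] : ~ ideal_sub (var_ideal k (pred2 i j)) Q.
    by move=> sub; apply: nex; exists i, j.
  by exists h.
pose r := [seq p <- enum [set: 'I_n * 'I_n] | G p.1 p.2].
have Ih : I (\prod_(p <- r) h p).
  move=> i j ij; apply/edge_primeE.
  have pr : (i, j) \in r by rewrite mem_filter ij mem_enum inE.
  by rewrite (big_rem _ pr); apply: idealMr; exact: (hP (i, j) ij).1.
have : Q ((\prod_(p <- r) h p) ^+ m).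
  apply: IQ; apply: mem_ideal_gen; exists (fun=> \prod_(p <- r) h p) => //.
  by rewrite prodr_const card_ord.
move=> /(prime_ideal_expr pQ)/(prime_ideal_prod pQ)[p].
by rewrite mem_filter => /andP[Gp _] /(hP p Gp).2.
Qed.

(** Dimension and depth are 2 at every maximal ideal. A chain of primes starts above some P_ij, so
    it has length at most 2; the regular pair has length 2, and through the chain it produces it
    also attains the dimension. *)
Lemma cohen_macaulay_regular_pair m :
    (forall F1 F2 : {poly k}, F1 \is monic -> F2 \is monic ->
      regular_pair (map_poly (@mpolyC n k) F1).[sum_vars k n]
        (map_poly (@mpolyC n k) F2).[neg_pairs k n] (ideal_exp I m)) ->
  cohen_macaulay_ideal (ideal_exp I m).
Proof.
move=> reg; split; first exact/noetherian_quot/noetherian_mpoly.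
move=> p pmax; have H := localization_localizes pmax.
set R := localization _ in H *; set mR := loc_maximal _ in H *.
pose M := comap (to_quot (ideal_exp I m)) p.
have JM : ideal_sub (ideal_exp I m) M := loc_le H.
have maxM : maximal_ideal M := loc_max H.
have bound e : prime_chain R e -> (e <= 2)%N.
  move=> /(prime_chain_comap H)[c [pc sc]]; have [p0 J0] := pc 0%N isT.
  have [i [j [ij Pij]]] := prime_contains_edge p0 J0.
  pose tau (u : 'I_2) := if u == ord0 then i else j.
  apply: (@prime_chain_mpoly_bound k n 2 e tau c) => // [u v|u lt_u|u].
  - have nij := graph_neq hG ij; rewrite /tau => e_uv; apply/eqP; move: e_uv.
    case: eqP => [->|/eqP u0]; case: eqP => [->//|/eqP v0] e_ij.
    + by rewrite e_ij eqxx in nij.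
    + by rewrite e_ij eqxx in nij.
    + by case: u v u0 v0 {e_ij} => [[|[|//]] ?] [[|[|//]] ?].
  - by have [] := pc u lt_u.
  move=> nu; apply: Pij; apply/var_idealX; apply: contra nu => /orP[]/eqP->.
    by apply/codomP; exists ord0; rewrite /tau eqxx.
  by apply/codomP; exists (lift ord0 ord0); rewrite /tau.
have [f [g fg]] : exists f g, regular_in mR [:: f; g].
  have [i [j [ij Pij]]] := prime_contains_edge (maximal_prime maxM) JM.
  have MX u : u != i -> u != j -> M 'X_u.
    by move=> ui uj; apply: Pij; apply/var_idealX; rewrite /= negb_or ui.
  have [F1 mF1 M1] := mpoly_residue_algebraic (sum_vars k n) maxM MX.
  have [F2 mF2 M2] := mpoly_residue_algebraic (neg_pairs k n) maxM MX.
  by eexists; eexists; exact: (regular_pair_loc H M1 M2 (reg _ _ mF1 mF2)).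
have chain s : regular_in mR s -> prime_chain R (size s).
  move=> [rs sm]; have [c [pc sc _]] := regular_seq_chain (loc_max_prime H) rs sm.
  by exists c.
exists 2; first by split; [exact: chain fg | exact: bound].
by split=> [|s /chain/bound]; first by exists [:: f; g].
Qed.

Lemma mon_mem_edge (L : seq 'I_n) i j t : t \in L -> off i j t ->
  edge_prime k i j (mon L).
Proof.
move=> tL ot; apply/edge_primeE; rewrite (big_rem _ tL); apply: idealMr.
by apply/var_idealX; rewrite /= negb_or.
Qed.

Lemma var_ideal_off i j (T : pred 'I_n) : {subset T <= pred2 i j} ->
  G i j -> forall x, I x -> var_ideal k T x.
Proof. by move=> sT ij x /(_ i j ij)/edge_primeE; exact: var_idealS. Qed.

Section ThreeVertices.
Hypothesis n_eq3 : n = 3.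

(** For n = 3 each P_ij is generated by the variable opposite to the edge; these are the variables
    that occur, and I_G is generated by their product. *)
Definition off_edge : pred 'I_n := [pred t | [exists i, [exists j, G i j && off i j t]]].

Lemma third_vertex (i j : 'I_n) : exists t, off i j t.
Proof.
apply: contrapT => /forallNP no; have : (n <= size [:: i; j])%N.
  rewrite -[n in (n <= _)%N]card_ord; apply: leq_trans (card_size [:: i; j]).
  apply: subset_leq_card; apply/fintype.subsetP => u _; rewrite !inE.
  by have /negP := no u; rewrite /off negb_and !negbK.
by rewrite /=; move: n_eq3; clear; lia.
Qed.

Lemma off_third (i j t : 'I_n) : i != j -> off i j t -> {subset predC1 t <= pred2 i j}.
Proof.
move=> ij /andP[ti tj] u ut; rewrite /in_mem /=; apply: contrapT => /negP/norP[ui uj].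
have tu : t != u by rewrite eq_sym; exact: ut.
have : (size [:: i; j; t; u] <= n)%N.
  rewrite -[n in (_ <= n)%N]card_ord -(card_uniqP (_ : uniq [:: i; j; t; u])) ?max_card //.
  by rewrite /= !inE !negb_or ij ![i == _]eq_sym ![j == _]eq_sym ti tj ui uj tu.
by rewrite /=; move: n_eq3; clear; lia.
Qed.

Lemma graph_ideal_three : ideal_eq I (two_gen (mon (enum off_edge)) 0).
Proof.
move=> x; split.
  move=> Ix; have [|b ->] := @mon_dvd k n (enum off_edge) x (enum_uniq _); last first.
    by apply/two_genP; exists b, 0; ring.
  move=> t; rewrite mem_enum => /existsP[i /existsP[j /andP[ij ot]]].
  apply/var_dvdP; apply: (var_ideal_off _ ij Ix).
  exact: off_third (graph_neq hG ij) ot.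
move=> /two_genP[a [b ->]]; rewrite mul0r addr0 => i j ij; apply: idealMr.
have [t ot] := third_vertex i j; apply: (mon_mem_edge (t := t)) => //.
by rewrite mem_enum; apply/existsP; exists i; apply/existsP; exists j; rewrite ij.
Qed.

Lemma cohen_macaulay_three m : cohen_macaulay_ideal (ideal_exp I m).
Proof.
apply: cohen_macaulay_regular_pair => F1 F2 mF1 mF2; set f := _.[sum_vars k n]; set g := _.[neg_pairs k n].
apply: (@regular_pair_eq _ f g (two_gen (mon (enum off_edge) ^+ m) 0)).
  move=> x; split.
    move=> /two_genP[a [b ->]]; rewrite mul0r addr0.
    apply/(ideal_exp_two_gen _ graph_ideal_three); apply: idealMr.
    exact: two_gen_power_expl.
  move=> /(ideal_exp_two_gen _ graph_ideal_three); case: m => [|m].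
    by move=> _; apply/two_genP; exists x, 0; ring.
  by move=> [_ [a [[b _ ->] ->]]]; apply/two_genP; exists a, b; ring.
elim: m => [|m IH].
  by apply: regular_pair_unit; apply/two_genP; exists 1, 0; ring.
rewrite exprS; apply: regular_pair_principal IH => t.
rewrite mem_enum => /existsP[i /existsP[j /andP[ij ot]]].
apply: regular_pair_eq (edge_regular_pair mF1 mF2 (graph_neq hG ij)) => x; split.
  move=> Px; apply/two_genP.
  have /var_dvdP[b ->] : var_ideal k (predC1 t) x; last by exists b, 0; ring.
  by apply: var_idealS Px; exact: off_third (graph_neq hG ij) ot.
move=> /two_genP[a [b ->]]; rewrite mul0r addr0; apply: idealMr.
by apply/var_idealX; rewrite /= negb_or.
Qed.

Lemma complete_intersection_three : complete_intersection I.
Proof.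
set h := mon (enum off_edge).
have IE x : I x <-> ideal_seq [:: h] x.
  rewrite (ideal_seq_rcons [::] h x); split.
    by move=> /graph_ideal_three/two_genP[a [b ->]]; exists 0, a; split; [exact/ideal_seq_nil | by rewrite mul0r addr0 add0r].
  by move=> [a [b [/ideal_seq_nil -> ->]]]; apply/graph_ideal_three/two_genP; exists b, 0; rewrite mul0r addr0 add0r.
exists [:: h] => //; split.
  have n0 : (0 < n)%N by rewrite n_eq3.
  have [j ij] : exists j, G (Ordinal n0) j by case: hG.
  move=> /IE/(var_ideal_off (fun _ => id) ij).
  exact: (proj1 (var_ideal_prime k _)).
case=> [|//] b _; rewrite [take _ _]/= [nth _ _ _]/= !ideal_seq_nil => /eqP.
by rewrite mulf_eq0 (negbTE (mon_neq0 k _)) => /eqP.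
Qed.

End ThreeVertices.

Section FourCycleGraph.
Variables a b c d : 'I_n.
Hypotheses (u4 : uniq [:: a; b; c; d]) (all4 : forall i, i \in [:: a; b; c; d]).
Hypotheses (ab : G a b) (bc : G b c) (cd : G c d) (da : G d a).
Hypotheses (nac : ~~ G a c) (nbd : ~~ G b d).

Let neqs : [/\ a != b, a != c & a != d] /\ [/\ b != c, b != d & c != d].
Proof.
by move: u4; rewrite /= !inE !negb_or !andbT => /and3P[/and3P[? ? ?] /andP[? ?] ?].
Qed.

(** Removing one vertex from each diagonal leaves an edge of the cycle, so the primes P_ij include
    all the ideals (x_t, x_s). *)
Lemma four_cycle_edge t s : t \in [:: a; c] -> s \in [:: b; d] ->
  exists i j, G i j /\ forall u, pred2 i j u = (u != t) && (u != s).
Proof.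
have [[nab nac' nad] [nbc nbd' ncd]] := neqs.
have sy := (eq_sym b a, eq_sym c a, eq_sym d a, eq_sym c b, eq_sym d b, eq_sym d c).
rewrite !inE => /orP[]/eqP -> /orP[]/eqP ->.
- exists c, d; split=> // u; have := all4 u; rewrite !inE /=.
  by case/or4P=> /eqP->; rewrite ?sy ?eqxx ?(negbTE nab) ?(negbTE nac') ?(negbTE nad) ?(negbTE nbc) ?(negbTE nbd') ?(negbTE ncd).
- exists b, c; split=> // u; have := all4 u; rewrite !inE /=.
  by case/or4P=> /eqP->; rewrite ?sy ?eqxx ?(negbTE nab) ?(negbTE nac') ?(negbTE nad) ?(negbTE nbc) ?(negbTE nbd') ?(negbTE ncd).
- exists d, a; split=> // u; have := all4 u; rewrite !inE /=.
  by case/or4P=> /eqP->; rewrite ?sy ?eqxx ?(negbTE nab) ?(negbTE nac') ?(negbTE nad) ?(negbTE nbc) ?(negbTE nbd') ?(negbTE ncd).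
- exists a, b; split=> // u; have := all4 u; rewrite !inE /=.
  by case/or4P=> /eqP->; rewrite ?sy ?eqxx ?(negbTE nab) ?(negbTE nac') ?(negbTE nad) ?(negbTE nbc) ?(negbTE nbd') ?(negbTE ncd).
Qed.

Lemma two_gen_vars t s (T : pred 'I_n) : (forall u, T u = (u != t) && (u != s)) ->
  ideal_eq (var_ideal k T) (two_gen 'X_t 'X_s).
Proof.
move=> TE x; split.
  apply: ideal_gen_sub => y [u]; rewrite TE negb_and !negbK => /orP[]/eqP -> ->; apply/two_genP.
    by exists 1, 0; ring.
  by exists 0, 1; ring.
move=> /two_genP[p [q ->]]; apply: idealD; apply: idealMr; apply/var_idealX;
  by rewrite TE negb_and !negbK eqxx ?orbT.
Qed.

Lemma graph_ideal_four_cycle : ideal_eq I (two_gen (mon [:: a; c]) (mon [:: b; d])).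
Proof.
have mon2 s t : mon [:: s; t] = 'X_s * 'X_t by rewrite big_cons big_seq1.
have [[nab nac' nad] [nbc nbd' ncd]] := neqs.
rewrite !mon2 => x; split; last first.
  move=> /two_genP[p [q ->]]; apply: idealD; apply: idealMr.
    exact: (graph_nonedge hG).
  exact: (graph_nonedge hG).
move=> Ix; apply: mpoly_mem_ideal => m mx.
have pick t s : t \in [:: a; c] -> s \in [:: b; d] -> (m t != 0%N) || (m s != 0%N).
  move=> tA sB; have [i [j [ij TE]]] := four_cycle_edge tA sB.
  have /var_ideal_weight/(_ _ mx) : var_ideal k (pred2 i j) x.
    exact: (var_ideal_off (fun _ => id) ij Ix).
  apply: contraLR; rewrite negb_or !negbK => /andP[/eqP mt /eqP ms].
  rewrite -ltnNge ltnS leqn0 /weight big1 // => u _; rewrite TE negb_and !negbK.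
  by case: eqP => [->|_]; rewrite ?mt ?muln0 //; case: eqP => [->|_]; rewrite ?ms.
have two s t : s != t -> m s != 0%N -> m t != 0%N -> exists r : S, 'X_[m] = 'X_s * 'X_t * r.
  move=> st ms mt; have le : (U_(s) + U_(t) <= m)%MM.
    apply/mnm_lepP => u; rewrite mnmDE !mnm1E.
    case: (eqVneq s u) => [<-|_]; first by rewrite eq_sym (negbTE st) addn0 lt0n.
    by case: (eqVneq t u) => [<-|//]; rewrite lt0n.
  by exists 'X_[m - (U_(s) + U_(t))]; rewrite -!mpolyXD addmC submK.
have inA : (a \in [:: a; c]) * (c \in [:: a; c]) by rewrite !inE !eqxx orbT.
have inB : (b \in [:: b; d]) * (d \in [:: b; d]) by rewrite !inE !eqxx orbT.
(* A monomial missing a or c must contain both b and d, since it meets every pair taken across the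
   diagonals. *)
have [ma|ma] := eqVneq (m a) 0%N; last have [mc|mc] := eqVneq (m c) 0%N.
- have [|//|r ->] := two b d nbd'.
  + by have := pick a b inA.1 inB.1; rewrite ma.
  + by have := pick a d inA.1 inB.2; rewrite ma.
  by apply/two_genP; exists 0, r; ring.
- have [|//|r ->] := two b d nbd'.
  + by have := pick c b inA.2 inB.1; rewrite mc.
  + by have := pick c d inA.2 inB.2; rewrite mc.
  by apply/two_genP; exists 0, r; ring.
by have [r ->] := two a c nac' ma mc; apply/two_genP; exists r, 0; ring.
Qed.

Let AB t s : t \in [:: a; c] -> s \in [:: b; d] -> t != s.
Proof.
have [[nab nac' nad] [nbc nbd' ncd]] := neqs.
by rewrite !inE => /orP[]/eqP -> /orP[]/eqP ->; rewrite // eq_sym.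
Qed.

Let uA : uniq [:: a; c]. Proof. by have [[_ e _] _] := neqs; rewrite /= inE e. Qed.

Let uB : uniq [:: b; d]. Proof. by have [_ [_ e _]] := neqs; rewrite /= inE e. Qed.

Lemma cohen_macaulay_four_cycle m : cohen_macaulay_ideal (ideal_exp I m).
Proof.
apply: cohen_macaulay_regular_pair => F1 F2 mF1 mF2.
apply: (regular_pair_eq (fun x => iff_sym (ideal_exp_two_gen m graph_ideal_four_cycle x))).
apply: regular_pair_two_gen_power => // t s tA sB.
have [i [j [ij TE]]] := four_cycle_edge tA sB.
apply: regular_pair_eq (edge_regular_pair mF1 mF2 (graph_neq hG ij)).
exact: two_gen_vars.
Qed.

Lemma complete_intersection_four_cycle : complete_intersection I.
Proof.
set p := mon [:: a; c]; set q := mon [:: b; d].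
have fP x : ideal_seq [:: p] x <-> exists r, x = p * r.
  rewrite (ideal_seq_rcons [::] p x); split=> [[u [v [/ideal_seq_nil -> ->]]]|[v ->]].
    by exists v; rewrite add0r.
  by exists 0, v; rewrite add0r; split=> //; exact/ideal_seq_nil.
have IE x : I x <-> ideal_seq [:: p; q] x.
  rewrite (ideal_seq_rcons [:: p] q x); split.
    by move=> /graph_ideal_four_cycle/two_genP[u [v ->]]; exists (p * u), v; split=> //; apply/fP; exists u.
  move=> [u [v [/fP[r ->] ->]]]; apply/graph_ideal_four_cycle/two_genP.
  by exists r, v.
exists [:: p; q] => //; split.
  move=> /IE/(var_ideal_off (fun _ => id) ab).
  exact: (proj1 (var_ideal_prime k _)).
case=> [|[|//]] x _; rewrite [take _ _]/= [nth _ _ _]/=.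
  rewrite !ideal_seq_nil => /eqP.
  by rewrite mulf_eq0 (negbTE (mon_neq0 k _)) => /eqP.
rewrite !fP => -[r e]; apply: mon_dvd => // t tA.
have pE : p = 'X_t * \prod_(u <- rem t [:: a; c]) 'X_u by rewrite /p (big_rem _ tA).
apply: (@var_dvd_mon k n t [:: b; d] x (\prod_(u <- rem t [:: a; c]) 'X_u * r)).
  by apply/negP => tB; have := AB tA tB; rewrite eqxx.
by rewrite mulrA -pE.
Qed.

End FourCycleGraph.

End GraphRing.

Local Close Scope ring_scope.

Theorem mainTheorem8 (k : fieldType) (n : nat) (hn : 3 <= n)
    (G : rel 'I_n) (hG : simple_graph G) :
  (exists2 m : nat, 3 <= m
     & cohen_macaulay_ideal (ideal_exp (graph_ideal k G) m))
  <-> complete_intersection (graph_ideal k G).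
Proof.
have three : (n <= 3)%N -> n = 3 by move=> n3; apply/eqP; rewrite eqn_leq n3.
split=> [[m m3 cm]|ci].
  have m0 : (0 < m)%N by apply: leq_trans m3.
  have [c [pc sc]] := graph_chain k hG (leq_trans (isT : 0 < 3)%N hn) m0.
  have deep := cohen_macaulay_deep cm pc sc.
  case: (deep_classification hG m3 deep) => [/three n3|].
    exact: complete_intersection_three.
  move=> [a [b [c' [d [u4 all4 [ab bc cd da] nac nbd]]]]].
  exact: (complete_intersection_four_cycle k hG u4 all4 ab bc cd da nac nbd).
(* In both remaining cases all powers are Cohen-Macaulay, so the least admissible exponent is
   taken. *)
exists 3 => //; case: (complete_intersection_classification hG hn ci) => [/three n3|].
  exact: cohen_macaulay_three.
move=> [a [b [c' [d [u4 all4 [ab bc cd da] nac nbd]]]]].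
exact: (cohen_macaulay_four_cycle k hG u4 all4 ab bc cd da nac nbd).
Qed.
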